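(* Let $d\ge 1$, $1<\gamma\le 2$, $\beta>0$, $\lambda>1$. Then we have the decomposition $$\frac{|\nabla|^{\gamma}}{\log^{\beta}(\lambda+|\nabla|)}=C_\beta\int_{\gamma-1}^{\gamma}\tau^{\beta-1}\,|\nabla|^{\gamma-\tau}\,d\tau+C_\beta\int_0^{\gamma-1}\tau^{\beta-1}\Bigl(|\nabla|^{\gamma-\tau}-\lambda\,\tau\,|\nabla|^{\gamma-\tau-1}\Bigr)\,d\tau+P,$$ where $P$ is a smooth Fourier multiplier which maps $L^p$ to $L^p$ for all $1\le p\le+\infty$. More precisely, for any function $f$, $$(Pf)(x)=(K*f)(x)=\int_{\mathbb R^d}K(x-y)f(y)\,dy,$$ and $\|K\|_{L^1_x}\le \mathrm{Const}$.
   Context: For a function $m$ on $[0,\infty)$, $m(|\nabla|)$ denotes the Fourier multiplier on $\mathbb R^d$ with symbol $m(|\xi|)$, i.e. $\widehat{m(|\nabla|)f}(\xi)=m(|\xi|)\hat f(\xi)$, where $\hat f(\xi)=\int_{\mathbb R^d}f(x)e^{-i\xi\cdot x}\,dx$; $\log^\beta(y)=(\log y)^\beta$. $C_\beta>0$ denotes a constant depending only on $\beta$, $K$ is the convolution kernel of $P$ on $\mathbb R^d$, $L^p=L^p(\mathbb R^d)$, and $\mathrm{Const}$ denotes a finite constant. The operator identity is equivalent to the corresponding identity of symbols (replace $|\nabla|$ by $|\xi|$ and $P$ by its symbol $P(\xi)$).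
   Formalization: The symbol of P is proved smooth only away from the origin: smoothness at ξ = 0 is false, since there P(ξ) behaves like a nonzero multiple of a power of 1/log(1/|ξ|) (for example C/log(1/|ξ|) when β=1, γ=2, λ=2). *)

(* Defs.v *)
From HB Require Import structures.
From mathcomp Require Import all_boot all_order all_algebra.
From mathcomp Require Import complex.
From mathcomp Require Import all_classical all_reals all_analysis.

Set Implicit Arguments.
Unset Strict Implicit.
Unset Printing Implicit Defensive.
Import Order.TTheory GRing.Theory Num.Theory.
Import numFieldNormedType.Exports.
Local Open Scope classical_set_scope.
Local Open Scope ring_scope.
Local Open Scope complex_scope.

(* R^d is represented by ['rV[R]_d], with the sigma-algebra generated by the
   coordinate maps (as the library does for tuples), which is the Borel
   sigma-algebra. *)
Section measurable_rV.
Context {R : realType} (n : nat).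

Let coord (i : 'I_n) (x : 'rV[R]_n) : R := x ord0 i.

Let rV_set0 : g_sigma_preimage coord set0.
Proof. exact: sigma_algebra0. Qed.

Let rV_setC A : g_sigma_preimage coord A -> g_sigma_preimage coord (~` A).
Proof. exact: sigma_algebraC. Qed.

Let rV_bigcup (F : (set 'rV[R]_n)^nat) :
  (forall i, g_sigma_preimage coord (F i)) ->
  g_sigma_preimage coord (\bigcup_i F i).
Proof. exact: sigma_algebra_bigcup. Qed.

HB.instance Definition _ :=
  @isMeasurable.Build (measure_tuple_display default_measure_display)
    'rV[R]_n (g_sigma_preimage coord) rV_set0 rV_setC rV_bigcup.

Lemma measurable_coord (i : 'I_n) :
  measurable_fun [set: 'rV[R]_n] (fun x => x ord0 i).
Proof.
move=> _ Y mY; rewrite setTI; apply: sub_sigma_algebra => /=.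
rewrite -bigcup_seq/=; exists i => /=; first by rewrite mem_index_enum.
by exists Y => //; rewrite setTI.
Qed.

Lemma measurable_fun_rV d (T : measurableType d) (f : T -> 'rV[R]_n) :
  (forall i, measurable_fun [set: T] (fun t => f t ord0 i)) ->
  measurable_fun [set: T] f.
Proof.
move=> mf _ A mA; rewrite setTI.
apply: (mA [set B | measurable (f @^-1` B)]); split.
  split => /= [|B mB|F mF].
  - by rewrite preimage_set0.
  - by rewrite setTD preimage_setC; exact: measurableC.
  - by rewrite preimage_bigcup; exact: bigcup_measurable.
rewrite -bigcup_seq => B [i _] [C mC <-] /=.
by rewrite setTI -[X in measurable X]setTI; exact: (mf i).
Qed.

End measurable_rV.

(* Appends a last coordinate: (x_0, ..., x_(n-1)), t |-> (x_0, ..., x_(n-1), t) *)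
Definition rV_rcons (R : realType) n (p : 'rV[R]_n * R) : 'rV[R]_n.+1 :=
  \row_(i < n.+1) oapp (fun j => p.1 ord0 j) p.2 (unlift ord_max i).

Lemma measurable_rV_rcons (R : realType) n :
  measurable_fun [set: 'rV[R]_n * R] (@rV_rcons R n).
Proof.
apply: measurable_fun_rV => i; case E : (unlift ord_max i) => [j|].
- rewrite (_ : (fun t => _) = (fun x : 'rV[R]_n => x ord0 j) \o fst).
    by apply: measurableT_comp => //; exact: measurable_coord.
  by apply/funext => t /=; rewrite mxE E.
- rewrite (_ : (fun t => _) = snd) //.
  by apply/funext => t /=; rewrite mxE E.
Qed.

Section lebesgue_rV.
Context {R : realType}.

Section step.
Context n (m : {measure set 'rV[R]_n -> \bar R}).

Definition lebesgue_rV_step : set 'rV[R]_n.+1 -> \bar R :=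
  pushforward (m \x lebesgue_measure)%E (@rV_rcons R n).

Let step0 : lebesgue_rV_step set0 = 0%E.
Proof. by rewrite /lebesgue_rV_step /pushforward preimage_set0 measure0. Qed.

Let mstep A : measurable A -> measurable (@rV_rcons R n @^-1` A).
Proof. by move=> mA; rewrite -[X in measurable X]setTI; exact: measurable_rV_rcons. Qed.

Let step_ge0 A : (0 <= lebesgue_rV_step A)%E.
Proof. by rewrite /lebesgue_rV_step /pushforward measure_ge0. Qed.

Let step_sigma_additive : semi_sigma_additive lebesgue_rV_step.
Proof.
move=> F mF tF mUF; rewrite /lebesgue_rV_step /pushforward preimage_bigcup.
apply: measure_semi_sigma_additive.
- by move=> k; exact: mstep.
- apply/trivIsetP => /= i j _ _ ij; rewrite -preimage_setI.
  by move/trivIsetP : tF => /(_ _ _ _ _ ij) ->//; rewrite preimage_set0.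
- by rewrite -preimage_bigcup; exact: mstep.
Qed.

HB.instance Definition _ := isMeasure.Build _ _ _
  lebesgue_rV_step step0 step_ge0 step_sigma_additive.

End step.

(* Lebesgue measure on R^n: the n-fold product of the library's one *)
Fixpoint lebesgue_rV n : {measure set 'rV[R]_n -> \bar R} :=
  match n with
  | 0%N => dirac (0 : 'rV[R]_0)
  | n'.+1 => lebesgue_rV_step (lebesgue_rV n')
  end.

End lebesgue_rV.

(* Sanity check: the measure of a box is its volume. *)
Lemma lebesgue_rV_box (R : realType) n (A : 'I_n -> set R) :
  (forall i, measurable (A i)) ->
  lebesgue_rV n [set x | forall i, A i (x ord0 i)] =
  (\prod_(i < n) lebesgue_measure (A i))%E.
Proof.
elim: n A => [|n IH] A mA.
  rewrite big_ord0 /= diracE mem_set // => -[]//.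
rewrite big_ord_recr /= -IH //.
have mB : measurable [set x : 'rV[R]_n |
    forall i, A (widen_ord (leqnSn n) i) (x ord0 i)].
  rewrite (_ : [set x | _] = \bigcap_(i in [set: 'I_n])
    ((fun x : 'rV[R]_n => x ord0 i) @^-1` A (widen_ord (leqnSn n) i))).
    apply: fin_bigcap_measurable => [|i _]; first exact: finite_finset.
    by rewrite -[X in measurable X]setTI; exact: measurable_coord.
  by apply/seteqP; split=> [x h i _|x h i]; [exact: (h i)|exact: (h i Logic.I)].
rewrite -(product_measure1E (lebesgue_rV n) lebesgue_measure mB (mA ord_max)).
rewrite /lebesgue_rV_step /pushforward; congr (_ _).
apply/seteqP; split=> -[x t] /=.
- move=> h; split=> [i|]; last first.
    by have := h ord_max; rewrite mxE unlift_none.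
  have := h (widen_ord (leqnSn n) i); rewrite mxE.
  have -> : widen_ord (leqnSn n) i = lift ord_max i.
    by apply/val_inj; rewrite /= /bump leqNgt ltn_ord.
  by rewrite liftK.
- move=> [h1 h2] i; rewrite mxE; case: unliftP => [j ->|->] //=.
  have <- : widen_ord (leqnSn n) j = lift ord_max j.
    by apply/val_inj; rewrite /= /bump leqNgt ltn_ord.
  exact: h1.
Qed.

(* The norm of ['rV[R]_d] as a normed module is the sup norm, hence: *)
Definition enorm (R : realType) d (x : 'rV[R]_d) : R :=
  Num.sqrt (\sum_(i < d) x ord0 i ^+ 2).

Definition dotp (R : realType) d (x y : 'rV[R]_d) : R :=
  \sum_(i < d) x ord0 i * y ord0 i.

Section complex_valued.
Context d (T : measurableType d) (R : realType).
Variable mu : {measure set T -> \bar R}.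
Implicit Type f : T -> R[i].

Definition cmeasurable_fun f :=
  measurable_fun [set: T] (fun x => complex.Re (f x)) /\
  measurable_fun [set: T] (fun x => complex.Im (f x)).

Definition cintegrable f :=
  mu.-integrable [set: T] (fun x => (complex.Re (f x))%:E) /\
  mu.-integrable [set: T] (fun x => (complex.Im (f x))%:E).

Definition cintegral f : R[i] :=
  (\int[mu]_x complex.Re (f x)) +i* (\int[mu]_x complex.Im (f x)).

Definition cLnorm (p : \bar R) f : \bar R :=
  'N[mu]_p[(fun x => (Normc.normc (f x))%:E)]%E.

Definition cLp (p : \bar R) f :=
  cmeasurable_fun f /\ (cLnorm p f < +oo)%E.

End complex_valued.

Section fourier.
Context (R : realType) (d : nat).
Implicit Types f K : 'rV[R]_d -> R[i].

Definition fourier f (xi : 'rV[R]_d) : R[i] :=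
  cintegral (lebesgue_rV d)
    (fun x => f x * (cos (dotp xi x) -i* sin (dotp xi x))).

Definition convolution K f (x : 'rV[R]_d) : R[i] :=
  cintegral (lebesgue_rV d) (fun y => K (x - y) * f y).

End fourier.

(* C^oo on an open set U: all iterated directional derivatives
   D_(v_1) ... D_(v_k) f exist and are continuous on U. *)
Definition smooth_on (R : realType) d (U : set 'rV[R]_d) (f : 'rV[R]_d -> R) :=
  forall vs : seq 'rV[R]_d,
    let g := foldr (fun v h => 'D_v h) f vs in
    forall x, U x -> {for x, continuous g} /\ forall v, derivable g x v.

(* Main.v *)
Require Import Defs.
From HB Require Import structures.
From mathcomp Require Import all_boot all_order all_algebra.
From mathcomp Require Import complex.
From mathcomp Require Import all_classical all_reals all_analysis.
From mathcomp Require Import measurable_realfun lebesgue_integral_under ess_sup_inf ring lra.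
Import Order.TTheory GRing.Theory Num.Theory.
Import numFieldNormedType.Exports.
Local Open Scope classical_set_scope.
Local Open Scope ring_scope.
Set Implicit Arguments.
Unset Strict Implicit.
Unset Printing Implicit Defensive.

(** Write r for the length of xi.  The Laplace transform of tau^(beta-1) at
    ln (lambda + r) is Gamma(beta) ln^(-beta) (lambda + r), so that, with
    C = 1/Gamma(beta),
      P(xi) = C * int_0^oo tau^(beta-1) M_tau(r) d tau,
      M_tau(r) = r^gamma (lambda + r)^(-tau) - [tau < gamma] r^(gamma - tau)
                 + [tau < gamma - 1] lambda tau r^(gamma - tau - 1).
    All the assertions on the kernel follow from one fact: P(xi) is an integral,
    against a finite signed measure, of Gaussians exp (- v^2 r^2 / 4) of various
    widths v.  The kernel is then the same integral of the corresponding
    Gaussian densities, which all have mass 1, so that it is integrable, in any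
    dimension; no derivative of P has to be estimated.

    The Gaussians appear as follows.  Put u = lambda / (lambda + r), so that
    1 - u = r / (lambda + r) and lambda + r = lambda / u.  Then
      M_tau(r) = lambda^(gamma - tau) u^(tau - gamma)
        ((1-u)^gamma - [tau < gamma] (1-u)^(gamma - tau)
         + [tau < gamma - 1] tau u (1-u)^(gamma - tau - 1)).
    Each power (1-u)^s has 0 < s <= 2; its binomial series converges on the
    closed interval 0 <= u <= 1 and the absolute values of its coefficients have
    a sum at most 4 ([sum_norm_bincoef], [binsum_cvg]).  Hence
      M_tau(r) = lambda^(gamma - tau) sum_k c_k(tau) u^(k - gamma + tau)
    where sum_k |c_k(tau)| <= 12 for all tau, and the two subtracted terms are
    exactly those that cancel the terms with k - gamma + tau <= 0
    ([series_coef_ind_pos]).  The factor lambda^(-tau), with lambda > 1, makes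
    the sum over k and the integral over tau absolutely convergent
    ([integrable_weight_kt]).  A power u^a = (1 + r/lambda)^(-a) with a > 0 is
    an average of the exponentials exp (- s r / lambda) for the Gamma(a)
    distribution of s, and an exponential exp (- 2 c) is an average of Gaussians
    by the subordination formula
      exp (- 2 c) = (2 / sqrt pi) int_0^oo exp (- z^2 - c^2 / z^2) dz
    ([integral_gauss_inv]), which gives v = s / (lambda z).  The outcome is
    [symbol_gauss_mixture].

    Convolution with an integrable real kernel multiplies Fourier transforms, by
    Fubini's theorem and the addition formulas ([fourier_convolution]), and is
    bounded on every L^p by Young's inequality ([convolution_Lp]), with a
    constant that does not depend on p.

    Smoothness of P outside 0 is a separate matter.  There, P is a polynomial
    expression in powers of r, powers of ln (lambda + r), and Laplace transforms,
    evaluated at ln r, of functions with support in [0, 2].  The algebra generated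
    by these functions, the powers of lambda + r and the linear forms is stable under
    directional derivatives ([is_derive_smooth_class]). *)

(** * Lebesgue measure on R^n *)

Section pushforward.
Context d d' (T : measurableType d) (T' : measurableType d') (R : realType).

(** The pushforward as a bundled measure, so that it can be compared with
    Lebesgue measure by uniqueness. *)
Definition image_measure (m : {measure set T -> \bar R}) (f : T -> T')
    (mf : measurable_fun [set: T] f) : {measure set T' -> \bar R} :=
  measure_function_pushforward__canonical__measure_function_Measure m mf.

End pushforward.

Section sigma_finite_measure_of.
Context d (T : measurableType d) (R : realType) (m : {measure set T -> \bar R}).
Hypothesis sfm : sigma_finite [set: T] m.

Let mT : set T -> \bar R := m.
HB.instance Definition _ := Measure.on mT.
HB.instance Definition _ := Measure_isSigmaFinite.Build _ _ _ mT sfm.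

(** Fubini's theorem asks for bundled sigma-finite measures. *)
Definition sigma_finite_measure_of : {sigma_finite_measure set T -> \bar R} :=
  mT.

End sigma_finite_measure_of.

Section line_change_of_variables.
Context {R : realType}.
Notation mu := (@lebesgue_measure R).

(** a times the pushforward of Lebesgue measure under x |-> a x + c gives every
    interval its length, hence is Lebesgue measure. *)
Lemma ge0_integral_affine (a c : R) (f : R -> \bar R) : 0 < a ->
  measurable_fun [set: R] f -> (forall x, 0 <= f x)%E ->
  (\int[mu]_x f x = a%:E * \int[mu]_x f (a * x + c)%R)%E.
Proof.
move=> a0 mf f0.
pose phi (x : measurableTypeR R) : measurableTypeR R := a * x + c.
have mphi : measurable_fun [set: measurableTypeR R] phi.
  by apply: measurable_funD => //; exact: measurable_funM.
transitivity (\int[mscale (NngNum (ltW a0)) (image_measure mu mphi)]_x f x)%E.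
  apply: eq_measure_integral => A mA _.
  apply: lebesgue_measure_unique => //= _ [[x y]] _ <-.
  rewrite /mscale /= /pushforward.
  rewrite (_ : phi @^-1` _ = `](x - c) / a, (y - c) / a]%classic); last first.
    by apply/seteqP; split => z /=; rewrite !in_itv /= /phi
      ltr_pdivrMr // ler_pdivlMr // ltrBlDr lerBrDr mulrC.
  rewrite !lebesgue_measure_itv /= !lte_fin ltr_pM2r ?invr_gt0 // ltrD2r.
  case: ifPn => _; last by rewrite mule0.
  by rewrite -!EFinB -EFinM; congr EFin; field; rewrite gt_eqF.
rewrite ge0_integral_mscale //; congr (_ * _)%E.
by rewrite ge0_integral_pushforward // preimage_setT.
Qed.

Lemma ge0_integral_reflect (c : R) (f : R -> \bar R) :
  measurable_fun [set: R] f -> (forall x, 0 <= f x)%E ->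
  (\int[mu]_x f (c - x)%R = \int[mu]_x f x)%E.
Proof.
move=> mf f0.
pose phi (x : measurableTypeR R) : measurableTypeR R := c - x.
have mphi : measurable_fun [set: measurableTypeR R] phi.
  exact: measurable_funB.
transitivity (\int[image_measure mu mphi]_x f x)%E.
  by rewrite ge0_integral_pushforward // preimage_setT.
apply: eq_measure_integral => A mA _; apply/esym.
apply: lebesgue_measure_unique => //= _ [[x y]] _ <-.
rewrite /= /pushforward.
rewrite (_ : phi @^-1` _ = `[c - y, c - x[%classic); last first.
  by apply/seteqP; split => z /=; rewrite !in_itv /= /phi => /andP[? ?];
    apply/andP; split; lra.
rewrite !lebesgue_measure_itv /= !lte_fin ltrD2l ltrN2.
by case: ifPn => // _; rewrite -!EFinB; congr EFin; ring.
Qed.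

End line_change_of_variables.

Section lebesgue_rV_theory.
Context {R : realType}.

Lemma sigma_finite_lebesgue_rV n :
  sigma_finite [set: 'rV[R]_n] (lebesgue_rV n : set 'rV[R]_n -> \bar R).
Proof.
pose B (k : nat) := [set x : 'rV[R]_n | forall i, `[- k%:R, k%:R]%classic (x ord0 i)].
exists B.
  apply/esym/seteqP; split => // x _.
  pose M := \sum_(i < n) `|x ord0 i|.
  have M0 : 0 <= M by exact: sumr_ge0.
  exists (Num.trunc M).+1 => // i; rewrite /= in_itv /= -ler_norml.
  apply: (@le_trans _ _ M).
    by rewrite /M (bigD1 i) //= lerDl sumr_ge0.
  exact/ltW/truncnS_gt.
move=> k; split.
  rewrite (_ : B k = \bigcap_(i in [set: 'I_n])
    ((fun x : 'rV[R]_n => x ord0 i) @^-1` `[- k%:R, k%:R]%classic)).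
    apply: fin_bigcap_measurable => [|i _]; first exact: finite_finset.
    by rewrite -[X in measurable X]setTI; exact: measurable_coord.
  by apply/seteqP; split=> [x h i _|x h i]; [exact: (h i)|exact: (h i Logic.I)].
rewrite /B (@lebesgue_rV_box R n (fun=> `[- k%:R, k%:R]%classic)) //.
rewrite (eq_bigr (fun=> (k%:R + k%:R)%:E)) => [|i _].
  by rewrite prodEFin ltry.
rewrite /= lebesgue_measure_itv /= lte_fin.
case: ifPn => [_|]; first by rewrite -EFinB opprK.
rewrite -leNgt => k0; congr EFin; have : 0 <= k%:R :> R by []. 
by lra.
Qed.

Definition leb n : {sigma_finite_measure set 'rV[R]_n -> \bar R} :=
  sigma_finite_measure_of (@sigma_finite_lebesgue_rV n).

Lemma ge0_integral_rV_rcons n (f : 'rV[R]_n.+1 -> \bar R) :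
  measurable_fun [set: 'rV[R]_n.+1] f -> (forall x, 0 <= f x)%E ->
  (\int[leb n.+1]_x f x =
   \int[leb n]_x \int[lebesgue_measure]_t f (rV_rcons (x, t)))%E.
Proof.
move=> mf f0.
transitivity (\int[leb n \x lebesgue_measure]_z f (rV_rcons z))%E.
  have mr : measurable_fun [set: 'rV[R]_n * measurableTypeR R] (@rV_rcons R n).
    exact: measurable_rV_rcons.
  have h := @ge0_integral_pushforward _ _ _ _ _ _ mr
    (leb n \x lebesgue_measure)%E setT f.
  have := h measurableT mf (fun x _ => f0 x).
  by rewrite preimage_setT.
apply: (fubini_tonelli1 (fun z : 'rV[R]_n * measurableTypeR R => f (rV_rcons z))) => //.
by apply: measurableT_comp => //; exact: measurable_rV_rcons.
Qed.

Lemma rV_rcons_ordmax n (p : 'rV[R]_n * R) : rV_rcons p ord0 ord_max = p.2.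
Proof. by rewrite mxE unlift_none. Qed.

Lemma rV_rcons_widen n (p : 'rV[R]_n * R) i :
  rV_rcons p ord0 (widen_ord (leqnSn n) i) = p.1 ord0 i.
Proof.
rewrite mxE; have -> : widen_ord (leqnSn n) i = lift ord_max i.
  by apply/val_inj; rewrite /= /bump leqNgt ltn_ord.
by rewrite liftK.
Qed.

Lemma rV_rconsB n (p q : 'rV[R]_n * R) :
  rV_rcons p - rV_rcons q = rV_rcons (p.1 - q.1, p.2 - q.2).
Proof.
by apply/rowP => i; rewrite !mxE; case: (unliftP ord_max i) => [j _|_] //=; rewrite !mxE.
Qed.

Lemma rV_rcons_surj n (x : 'rV[R]_n.+1) : exists p, x = rV_rcons p.
Proof.
exists (\row_i x ord0 (widen_ord (leqnSn n) i), x ord0 ord_max).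
apply/rowP => i; rewrite mxE; case: unliftP => [j ->|->] //=.
rewrite mxE; congr (x _ _).
by apply/val_inj; rewrite /= /bump leqNgt ltn_ord.
Qed.

Lemma measurable_rV_sub n :
  measurable_fun [set: 'rV[R]_n * 'rV[R]_n] (fun p => p.1 - p.2).
Proof.
apply: measurable_fun_rV => i; under eq_fun do rewrite !mxE.
apply: measurable_funB.
  by apply: (measurableT_comp (measurable_coord i)).
by apply: (measurableT_comp (measurable_coord i)).
Qed.

Lemma measurable_rV_subl n (x : 'rV[R]_n) :
  measurable_fun [set: 'rV[R]_n] (fun y => x - y).
Proof.
apply: measurable_fun_rV => i; under eq_fun do rewrite !mxE.
by apply: measurable_funB => //; exact: measurable_coord.
Qed.

Lemma measurable_rV_subr n (y : 'rV[R]_n) :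
  measurable_fun [set: 'rV[R]_n] (fun x => x - y).
Proof.
apply: measurable_fun_rV => i; under eq_fun do rewrite !mxE.
by apply: measurable_funB => //; exact: measurable_coord.
Qed.

Lemma measurable_rV_rcons_line n (x : 'rV[R]_n) :
  measurable_fun [set: R] (fun t : R => rV_rcons (x, t)).
Proof.
exact: (measurableT_comp (@measurable_rV_rcons R n) (pair1_measurable x)).
Qed.

Lemma measurable_integral_rV_rcons n (f : 'rV[R]_n.+1 -> \bar R) :
  measurable_fun [set: 'rV[R]_n.+1] f -> (forall x, 0 <= f x)%E ->
  measurable_fun [set: 'rV[R]_n]
    (fun x => \int[lebesgue_measure]_t f (rV_rcons (x, t)))%E.
Proof.
move=> mf f0; apply: (measurable_fun_fubini_tonelli_F
  (fun z : 'rV[R]_n * measurableTypeR R => f (rV_rcons z))) => //.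
by apply: measurableT_comp => //; exact: measurable_rV_rcons.
Qed.

(** By induction on the dimension, the last coordinate being integrated first:
    invariance on R^n follows from invariance on the line.  Reflections are
    treated first because the convolution needs them, and a translation is the
    composite of two reflections. *)
Lemma ge0_integral_rV_reflect n (c : 'rV[R]_n) (f : 'rV[R]_n -> \bar R) :
  measurable_fun [set: 'rV[R]_n] f -> (forall x, 0 <= f x)%E ->
  (\int[leb n]_x f (c - x)%R = \int[leb n]_x f x)%E.
Proof.
elim: n c f => [|n IH] c f mf f0.
  by apply: eq_integral => x _; congr f; apply/rowP => -[].
have [[c1 c2] ->] := rV_rcons_surj c.
rewrite (ge0_integral_rV_rcons mf f0).
rewrite (ge0_integral_rV_rcons (f := fun x => f (rV_rcons (c1, c2) - x))
  (measurableT_comp mf (measurable_rV_subl _)) (fun x => f0 _)).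
rewrite -[RHS](IH c1); [|exact: (measurable_integral_rV_rcons mf f0)|
  by move=> x; exact: integral_ge0].
apply: eq_integral => x _.
rewrite -(ge0_integral_reflect c2 (f := fun t => f (rV_rcons (c1 - x, t)))) //.
  by apply: eq_integral => t _; rewrite rV_rconsB.
apply: measurableT_comp => //; exact: measurable_rV_rcons_line.
Qed.

Lemma ge0_integral_rV_shift n (c : 'rV[R]_n) (f : 'rV[R]_n -> \bar R) :
  measurable_fun [set: 'rV[R]_n] f -> (forall x, 0 <= f x)%E ->
  (\int[leb n]_x f (x - c)%R = \int[leb n]_x f x)%E.
Proof.
move=> mf f0.
rewrite -(ge0_integral_rV_reflect c) //; last first.
  apply: measurableT_comp => //; exact: measurable_rV_subr.
rewrite -[RHS](ge0_integral_rV_reflect 0) //.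
by apply: eq_integral => x _; congr f; rewrite sub0r addrAC subrr add0r.
Qed.

End lebesgue_rV_theory.

(** * Iterated integrals and mixtures of densities *)

Lemma integrable_mul_bounded d (T : measurableType d) (R : realType)
    (mu : {measure set T -> \bar R}) (w phi : T -> R) (M : R) :
  mu.-integrable [set: T] (EFin \o w) -> measurable_fun [set: T] phi ->
  (forall x, `|phi x| <= M) ->
  mu.-integrable [set: T] (fun x => (w x * phi x)%:E).
Proof.
move=> wi mphi phiM.
apply: (integrableMl measurableT wi mphi); exists M; split; first exact: num_real.
by move=> N MN x _ /=; rewrite (le_trans (phiM x)) // ltW.
Qed.

Section fubini_mixtures.
Context d1 d2 (X : measurableType d1) (Y : measurableType d2) (R : realType).
Variables (m1 : {sigma_finite_measure set X -> \bar R})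
  (m2 : {sigma_finite_measure set Y -> \bar R}).

(** The inner integral may fail to converge for a null set of x; the real-valued
    integral is then 0 by convention, which does not change the outer one. *)
Lemma Rintegral_prod12 (f : X * Y -> R) :
  (m1 \x m2)%E.-integrable [set: X * Y] (EFin \o f) ->
  \int[m1]_x \int[m2]_y f (x, y) = \int[(m1 \x m2)%E]_z f z.
Proof.
move=> fi; rewrite /Rintegral -(integral12_prod_meas1 fi); congr fine.
have Fi := integrable_fubini_F fi.
have mF := measurable_int _ Fi.
apply: ae_eq_integral => //.
  by apply/measurable_EFinP; apply: measurableT_comp.
apply: filterS (integrable_ae measurableT Fi) => x /(_ Logic.I) fx _.
by rewrite fineK.
Qed.

Lemma integrable_fubini_G (f : X * Y -> R) :
  (m1 \x m2)%E.-integrable [set: X * Y] (EFin \o f) ->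
  m2.-integrable [set: Y] (fubini_G m1 (EFin \o f)).
Proof.
move=> fi; have mf := measurable_int _ fi.
have mF := measurable_fubini_G fi.
apply/integrableP; split => //.
apply: le_lt_trans (iffLR (integrable21ltyP _ _ mf) fi).
apply: ge0_le_integral => //; first exact: measurableT_comp.
- apply: (measurable_fun_fubini_tonelli_G (abse \o (EFin \o f))) => /= [|z].
    exact: measurableT_comp.
  by rewrite lee_fin.
- move=> y _; apply: le_abse_integral => //.
  exact: (measurableT_comp mf (pair2_measurable y)).
Qed.

Lemma Rintegral_prod21 (f : X * Y -> R) :
  (m1 \x m2)%E.-integrable [set: X * Y] (EFin \o f) ->
  \int[m2]_y \int[m1]_x f (x, y) = \int[(m1 \x m2)%E]_z f z.
Proof.
move=> fi; rewrite /Rintegral -(integral21_prod_meas1 fi); congr fine.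
have Fi := integrable_fubini_G fi.
have mF := measurable_int _ Fi.
apply: ae_eq_integral => //.
  by apply/measurable_EFinP; apply: measurableT_comp.
apply: filterS (integrable_ae measurableT Fi) => x /(_ Logic.I) fx _.
by rewrite fineK.
Qed.

Lemma integrable_Rintegral1 (f : X * Y -> R) :
  (m1 \x m2)%E.-integrable [set: X * Y] (EFin \o f) ->
  m2.-integrable [set: Y] (fun y => (\int[m1]_x f (x, y))%:E).
Proof.
move=> fi; have Fi := integrable_fubini_G fi.
have mF := measurable_int _ Fi.
apply/integrableP; split.
  by apply/measurable_EFinP; apply: measurableT_comp mF.
case/integrableP : Fi => _; apply: le_lt_trans.
apply: ge0_le_integral => //.
- by apply/measurable_EFinP; apply: measurableT_comp => //; apply: measurableT_comp mF.
- exact: measurableT_comp.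
- move=> y _; rewrite /Rintegral /fubini_G /=.
  by case: (\int[m1]_x _)%E => //= ; rewrite normr0 leey.
Qed.

Lemma integrable_Rintegral2 (f : X * Y -> R) :
  (m1 \x m2)%E.-integrable [set: X * Y] (EFin \o f) ->
  m1.-integrable [set: X] (fun x => (\int[m2]_y f (x, y))%:E).
Proof.
move=> fi; have Fi := integrable_fubini_F fi.
have mF := measurable_int _ Fi.
have mf : measurable_fun [set: X] (fun x => (\int[m2]_y f (x, y))%:E).
  by apply/measurable_EFinP; apply: measurableT_comp mF.
apply/integrableP; split => //.
case/integrableP : Fi => _; apply: le_lt_trans.
apply: ge0_le_integral => //; [exact: measurableT_comp|exact: measurableT_comp|].
move=> x _; rewrite /Rintegral /fubini_F /=.
by case: (\int[m2]_x _)%E => //= ; rewrite normr0 leey.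
Qed.

Section mixture.
Variables (w : X -> R) (rho : X * Y -> R).
Hypotheses (wi : m1.-integrable [set: X] (EFin \o w))
  (mrho : measurable_fun [set: X * Y] rho)
  (rho_ge0 : forall x y, w x != 0 -> 0 <= rho (x, y))
  (rho1 : forall x, w x != 0 -> (\int[m2]_y (rho (x, y))%:E = 1)%E).

(** If every rho (x, _) is a probability density, then w (x) rho (x, y) has the
    same L^1 norm as w.  Only the points x where w does not vanish matter, which
    allows densities depending on a parameter that is positive only there. *)
Lemma integrable_mixture :
  (m1 \x m2)%E.-integrable [set: X * Y] (fun z => (w z.1 * rho z)%:E).
Proof.
have mw : measurable_fun [set: X] w by apply/measurable_EFinP; exact: measurable_int wi.
have mwr : measurable_fun [set: X * Y] (fun z => w z.1 * rho z).
  by apply: measurable_funM => //; exact: measurableT_comp.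
apply/integrable12ltyP; first exact/measurable_EFinP.
rewrite (eq_integral (fun x => `|(w x)%:E|)%E) => [|x _].
  by case/integrableP : wi.
have [wx0|wx0] := eqVneq (w x) 0.
  by rewrite wx0 abse0 integral0_eq // => y _; rewrite mul0r abse0.
under eq_integral => y _ do rewrite /= normrM (ger0_norm (rho_ge0 y wx0)) EFinM.
rewrite ge0_integralZl_EFin //= ?rho1 ?mule1 // => [y _|].
  by rewrite lee_fin rho_ge0.
by apply/measurable_EFinP; exact: (measurableT_comp mrho (pair1_measurable x)).
Qed.

Lemma Rintegral_mixture (phi : X * Y -> R) :
  measurable_fun [set: X * Y] phi -> (forall z, `|phi z| <= 1) ->
  \int[(m1 \x m2)%E]_z (w z.1 * rho z * phi z) =
  \int[m1]_x (w x * \int[m2]_y (rho (x, y) * phi (x, y))).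
Proof.
move=> mphi phi1.
rewrite -(Rintegral_prod12 (f := fun z => w z.1 * rho z * phi z)).
  apply: eq_Rintegral => x _ /=.
  have [->|wx0] := eqVneq (w x) 0.
    by rewrite mul0r /Rintegral integral0_eq // => y _; rewrite !mul0r.
  rewrite -RintegralZl //; first by apply: eq_Rintegral => y _; rewrite mulrA.
  have mr := measurableT_comp mrho (pair1_measurable x).
  apply: (integrable_mul_bounded (M := 1)) => [|| //].
    apply/integrableP; split; first exact/measurable_EFinP.
    under eq_integral => y _ do rewrite /= ger0_norm ?rho_ge0 //.
    by rewrite rho1 // ltry.
  exact: (measurableT_comp mphi (pair1_measurable x)).
exact: (integrable_mul_bounded integrable_mixture mphi phi1).
Qed.

(** Testing the mixture of the densities rho (x, _) with weight w against a
    bounded function; applied with phi a cosine or a sine, it computes the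
    Fourier transform of a mixture. *)
Lemma Rintegral_mixture_weak (phi : Y -> R) :
  measurable_fun [set: Y] phi -> (forall y, `|phi y| <= 1) ->
  \int[m2]_y ((\int[m1]_x (w x * rho (x, y))) * phi y) =
  \int[m1]_x (w x * \int[m2]_y (rho (x, y) * phi y)).
Proof.
move=> mphi phi1.
have mphi' : measurable_fun [set: X * Y] (fun z => phi z.2) by exact: measurableT_comp.
have phi1' (z : X * Y) : `|phi z.2| <= 1 by [].
rewrite -(Rintegral_mixture mphi' phi1').
have wi2 := integrable_mul_bounded integrable_mixture mphi' phi1'.
rewrite -(Rintegral_prod21 wi2) /Rintegral; congr fine.
have i1 := integrable_Rintegral1 integrable_mixture.
have i2 := integrable_Rintegral1 wi2.
apply: ae_eq_integral => //.
- exact: measurable_int (integrable_mul_bounded i1 mphi phi1).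
- exact: measurable_int i2.
apply: filterS (ae_integrable2 integrable_mixture) => y iy _ /=.
by rewrite -RintegralZr.
Qed.

End mixture.
End fubini_mixtures.

(** * Fundamental theorem of calculus on unbounded intervals *)

Section improper_integrals.
Context {R : realType}.
Notation mu := (@lebesgue_measure R).

Lemma derive_continuous (f : R -> R) (x df : R) :
  is_derive x 1 f df -> {for x, continuous f}.
Proof.
by move=> h; apply/differentiable_continuous/derivable1_diffP; exact: ex_derive.
Qed.

Lemma is_derive_FTC2 (f F : R -> R) (a b : R) : a < b ->
  (forall x : R, a <= x <= b -> is_derive x 1 F (f x)) ->
  (forall x : R, a <= x <= b -> {for x, continuous f}) ->
  (\int[mu]_(x in `[a, b]) (f x)%:E = (F b - F a)%:E)%E.
Proof.
move=> ab dF cf; rewrite EFinB; apply: continuous_FTC2 => //.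
- by apply: continuous_in_subspaceT => x; rewrite inE /= in_itv /= => /cf.
- split => [x||].
  + by rewrite in_itv /= => /andP[ax xb]; have := dF x; rewrite !ltW // => /(_ isT)[].
  + apply: cvg_at_right_filter; apply: (@derive_continuous _ _ (f a)).
    by apply: dF; rewrite lexx ltW.
  + apply: cvg_at_left_filter; apply: (@derive_continuous _ _ (f b)).
    by apply: dF; rewrite lexx ltW.
- move=> x; rewrite in_itv /= => /andP[ax xb]; rewrite derive1E.
  by apply: derive_val; apply: dF; rewrite !ltW.
Qed.

(** A nonnegative derivative has as integral over the half-line the difference of
    the limits of its primitive, without an integrability hypothesis: the
    intervals [1/(n+2), n+2] exhaust the half-line, and monotone convergence
    applies. *)
Lemma ge0_FTC2_itv0y (f F : R -> R) (l0 l1 : R) :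
  (forall x : R, 0 < x -> 0 <= f x) ->
  (forall x : R, 0 < x -> is_derive x 1 F (f x)) ->
  (forall x : R, 0 < x -> {for x, continuous f}) ->
  F x @[x --> (0:R)^'+] --> l0 -> F x @[x --> +oo%R] --> l1 ->
  (\int[mu]_(x in `]0%R, +oo[) (f x)%:E = (l1 - l0)%:E)%E.
Proof.
move=> f0 dF cf cF0 cFy.
pose A (n : nat) := `[n.+2%:R^-1, n.+2%:R]%classic : set R.
have A0 n x : A n x -> 0 < x.
  by rewrite /A /= in_itv /= => /andP[+ _]; apply: lt_le_trans; rewrite invr_gt0.
have AE : \bigcup_n A n = `]0, +oo[%classic.
  apply/seteqP; split => x /=; first by move=> [n _ /A0 x0]; rewrite in_itv /= x0.
  rewrite in_itv /= andbT => x0.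
  exists (maxn (Num.trunc x) (Num.trunc x^-1)) => //.
  rewrite /A /= in_itv /=; apply/andP; split.
    rewrite invf_ple ?posrE //; apply/ltW/(lt_le_trans (truncnS_gt _)).
    by rewrite ler_nat ltnS leqW // leq_maxr.
  apply/ltW/(lt_le_trans (truncnS_gt _)).
  by rewrite ler_nat ltnS leqW // leq_maxl.
have mf : measurable_fun (`]0, +oo[ : set R) f.
  apply: open_continuous_measurable_fun => // x.
  by rewrite inE /= in_itv /= andbT => /cf.
have cv2 : (n.+2%:R : R) @[n --> \oo] --> +oo%R.
  have := @cvgr_idn R; rewrite -(cvg_shiftn 2) /=.
  by under [X in X @ _ --> _ -> _]eq_fun do rewrite addn2.
have := @ge0_nondecreasing_set_cvg_integral _ (measurableTypeR R) R A (EFin \o f) mu _ _ _ _.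
rewrite AE => h; apply: cvg_unique (h _ _ _ _) _ => //.
- move=> n m nm; apply/subsetPset => x; rewrite /A /= !in_itv /= => /andP[nx xn].
  rewrite (le_trans xn) ?ler_nat ?ltnS // andbT (le_trans _ nx) //.
  by rewrite lef_pV2 ?posrE // ler_nat !ltnS.
- by move=> n; exact: measurable_itv.
- move=> n; apply/measurable_EFinP; apply: measurable_funS mf => //.
  by rewrite -AE; exact: bigcup_sup.
- by move=> n x /A0 x0; rewrite lee_fin f0.
- rewrite (_ : (fun _ => _) = (fun n : nat => (F n.+2%:R - F n.+2%:R^-1)%:E)).
    apply: cvg_EFin; first exact: nearW.
    apply: cvgB.
      by apply: (iffLR (cvg_pinftyP F l1) cFy).
    apply: (iffLR (cvg_at_rightP F 0 l0) cF0); split=> [n|]; first by rewrite invr_gt0.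
    by apply/gtr0_cvgV0 => //; first exact: nearW.
  apply/funext => n; apply: is_derive_FTC2.
  + rewrite (@lt_trans _ _ 1) ?ltr1n // invf_lt1 ?ltr1n //.
  + by move=> x xA; apply: dF; apply: (A0 n); rewrite /A /= in_itv.
  + by move=> x xA; apply: cf; apply: (A0 n); rewrite /A /= in_itv.
Qed.

Lemma cvg_integral_itvNyc (f : R -> R) : mu.-integrable [set: R] (EFin \o f) ->
  \int[mu]_(t in `]-oo, x]) f t @[x --> +oo%R] --> \int[mu]_t f t.
Proof.
move=> fi; apply/cvg_pinftyP => u uy.
have fin := integrable_fin_num measurableT fi.
have mf := measurable_int _ fi.
have h : (\int[mu]_(t in `]-oo, u n]) (f t)%:E)%E @[n --> \oo] -->
    (\int[mu]_t (f t)%:E)%E.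
  under eq_fun do rewrite integral_mkcond.
  apply: (@dominated_cvg _ (measurableTypeR R) R mu setT measurableT
    (fun n => (EFin \o f) \_ `]-oo, u n]) (EFin \o f) (fun x => `|(f x)%:E|%E)).
  - move=> n; apply/(measurable_restrictT _ _).1 => //.
    exact: measurable_funS mf.
  - move=> x _; apply: cvg_near_cst; near=> n.
    rewrite patchE mem_set //= in_itv /=; near: n.
    exact: (cvgryPge u).1.
  - by [].
  - exact: integrable_abse.
  - by move=> n x _; rewrite patchE; case: ifP => _ //; rewrite abse0 abse_ge0.
rewrite /Rintegral; apply: fine_cvg.
by rewrite fineK.
Unshelve. all: by end_near. Qed.

Lemma cvg_integral_itvNyc_Ny (f : R -> R) :
  mu.-integrable [set: R] (EFin \o f) ->
  \int[mu]_(t in `]-oo, x]) f t @[x --> -oo%R] --> 0.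
Proof.
move=> fi; apply/cvgNy_compNP/cvg_pinftyP => u uy.
have mf := measurable_int _ fi.
have h : (\int[mu]_(t in `]-oo, (- u n)%R]) (f t)%:E)%E @[n --> \oo] --> 0%E.
  rewrite -(@integral0 _ (measurableTypeR R) R mu setT).
  under eq_fun do rewrite integral_mkcond.
  apply: (@dominated_cvg _ (measurableTypeR R) R mu setT measurableT
    (fun n => (EFin \o f) \_ `]-oo, (- u n)%R]) (cst 0%E)
    (fun x => `|(f x)%:E|%E)).
  - move=> n; apply/(measurable_restrictT _ _).1 => //.
    exact: measurable_funS mf.
  - move=> x _; apply: cvg_near_cst; near=> n.
    rewrite patchE memNset //= in_itv /=; apply/negP; rewrite -ltNge ltrNl.
    near: n; exact: (cvgryPgt u).1.
  - by [].
  - exact: integrable_abse.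
  - by move=> n x _; rewrite patchE; case: ifP => _ //; rewrite abse0 abse_ge0.
by rewrite /Rintegral; apply: fine_cvg.
Unshelve. all: by end_near. Qed.

(** For derivatives of varying sign, integrability is assumed and dominated
    convergence on [-n, n] replaces monotone convergence. *)
Lemma integral_derive_vanishing (f F : R -> R) :
  mu.-integrable [set: R] (EFin \o f) -> continuous f ->
  (forall x : R, is_derive x 1 F (f x)) ->
  (F n%:R - F (- n%:R)) @[n --> \oo] --> 0 ->
  \int[mu]_t f t = 0.
Proof.
move=> fi cf dF F0.
have mf := measurable_int _ fi.
have h : (\int[mu]_(t in `[(- n%:R)%R, n%:R%R]) (f t)%:E)%E @[n --> \oo] -->
    (\int[mu]_t (f t)%:E)%E.
  under eq_fun do rewrite integral_mkcond.
  apply: (@dominated_cvg _ (measurableTypeR R) R mu setT measurableT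
    (fun n => (EFin \o f) \_ `[(- n%:R)%R, n%:R%R]) (EFin \o f)
    (fun x => `|(f x)%:E|%E)).
  - move=> n; apply/(measurable_restrictT _ _).1 => //.
    exact: measurable_funS mf.
  - move=> x _; apply: cvg_near_cst; near=> n.
    rewrite patchE mem_set //= in_itv /= -ler_norml; near: n.
    exact: (cvgryPge _).1 cvgr_idn _.
  - by [].
  - exact: integrable_abse.
  - by move=> n x _; rewrite patchE; case: ifP => _ //; rewrite abse0 abse_ge0.
suff h0 : (\int[mu]_(t in `[(- n%:R)%R, n%:R%R]) (f t)%:E)%E @[n --> \oo] --> 0%E.
  by rewrite /Rintegral (cvg_unique _ h h0).
rewrite -(cvg_shiftS) /=.
rewrite (_ : (fun _ => _) = (fun n => (F n.+1%:R - F (- n.+1%:R))%:E)).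
  apply: cvg_EFin; first exact: nearW.
  by move: F0; rewrite -cvg_shiftS.
apply/funext => n; apply: is_derive_FTC2 => // [|x _]; last exact: cf.
by rewrite (@lt_trans _ _ 0) // ?oppr_lt0 ltr0n.
Unshelve. all: by end_near. Qed.

End improper_integrals.

(** * Fourier transform of the Gaussian, and subordination *)

Section gaussian_fourier.
Context {R : realType}.
Notation mu := (@lebesgue_measure R).

Lemma integral_gauss_scale (a : R) : 0 < a ->
  (\int[mu]_x (gauss_fun (a * x))%:E = (Num.sqrt pi / a)%:E)%E.
Proof.
move=> a0; have := integralT_gauss (R := R).
rewrite (ge0_integral_affine 0 a0) //; last 2 first.
- by apply/measurable_EFinP; exact: measurable_gauss_fun.
- by move=> x; rewrite lee_fin gauss_fun_ge0.
under eq_integral do rewrite addr0.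
move=> h; rewrite mulrC EFinM -h muleA -EFinM mulVf ?gt_eqF //.
by rewrite mul1e.
Qed.

Lemma integrable_gauss_scale (a : R) : 0 < a ->
  mu.-integrable [set: R] (fun x => (gauss_fun (a * x))%:E).
Proof.
move=> a0; apply/integrableP; split.
  apply/measurable_EFinP; apply: measurableT_comp => //.
  exact: measurable_gauss_fun.
under eq_integral do rewrite gee0_abs ?lee_fin ?gauss_fun_ge0 //.
by rewrite integral_gauss_scale // ltry.
Qed.

Let cosM_continuous (xi : R) : continuous (fun x : R => cos (xi * x)).
Proof.
by move=> x; apply: continuous_comp; [exact: mulrl_continuous|exact: continuous_cos].
Qed.

Let sinM_continuous (xi : R) : continuous (fun x : R => sin (xi * x)).
Proof.
by move=> x; apply: continuous_comp; [exact: mulrl_continuous|exact: continuous_sin].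
Qed.

Lemma integrable_gauss_cos (xi : R) :
  mu.-integrable [set: R] (fun x => (gauss_fun x * cos (xi * x))%:E).
Proof.
apply: (integrable_mul_bounded (M := 1)); first exact: integrableT_gauss.
  by apply: continuous_measurable_fun; exact: cosM_continuous.
by move=> x; rewrite ler_norml cos_geN1 cos_le1.
Qed.

(** A Gaussian bound for the derivative in xi of exp (- x^2) cos (xi x), uniform
    in xi; it reduces to |x| <= 1 + x^2 / 2 <= exp (x^2 / 2). *)
Lemma normr_mul_gauss_le (x : R) :
  `|x| * gauss_fun x <= gauss_fun ((Num.sqrt 2)^-1 * x).
Proof.
rewrite /gauss_fun exprMn exprVn sqr_sqrtr //.
rewrite (_ : - x ^+ 2 = - (2^-1 * x ^+ 2) - (2^-1 * x ^+ 2)); last by field.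
rewrite expRD mulrA ler_piMl ?expR_ge0 // expRN ler_pdivrMr ?expR_gt0 // mul1r.
apply: le_trans (expR_ge1Dx _).
rewrite -subr_ge0 (_ : _ - _ = ((`|x| - 1) ^+ 2 + 1) / 2).
  by rewrite divr_ge0 // addr_ge0 // sqr_ge0.
by rewrite -(real_normK (num_real x)); field.
Qed.

Lemma integrable_mul_gauss_sin (xi : R) :
  mu.-integrable [set: R] (fun x => (- x * gauss_fun x * sin (xi * x))%:E).
Proof.
have s2 : 0 < (Num.sqrt 2 : R)^-1 by rewrite invr_gt0 sqrtr_gt0.
apply: (integrable_mul_bounded (M := 1)).
- apply: le_integrable (integrable_gauss_scale s2) => //.
    apply/measurable_EFinP; apply: measurable_funM.
      exact: oppr_measurable.
    exact: measurable_gauss_fun.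
  move=> x _ /=; rewrite !lee_fin normrM normrN (ger0_norm (gauss_fun_ge0 _)).
  by rewrite (le_trans (normr_mul_gauss_le x)) // ler_norm.
- by apply: continuous_measurable_fun; exact: sinM_continuous.
- by move=> x; rewrite ler_norml sin_geN1 sin_le1.
Qed.

Lemma cvg_gauss_natr : gauss_fun (n%:R : R) @[n --> \oo] --> 0.
Proof. exact: (iffLR (cvg_pinftyP _ _) cvg_gauss_fun _ cvgr_idn). Qed.

(** Integration by parts for exp (- x^2) sin (xi x), which vanishes at infinity. *)
Lemma integral_mul_gauss_sin (xi : R) :
  \int[mu]_x (- x * gauss_fun x * sin (xi * x)) =
  - (xi / 2) * \int[mu]_x (gauss_fun x * cos (xi * x)).
Proof.
pose F x : R := gauss_fun x * sin (xi * x).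
have i1 := integrable_mul_gauss_sin xi.
have i2 := integrable_gauss_cos xi.
have : \int[mu]_x (2 * (- x * gauss_fun x * sin (xi * x)) +
                   xi * (gauss_fun x * cos (xi * x))) = 0.
  apply: (@integral_derive_vanishing _ _ F).
  - exact: (integrableD measurableT (integrableZl measurableT 2 i1)
      (integrableZl measurableT xi i2)).
  - have cg : continuous (fun x : R => gauss_fun x) by exact: continuous_gauss_fun.
    move=> x; apply: cvgD; apply: cvgM; try exact: cvg_cst.
      apply: cvgM; last exact: sinM_continuous.
      by apply: cvgM; [exact: continuousN|exact: cg].
    by apply: cvgM; [exact: cg|exact: cosM_continuous].
  - move=> x; apply: is_derive_eq.
    by rewrite /gauss_fun /GRing.scale /=; ring.
  - apply/norm_cvg0P; apply: (@squeeze_cvgr _ _ _ _ (cst 0) (fun n => gauss_fun n%:R *+ 2)).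
    + apply: nearW => n; rewrite normr_ge0 /=.
      rewrite /F /gauss_fun sqrrN mulrN sinN mulrN opprK -mulr2n normrMn ler_pMn2r //.
      rewrite normrM ger0_norm ?expR_ge0 // ler_piMr ?expR_ge0 //.
      by rewrite ler_norml sin_geN1 sin_le1.
    + exact: cvg_cst.
    + have := cvgD cvg_gauss_natr cvg_gauss_natr.
      by rewrite addr0; apply.
rewrite RintegralD //; [|exact: (integrableZl measurableT 2 i1)|
  exact: (integrableZl measurableT xi i2)].
rewrite !RintegralZl // => /eqP; rewrite addr_eq0 => /eqP h.
by apply: (@mulfI _ 2) => //; rewrite h; field.
Qed.

Let I (xi : R) : R := \int[mu]_x (gauss_fun x * cos (xi * x)).

Let partial_gauss_cos (xi x : R) :
  partial1of2 (fun xi x => gauss_fun x * cos (xi * x)) xi x =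
  - x * gauss_fun x * sin (xi * x).
Proof.
rewrite partial1of2E; apply: derive_val; apply: is_derive_eq.
by rewrite /GRing.scale /=; ring.
Qed.

Let is_derive_I (xi : R) : is_derive xi 1 I (- (xi / 2) * I xi).
Proof.
have s2 : 0 < (Num.sqrt 2 : R)^-1 by rewrite invr_gt0 sqrtr_gt0.
have xi_in : `]xi - 1, xi + 1[%classic xi by rewrite /= in_itv /=; apply/andP; split; lra.
have H1 (x : R) : `]xi - 1, xi + 1[%classic x ->
    mu.-integrable [set: R] (EFin \o (fun y => gauss_fun y * cos (x * y))).
  by move=> _; exact: integrable_gauss_cos.
have H2 (x y : R) : `]xi - 1, xi + 1[%classic x -> [set: R] y ->
    derivable ((fun xi x : R => gauss_fun x * cos (xi * x)) ^~ y) x 1.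
  by move=> _ _; apply: ex_derive.
have H3 (x y : R) : `]xi - 1, xi + 1[%classic x -> [set: R] y ->
    `|partial1of2 (fun xi x => gauss_fun x * cos (xi * x)) x y| <=
    gauss_fun ((Num.sqrt 2)^-1 * y).
  move=> _ _; rewrite partial_gauss_cos !normrM normrN (ger0_norm (gauss_fun_ge0 _)).
  apply: le_trans (normr_mul_gauss_le y).
  by rewrite ler_piMr ?mulr_ge0 ?expR_ge0 // ler_norml sin_geN1 sin_le1.
have H4 (y : R) : 0 <= gauss_fun ((Num.sqrt 2)^-1 * y) by exact: gauss_fun_ge0.
have dI := derivable_under_integral measurableT xi_in H1 H2 H4
  (integrable_gauss_scale s2) H3.
apply: DeriveDef => //.
rewrite -derive1E.
rewrite (differentiation_under_integral measurableT xi_in H1 H2 H4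
  (integrable_gauss_scale s2) H3).
rewrite -integral_mul_gauss_sin; apply: eq_Rintegral => x _.
exact: partial_gauss_cos.
Qed.

(** The integral I (xi) solves I' = - (xi / 2) I, by differentiation under the
    integral sign and integration by parts, so that I (xi) exp (xi^2 / 4) is
    constant; its value at 0 is the Gaussian integral. *)
Lemma integral_gauss_cos (xi : R) :
  \int[mu]_x (gauss_fun x * cos (xi * x)) = Num.sqrt pi * expR (- (xi ^+ 2 / 4)).
Proof.
have h : forall x : R, is_derive x 1 (fun x => I x * expR (x ^+ 2 / 4)) 0.
  move=> x; apply: is_derive_eq; first exact: is_deriveM.
  by rewrite /GRing.scale /=; field.
have I0 : I 0 = Num.sqrt pi.
  transitivity (\int[mu]_x gauss_fun x).
    by apply: eq_Rintegral => x _; rewrite mul0r cos0 mulr1.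
  by rewrite /Rintegral integralT_gauss.
have := is_derive_0_is_cst xi 0 h.
rewrite expr0n /= mul0r expR0 mulr1 I0 expRN => <-.
by rewrite -mulrA divff ?mulr1 ?gt_eqF ?expR_gt0.
Qed.

End gaussian_fourier.

Section subordination.
Context {R : realType}.
Notation mu := (@lebesgue_measure R).

Let erf (x : R) : R := \int[mu]_(t in `]-oo, x]) gauss_fun t.

Let is_derive_erf (x : R) : is_derive x 1 erf (gauss_fun x).
Proof.
have [] := @continuous_FTC1 R gauss_fun (BInfty R true) x (x + 1).
- by rewrite ltrDl.
- by apply: integrableS (@integrableT_gauss R).
- exact: ltNyr.
- exact: continuous_gauss_fun.
move=> h1 h2; apply: DeriveDef; [exact: h1|rewrite -derive1E; exact: h2].
Qed.

Let cvg_erf_y : erf x @[x --> +oo%R] --> Num.sqrt pi.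
Proof.
have := cvg_integral_itvNyc (@integrableT_gauss R).
rewrite (_ : Rintegral mu setT _ = Num.sqrt pi) //.
by rewrite /Rintegral integralT_gauss.
Qed.

Let cvg_erf_Ny : erf x @[x --> -oo%R] --> 0.
Proof. exact: cvg_integral_itvNyc_Ny (@integrableT_gauss R). Qed.

Section limits.
Variable c : R.
Hypothesis c0 : 0 < c.

Let cvg_addV_y : z + c / z @[z --> +oo%R] --> +oo%R.
Proof.
apply/cvgryPge => A; near=> z.
have z0 : 0 < z by near: z; exact: nbhs_pinfty_gt.
rewrite (@le_trans _ _ z) ?lerDl ?divr_ge0 ?(ltW z0) ?(ltW c0) //.
Unshelve. all: by end_near. Qed.

Let cvg_subV_y : z - c / z @[z --> +oo%R] --> +oo%R.
Proof.
apply/cvgryPge => A; near=> z.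
have z1 : 1 <= z by near: z; exact: nbhs_pinfty_ge.
have z0 : 0 < z by rewrite (lt_le_trans _ z1).
rewrite lerBrDr (@le_trans _ _ (A + c)) //.
by rewrite lerD2l ler_pdivrMr // ler_peMr // ltW.
Unshelve. all: by end_near. Qed.

Let cvg_V0 : c / z @[z --> (0:R)^'+] --> +oo%R.
Proof.
apply/cvgryPge => A; near=> z.
have z0 : 0 < z by near: z; exact: nbhs_right_gt.
have A0 : 0 < `|A| + 1 by rewrite ltr_wpDl.
rewrite ler_pdivlMr // (@le_trans _ _ ((`|A| + 1) * z)) //.
  by rewrite ler_pM2r // (le_trans (ler_norm _)) // lerDl.
rewrite mulrC -ler_pdivlMr //.
by near: z; apply: nbhs_right_le; rewrite divr_gt0.
Unshelve. all: by end_near. Qed.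

Let cvg_addV_0 : z + c / z @[z --> (0:R)^'+] --> +oo%R.
Proof.
apply/cvgryPge => A; near=> z.
have z0 : 0 < z by near: z; exact: nbhs_right_gt.
rewrite (@le_trans _ _ (c / z)) ?lerDr ?(ltW z0) //.
by near: z; apply: (iffLR (cvgryPge _) cvg_V0 A).
Unshelve. all: by end_near. Qed.

Let cvg_subV_0 : z - c / z @[z --> (0:R)^'+] --> -oo%R.
Proof.
apply/cvgrNyPle => A; near=> z.
have z0 : 0 < z by near: z; exact: nbhs_right_gt.
have z1 : z <= 1 by near: z; exact: nbhs_right_le.
rewrite lerBlDl (@le_trans _ _ 1) // -lerBlDr.
by near: z; apply: (iffLR (cvgryPge _) cvg_V0 (1 - A)).
Unshelve. all: by end_near. Qed.

(** The integrand has an explicit primitive: as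
    - z^2 - (c/z)^2 = - (z + c/z)^2 + 2c = - (z - c/z)^2 - 2c, and the derivatives
    1 - c/z^2 of z + c/z and 1 + c/z^2 of z - c/z add up to 2, half of
    exp (2c) erf (z + c/z) + exp (- 2c) erf (z - c/z) is a primitive.  At 0 and at
    infinity, z + c/z tends to +oo both times, whereas z - c/z goes from -oo
    to +oo. *)
Lemma integral_gauss_inv_gt0 :
  (\int[mu]_(z in `]0%R, +oo[) (expR (- z ^+ 2 - (c / z) ^+ 2))%:E =
   (Num.sqrt pi / 2 * expR (- (2 * c)))%:E)%E.
Proof.
pose F z := 2^-1 * (expR (2 * c) * erf (z + c / z) + expR (- (2 * c)) * erf (z - c / z)).
rewrite (_ : _ * expR _ = 2^-1 * (expR (2 * c) * Num.sqrt pi + expR (- (2 * c)) * Num.sqrt pi)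
  - 2^-1 * (expR (2 * c) * Num.sqrt pi + expR (- (2 * c)) * 0)); last by field.
apply: (@ge0_FTC2_itv0y _ (fun z => expR (- z ^+ 2 - (c / z) ^+ 2)) F) => [x x0|x x0|x x0||].
- exact: expR_ge0.
- have x0' : x != 0 by rewrite gt_eqF.
  have dV : is_derive x 1 (fun z : R => z^-1) (- x ^- 2 *: 1).
    exact: is_deriveV.
  have dp : is_derive x 1 (fun z : R => z + c / z) (1 - c / x ^+ 2).
    apply: is_derive_eq; rewrite /GRing.scale /=; field.
    by rewrite x0'.
  have dm : is_derive x 1 (fun z : R => z - c / z) (1 + c / x ^+ 2).
    apply: is_derive_eq; rewrite /GRing.scale /=; field.
    by rewrite x0'.
  have dep := @is_derive1_comp R erf (fun z => z + c / z) x _ _ (is_derive_erf _) dp.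
  have dem := @is_derive1_comp R erf (fun z => z - c / z) x _ _ (is_derive_erf _) dm.
  have dF := is_deriveZ 2^-1 (is_deriveD (is_deriveZ (expR (2 * c)) dep)
    (is_deriveZ (expR (- (2 * c))) dem)).
  apply: is_derive_eq dF _.
  rewrite /GRing.scale /= /gauss_fun.
  have e1 : expR (2 * c) * expR (- (x + c / x) ^+ 2) = expR (- x ^+ 2 - (c / x) ^+ 2).
    by rewrite -expRD; congr expR; field.
  have e2 : expR (- (2 * c)) * expR (- (x - c / x) ^+ 2) = expR (- x ^+ 2 - (c / x) ^+ 2).
    by rewrite -expRD; congr expR; field.
  by rewrite (mulrA (expR (2 * c))) e1 (mulrA (expR (- (2 * c)))) e2; field.
- have x0' : x != 0 by rewrite gt_eqF.
  have cV : {for x, continuous (fun z : R => c / z)}.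
    by apply: cvgM; [exact: cvg_cst|exact: cvgV].
  apply: continuous_comp; last exact: continuous_expR.
  apply: cvgB; first by apply: cvgN; exact: exprn_continuous.
  by apply: (cvgM cV cV).
- apply: cvgM; first exact: cvg_cst.
  apply: cvgD; apply: cvgM; try exact: cvg_cst.
    exact: cvg_comp cvg_addV_0 cvg_erf_y.
  exact: cvg_comp cvg_subV_0 cvg_erf_Ny.
- apply: cvgM; first exact: cvg_cst.
  apply: cvgD; apply: cvgM; try exact: cvg_cst.
    exact: cvg_comp cvg_addV_y cvg_erf_y.
  exact: cvg_comp cvg_subV_y cvg_erf_y.
Qed.

End limits.

(** Subordination: exp (- 2c) is an average of the Gaussians
    c |-> exp (- (c/z)^2). *)
Lemma integral_gauss_inv (c : R) : 0 <= c ->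
  (\int[mu]_(z in `]0%R, +oo[) (expR (- z ^+ 2 - (c / z) ^+ 2))%:E =
   (Num.sqrt pi / 2 * expR (- (2 * c)))%:E)%E.
Proof.
rewrite le_eqVlt => /predU1P[<-|]; last exact: integral_gauss_inv_gt0.
under eq_integral do rewrite mul0r expr0n /= subr0.
rewrite mulr0 oppr0 expR0 mulr1 -integral0y_gauss integral_itv_obnd_cbnd //.
by apply/measurable_EFinP/measurable_funTS; exact: measurable_gauss_fun.
Qed.

End subordination.

(** * The Gamma function *)

(** Inversion is not continuous at 0, but x^-1 = x * (x^2)^-1 and real powers
    are measurable. *)
Lemma measurable_invr (R : realType) : measurable_fun [set: R] (fun x : R => x^-1).
Proof.
rewrite (_ : (fun x : R => x^-1) = (fun x => x * (x ^+ 2) `^ (-1))).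
  apply: measurable_funM => //.
  exact: (measurableT_comp (measurable_powR (-1)) (exprn_measurable 2)).
apply/funext => x; rewrite powR_inv1 ?sqr_ge0 //.
by have [->|x0] := eqVneq x 0; [rewrite invr0 mul0r|field].
Qed.

Section gamma.
Context {R : realType}.
Notation mu := (@lebesgue_measure R).

Definition ind_pos (t : R) : R := indic (`]0, +oo[%classic : set R) t.

Lemma ind_posE t : ind_pos t = (0 < t)%R%:R.
Proof. by rewrite /ind_pos indicE mem_setE in_itv /= andbT. Qed.

Lemma ind_pos_ge0 t : 0 <= ind_pos t. Proof. by rewrite ind_posE. Qed.

Lemma measurable_ind_pos : measurable_fun [set: R] ind_pos.
Proof. exact: measurable_indic. Qed.

Lemma integral_ind_pos (f : R -> R) :
  (\int[mu]_t (ind_pos t * f t)%:E = \int[mu]_(t in `]0%R, +oo[) (f t)%:E)%E.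
Proof.
rewrite [RHS]integral_mkcond; apply: eq_integral => t _.
rewrite patchE mem_setE in_itv /= andbT ind_posE.
by case: ifP; rewrite ?mul1r ?mul0r.
Qed.

(** The integrand of Euler's integral, t^(a-1) exp (- t) for t > 0.  The power is
    written as an exponential, and the integrand is extended by 0, so that it is
    measurable on the whole plane as a function of (a, t). *)
Definition gamma_density (a t : R) : R := ind_pos t * expR ((a - 1) * ln t - t).

Definition Gamma_fun (a : R) : R := \int[mu]_t gamma_density a t.

Lemma gamma_density_ge0 a t : 0 <= gamma_density a t.
Proof. by rewrite mulr_ge0 ?ind_pos_ge0 ?expR_ge0. Qed.

Lemma measurable_gamma_density2 :
  measurable_fun [set: R * R] (fun p => gamma_density p.1 p.2).
Proof.
apply: measurable_funM; first exact: measurableT_comp measurable_ind_pos _.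
apply: measurableT_comp => //; apply: measurable_funB => //.
apply: measurable_funM; first exact: measurable_funB.
exact: measurableT_comp.
Qed.

Lemma measurable_gamma_density a : measurable_fun [set: R] (gamma_density a).
Proof.
exact: (measurableT_comp measurable_gamma_density2 (pair1_measurable a)).
Qed.

Section beta_prime.
Variable a : R.
Hypothesis a0 : 0 < a.

Let F (t : R) : R := a^-1 * expR (a * (ln t - ln (1 + t))).
Let f (t : R) : R := expR (a * (ln t - ln (1 + t))) / (t * (1 + t)).

Let is_derive_F (t : R) : 0 < t -> is_derive t 1 F (f t).
Proof.
move=> t0; have t1 : 0 < 1 + t by rewrite addr_gt0.
have dt := is_derive1_ln t0.
have d1 : is_derive t 1 (fun x : R => ln (1 + x)) (1 + t)^-1.
  have d0 : is_derive t 1 (fun x : R => 1 + x) 1.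
    have := is_deriveD (is_derive_cst (1 : R) t (1 : R)) (is_derive_id t (1 : R)).
    by rewrite add0r.
  have := @is_derive1_comp R (@ln R) (fun x => 1 + x) t _ 1 (is_derive1_ln t1) d0.
  by rewrite mulr1.
apply: is_derive_eq; rewrite /f /GRing.scale /=; field.
by rewrite !gt_eqF.
Qed.

Let cvg_F_0 : F t @[t --> (0:R)^'+] --> 0.
Proof.
suff h : expR (a * (ln t - ln (1 + t))) @[t --> (0:R)^'+] --> 0.
  have : a^-1 * expR (a * (ln t - ln (1 + t))) @[t --> (0:R)^'+] --> a^-1 * 0.
    by apply: cvgM; [exact: cvg_cst|exact: h].
  by rewrite mulr0.
apply/cvgr0Pnorm_lt => e e0; near=> t.
have t0 : 0 < t by near: t; exact: nbhs_right_gt.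
rewrite ger0_norm ?expR_ge0 // -[ltRHS](lnK e0) ltr_expR mulrC -ltr_pdivlMr //.
rewrite ltrBlDr ltr_wpDr ?ln_ge0 ?lerDl ?(ltW t0) //.
rewrite -ltr_expR lnK ?posrE //.
near: t; exact/nbhs_right_lt/expR_gt0.
Unshelve. all: by end_near. Qed.

Let cvg_F_y : F t @[t --> +oo%R] --> a^-1.
Proof.
suff h : (ln t - ln (1 + t) : R) @[t --> +oo%R] --> (0 : R).
  have : a^-1 * expR (a * (ln t - ln (1 + t))) @[t --> +oo%R] --> a^-1 * expR (a * 0).
    apply: cvgM; first exact: cvg_cst.
    apply: continuous_cvg; first exact: continuous_expR.
    by apply: cvgM; [exact: cvg_cst|exact: h].
  by rewrite mulr0 expR0 mulr1.
apply: (squeeze_cvgr (f := fun t : R => - t^-1) (h := fun=> 0)).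
- near=> t; have t0 : 0 < t by near: t; exact: nbhs_pinfty_gt.
  have t1 : 0 < 1 + t by rewrite addr_gt0.
  rewrite subr_le0 ler_ln ?posrE // lerDr ler01 andbT.
  rewrite lerNl opprB -ln_div ?posrE //.
  rewrite (_ : (1 + t) / t = 1 + t^-1); last by field; rewrite gt_eqF.
  by apply: le_ln1Dx; rewrite (@lt_trans _ _ 0) // invr_gt0.
- have hV : (fun t : R => t^-1) t @[t --> +oo%R] --> (0 : R).
    apply/gtr0_cvgV0; last exact: cvg_id.
    by near=> t; near: t; exact: nbhs_pinfty_gt.
  by have := cvgN hV; rewrite oppr0; apply.
- exact: cvg_cst.
Unshelve. all: by end_near. Qed.

(** An explicit integrable majorant of the Gamma integrand: for
    f (t) = t^(a-1) (1+t)^(-a-1), the function (t / (1+t))^a / a is a primitive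
    that goes from 0 to 1/a. *)
Lemma integral_beta_prime :
  (\int[mu]_(t in `]0%R, +oo[)
    (expR (a * (ln t - ln (1 + t))) / (t * (1 + t)))%:E = (a^-1)%:E)%E.
Proof.
rewrite -[X in _ = X%:E]subr0; apply: (@ge0_FTC2_itv0y _ f F) => //.
- by move=> x x0; rewrite /f divr_ge0 ?expR_ge0 // mulr_ge0 ?addr_ge0 ?ltW.
- move=> t t0; have t1 : 0 < 1 + t by rewrite addr_gt0.
  have cl : {for t, continuous (@ln R)} by exact: continuous_ln.
  have c1 : {for t, continuous (fun x : R => 1 + x)}.
    by apply: cvgD; [exact: cvg_cst|exact: cvg_id].
  apply: cvgM.
    apply: continuous_comp; last exact: continuous_expR.
    apply: cvgM; first exact: cvg_cst.
    apply: cvgB => //; apply: (continuous_comp c1).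
    exact: continuous_ln.
  apply: cvgV; first by rewrite mulf_neq0 // gt_eqF.
  by apply: cvgM => //; exact: cvg_id.
Qed.

(** Equivalently, (a+1) ln (1+t) - t is bounded by its value at t = a, the point
    where it is maximal; this is ln y <= y - 1 at y = (1+t)/(a+1). *)
Lemma gamma_density_le (t : R) : 0 < t -> gamma_density a t <=
  expR ((a + 1) * ln (a + 1) - a) * (expR (a * (ln t - ln (1 + t))) / (t * (1 + t))).
Proof.
move=> t0; have t1 : 0 < 1 + t by rewrite addr_gt0.
have a1 : 0 < a + 1 by rewrite addr_gt0.
rewrite /gamma_density ind_posE t0 mul1r.
have -> : t * (1 + t) = expR (ln t + ln (1 + t)) by rewrite expRD !lnK ?posrE.
rewrite -expRN -!expRD ler_expR.
have : ln (1 + t) - ln (a + 1) <= (1 + t) / (a + 1) - 1.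
  rewrite -ln_div ?posrE //.
  rewrite -[X in ln X](subrKC 1); apply: le_ln1Dx.
  by rewrite ltrBrDl subrr divr_gt0.
rewrite -(ler_pM2l a1) => h.
have e : (a + 1) * ((1 + t) / (a + 1) - 1) = t - a by field; rewrite gt_eqF.
rewrite e in h; lra.
Qed.

Lemma integral_gamma_density_lty : (\int[mu]_t (gamma_density a t)%:E < +oo)%E.
Proof.
pose M := expR ((a + 1) * ln (a + 1) - a).
pose g t := expR (a * (ln t - ln (1 + t))) / (t * (1 + t)).
have mg : measurable_fun [set: R] (fun t => ind_pos t * g t).
  apply: measurable_funM; first exact: measurable_ind_pos.
  have m1 : measurable_fun [set: R] (fun t : R => 1 + t) by exact: measurable_funD.
  apply: measurable_funM.
    apply: measurableT_comp => //; apply: measurable_funM => //.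
    apply: measurable_funB => //; exact: measurableT_comp.
  apply: (measurableT_comp (@measurable_invr R)).
  exact: measurable_funM.
apply: (@le_lt_trans _ _ (\int[mu]_t (M%:E * (ind_pos t * g t)%:E))%E).
  apply: ge0_le_integral => //.
  - by move=> t _; rewrite lee_fin gamma_density_ge0.
  - by apply/measurable_EFinP; exact: measurable_gamma_density.
  - by apply/measurable_EFinP; apply: measurable_funM.
  - move=> t _; rewrite -EFinM lee_fin.
    have [t0|t0] := ltP 0 t; last by rewrite /gamma_density !ind_posE ltNge t0 !mul0r mulr0.
    by rewrite [ind_pos t]ind_posE t0 mul1r; exact: gamma_density_le.
rewrite ge0_integralZl_EFin ?expR_ge0 //.
- by rewrite integral_ind_pos integral_beta_prime // -EFinM ltry.
- move=> t _; rewrite lee_fin ind_posE; have [t0|t0] := ltP 0 t; last by rewrite mul0r.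
  by rewrite mul1r /g divr_ge0 ?expR_ge0 // mulr_ge0 ?addr_ge0 ?ltW.
- exact/measurable_EFinP.
Qed.

Lemma integrable_gamma_density :
  mu.-integrable [set: R] (EFin \o gamma_density a).
Proof.
apply/integrableP; split.
  by apply/measurable_EFinP; exact: measurable_gamma_density.
under eq_integral do rewrite gee0_abs ?lee_fin ?gamma_density_ge0 //.
exact: integral_gamma_density_lty.
Qed.

Lemma EFin_Gamma_fun : (Gamma_fun a)%:E = (\int[mu]_t (gamma_density a t)%:E)%E.
Proof.
by rewrite /Gamma_fun /Rintegral fineK //;
  exact: (integrable_fin_num measurableT integrable_gamma_density).
Qed.

Lemma Gamma_fun_gt0 : 0 < Gamma_fun a.
Proof.
(* a lower bound of t^(a-1) exp (- t) for t in [1, 2] *)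
pose c := expR (- (`|a - 1| * ln 2) - 2).
rewrite -lte_fin EFin_Gamma_fun; apply: (@lt_le_trans _ _ (\int[mu]_(t in `[1%R, 2%R]) c%:E)%E).
  rewrite integral_cst //= lebesgue_measure_itv /= lte_fin ltr1n /= -EFinB -EFinM lte_fin.
  by rewrite mulr_gt0 ?expR_gt0 // subr_gt0 ltr1n.
apply: (@le_trans _ _ (\int[mu]_(t in `[1%R, 2%R]) (gamma_density a t)%:E)%E).
  apply: ge0_le_integral => //.
  - by move=> t _; rewrite lee_fin expR_ge0.
  - apply/measurable_EFinP/measurable_funTS; exact: measurable_gamma_density.
  - move=> t; rewrite /= in_itv /= => /andP[t1 t2].
    have t0 : 0 < t by rewrite (lt_le_trans _ t1).
    rewrite lee_fin /gamma_density ind_posE t0 mul1r ler_expR lerB //.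
    rewrite lerNl -mulNr; apply: (@le_trans _ _ (`|a - 1| * ln t)).
      by rewrite ler_wpM2r ?ln_ge0 // -normrN ler_norm.
    by rewrite ler_wpM2l // ler_ln ?posrE.
apply: ge0_subset_integral => //.
  by apply/measurable_EFinP; exact: measurable_gamma_density.
by move=> t _; rewrite lee_fin gamma_density_ge0.
Qed.

(** The substitution t |-> L t: with L = ln (lambda + r) this produces the power
    of the logarithm, and with L = 1 + r/lambda the powers of
    lambda / (lambda + r). *)
Lemma integral_gamma_density_scale (L : R) : 0 < L ->
  (\int[mu]_t (ind_pos t * expR ((a - 1) * ln t - L * t))%:E =
   (Gamma_fun a * expR (- (a * ln L)))%:E)%E.
Proof.
move=> L0; rewrite EFinM EFin_Gamma_fun.
rewrite (@ge0_integral_affine _ L 0 (fun t => (gamma_density a t)%:E)) //; last 2 first.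
- by apply/measurable_EFinP; exact: measurable_gamma_density.
- by move=> t; rewrite lee_fin gamma_density_ge0.
under [in RHS]eq_integral do rewrite addr0.
rewrite muleAC -EFinM -ge0_integralZl_EFin //; last 3 first.
- by move=> t _; rewrite lee_fin gamma_density_ge0.
- apply/measurable_EFinP; apply: measurableT_comp => //.
  exact: measurable_gamma_density.
- by rewrite mulr_ge0 ?expR_ge0 ?ltW.
apply: eq_integral => t _; rewrite -EFinM; congr EFin.
rewrite /gamma_density !ind_posE pmulr_rgt0 //.
have [t0|t0] := ltP 0 t; last by rewrite !mul0r mulr0.
rewrite !mul1r lnM ?posrE //.
rewrite -{2}(lnK L0) -!expRD; congr expR; ring.
Qed.

End beta_prime.

Lemma measurable_Gamma_fun : measurable_fun [set: R] Gamma_fun.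
Proof.
apply: measurableT_comp => //.
apply: (measurable_fun_fubini_tonelli_F
  (fun p : R * measurableTypeR R => (gamma_density p.1 p.2)%:E)).
  by apply/measurable_EFinP; exact: measurable_gamma_density2.
by move=> p; rewrite lee_fin gamma_density_ge0.
Qed.

End gamma.

(** * Gaussian densities on R^n *)

Section gaussian_density.
Context {R : realType}.
Notation mu := (@lebesgue_measure R).

Lemma Rintegral_scale (a : R) (f : R -> R) : 0 < a ->
  mu.-integrable [set: R] (EFin \o f) ->
  \int[mu]_x f x = a * \int[mu]_x f (a * x).
Proof.
move=> a0 fi; have mf := measurable_int _ fi.
have fp := integrable_pos_fin_num measurableT fi.
have fn := integrable_neg_fin_num measurableT fi.
have sp : (\int[mu]_x ((EFin \o f)^\+ x) = a%:E * \int[mu]_x ((EFin \o f)^\+ (a * x)%R))%E.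
  rewrite (@ge0_integral_affine _ a 0 (EFin \o f)^\+%E) //; last exact: measurable_funepos.
  by under eq_integral do rewrite addr0.
have sn : (\int[mu]_x ((EFin \o f)^\- x) = a%:E * \int[mu]_x ((EFin \o f)^\- (a * x)%R))%E.
  rewrite (@ge0_integral_affine _ a 0 (EFin \o f)^\-%E) //; last exact: measurable_funeneg.
  by under eq_integral do rewrite addr0.
have fin_div (x : \bar R) : (a%:E * x)%E \is a fin_num -> x \is a fin_num.
  by case: x => [x||] //=; rewrite ?gt0_muley ?gt0_muleNy ?lte_fin.
rewrite sp in fp; rewrite sn in fn.
have fp' := fin_div _ fp; have fn' := fin_div _ fn.
have ep : (\int[mu]_x ((fun x => (f (a * x))%:E)^\+ x) =
    \int[mu]_x ((EFin \o f)^\+ (a * x)%R))%E.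
  by apply: eq_integral => x _; rewrite !funeposE.
have en : (\int[mu]_x ((fun x => (f (a * x))%:E)^\- x) =
    \int[mu]_x ((EFin \o f)^\- (a * x)%R))%E.
  by apply: eq_integral => x _; rewrite !funenegE.
rewrite /Rintegral integralE sp sn [in RHS]integralE ep en.
by rewrite -(fineK fp') -(fineK fn') -!EFinM -!EFinB /= -mulrBr.
Qed.

Lemma Rintegral_odd (f : R -> R) : measurable_fun [set: R] f ->
  (forall x, f (- x) = - f x) -> \int[mu]_x f x = 0.
Proof.
move=> mf fN; rewrite /Rintegral integralE.
rewrite [X in (_ - X)%E](_ : _ = \int[mu]_x ((EFin \o f)^\+ x))%E.
  by case: (\int[mu]_x _)%E => //= r; rewrite subrr.
have mfp : measurable_fun [set: R] (EFin \o f)^\+%E.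
  by apply: measurable_funepos; exact/measurable_EFinP.
rewrite -(ge0_integral_reflect 0 mfp) //; apply: eq_integral => x _.
by rewrite sub0r funenegE funeposE /= fN.
Qed.

(** The density of mass 1 proportional to exp (- (x/v)^2): its Fourier transform
    is exp (- v^2 xi^2 / 4). *)
Definition gauss1 (v x : R) : R := gauss_fun (v^-1 * x) / (v * Num.sqrt pi).

Lemma gauss1_ge0 (v x : R) : 0 < v -> 0 <= gauss1 v x.
Proof. by move=> v0; rewrite /gauss1 divr_ge0 ?gauss_fun_ge0 // mulr_ge0 ?sqrtr_ge0 ?ltW. Qed.

Lemma measurable_gauss1_2 : measurable_fun [set: R * R] (fun p => gauss1 p.1 p.2).
Proof.
have m1 : measurable_fun [set: R * R] (fun p : R * R => p.1^-1).
  exact: (measurableT_comp (@measurable_invr R)).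
apply: measurable_funM.
  apply: (measurableT_comp (@measurable_gauss_fun R)).
  exact: measurable_funM.
apply: (measurableT_comp (@measurable_invr R)).
exact: measurable_funM.
Qed.

Lemma measurable_gauss1 (v : R) : measurable_fun [set: R] (gauss1 v).
Proof. exact: (measurableT_comp measurable_gauss1_2 (pair1_measurable v)). Qed.

Lemma sqrt_pi_gt0 : 0 < Num.sqrt pi :> R.
Proof. by rewrite sqrtr_gt0 pi_gt0. Qed.

Lemma integral_gauss1 (v : R) : 0 < v -> (\int[mu]_x (gauss1 v x)%:E = 1)%E.
Proof.
move=> v0; rewrite /gauss1; under eq_integral do rewrite EFinM.
rewrite ge0_integralZr //.
- rewrite integral_gauss_scale ?invr_gt0 // -EFinM; congr EFin; field.
  by rewrite !gt_eqF ?sqrt_pi_gt0.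
- apply/measurable_EFinP; apply: (measurableT_comp (@measurable_gauss_fun R)).
  exact: mulrl_measurable.
- by move=> x _; rewrite lee_fin gauss_fun_ge0.
- by rewrite lee_fin invr_ge0 mulr_ge0 ?sqrtr_ge0 ?ltW.
Qed.

Lemma integrable_gauss1 (v : R) : 0 < v -> mu.-integrable [set: R] (EFin \o gauss1 v).
Proof.
move=> v0; apply/integrableP; split.
  by apply/measurable_EFinP; exact: measurable_gauss1.
under eq_integral do rewrite gee0_abs ?lee_fin ?gauss1_ge0 //.
by rewrite integral_gauss1 // ltry.
Qed.

Lemma measurable_cosM (xi : R) : measurable_fun [set: R] (fun x => cos (xi * x)).
Proof.
apply: (measurableT_comp (continuous_measurable_fun (@continuous_cos R))).
exact: mulrl_measurable.
Qed.

Lemma measurable_sinM (xi : R) : measurable_fun [set: R] (fun x => sin (xi * x)).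
Proof.
apply: (measurableT_comp (continuous_measurable_fun (@continuous_sin R))).
exact: mulrl_measurable.
Qed.

Lemma normr_cos_le1 (x : R) : `|cos x| <= 1.
Proof. by rewrite ler_norml cos_geN1 cos_le1. Qed.

Lemma normr_sin_le1 (x : R) : `|sin x| <= 1.
Proof. by rewrite ler_norml sin_geN1 sin_le1. Qed.

Lemma integral_gauss1_cos (v xi : R) : 0 < v ->
  \int[mu]_x (gauss1 v x * cos (xi * x)) = expR (- (v ^+ 2 * xi ^+ 2 / 4)).
Proof.
move=> v0; rewrite (Rintegral_scale v0); last first.
  apply: (integrable_mul_bounded (integrable_gauss1 v0) (measurable_cosM xi)).
  by move=> x; exact: normr_cos_le1.
transitivity (v * \int[mu]_x ((v * Num.sqrt pi)^-1 * (gauss_fun x * cos (xi * v * x)))).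
  congr (_ * _); apply: eq_Rintegral => x _.
  by rewrite /gauss1 mulKf ?gt_eqF // (mulrA xi); ring.
rewrite RintegralZl //; last exact: integrable_gauss_cos.
rewrite integral_gauss_cos exprMn [xi ^+ 2 * _]mulrC; field.
by rewrite !gt_eqF ?sqrt_pi_gt0.
Qed.

Lemma integral_gauss1_sin (v xi : R) : 0 < v ->
  \int[mu]_x (gauss1 v x * sin (xi * x)) = 0.
Proof.
move=> v0; apply: Rintegral_odd => [|x].
  by apply: measurable_funM; [exact: measurable_gauss1|exact: measurable_sinM].
by rewrite /gauss1 !mulrN sinN mulrN /gauss_fun sqrrN.
Qed.

End gaussian_density.

Section gaussian_rV.
Context {R : realType}.
Notation mu := (@lebesgue_measure R).

Definition gauss_rV n (v : R) (x : 'rV[R]_n) : R :=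
  \prod_(i < n) gauss1 v (x ord0 i).

Lemma gauss_rV_ge0 n (v : R) (x : 'rV[R]_n) : 0 < v -> 0 <= gauss_rV v x.
Proof. by move=> v0; apply: prodr_ge0 => i _; exact: gauss1_ge0. Qed.

Lemma measurable_gauss_rV2 n :
  measurable_fun [set: R * 'rV[R]_n] (fun p => gauss_rV p.1 p.2).
Proof.
apply: measurable_prod => i _.
have m2 : measurable_fun [set: R * 'rV[R]_n]
    (fun p : R * 'rV[R]_n => (p.1, p.2 ord0 i)).
  apply: measurable_fun_pair => //.
  exact: (measurableT_comp (measurable_coord i)).
exact: (measurableT_comp (@measurable_gauss1_2 R) m2).
Qed.

Lemma gauss_rV_rcons n (v : R) (x : 'rV[R]_n) (t : R) :
  gauss_rV v (rV_rcons (x, t)) = gauss_rV v x * gauss1 v t.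
Proof.
rewrite /gauss_rV big_ord_recr /= rV_rcons_ordmax; congr (_ * _).
by apply: eq_bigr => i _; rewrite rV_rcons_widen.
Qed.

Lemma measurable_dotp n (xi : 'rV[R]_n) :
  measurable_fun [set: 'rV[R]_n] (fun x => dotp xi x).
Proof.
apply: measurable_sum => i; apply: measurable_funM => //.
exact: measurable_coord.
Qed.

Lemma measurable_cos_dotp n (xi : 'rV[R]_n) :
  measurable_fun [set: 'rV[R]_n] (fun x => cos (dotp xi x)).
Proof.
apply: (measurableT_comp (continuous_measurable_fun (@continuous_cos R))).
exact: measurable_dotp.
Qed.

Lemma measurable_sin_dotp n (xi : 'rV[R]_n) :
  measurable_fun [set: 'rV[R]_n] (fun x => sin (dotp xi x)).
Proof.
apply: (measurableT_comp (continuous_measurable_fun (@continuous_sin R))).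
exact: measurable_dotp.
Qed.

Lemma dotp_rcons n (p q : 'rV[R]_n * R) :
  dotp (rV_rcons p) (rV_rcons q) = dotp p.1 q.1 + p.2 * q.2.
Proof.
rewrite /dotp big_ord_recr /= !rV_rcons_ordmax; congr (_ + _).
by apply: eq_bigr => i _; rewrite !rV_rcons_widen.
Qed.

Lemma Rintegral_rV_rcons n (f : 'rV[R]_n.+1 -> R) :
  (leb n.+1).-integrable [set: 'rV[R]_n.+1] (EFin \o f) ->
  \int[leb n.+1]_x f x = \int[leb n]_x \int[mu]_t f (rV_rcons (x, t)).
Proof.
move=> fi.
have mf := measurable_int _ fi.
have mr : measurable_fun [set: 'rV[R]_n * measurableTypeR R] (@rV_rcons R n).
  exact: measurable_rV_rcons.
have fri : (leb n \x mu)%E.-integrable [set: 'rV[R]_n * measurableTypeR R]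
    (EFin \o (f \o @rV_rcons R n)).
  apply/integrableP; split; first exact: (measurableT_comp mf mr).
  case/integrableP : fi => _; rewrite ge0_integral_rV_rcons //; last first.
    exact: measurableT_comp.
  rewrite -(fubini_tonelli1 (fun z : 'rV[R]_n * measurableTypeR R => `|(f (rV_rcons z))%:E|%E)) //.
  exact: (measurableT_comp (@abse_measurable R setT) (measurableT_comp mf mr)).
rewrite (Rintegral_prod12 fri).
have h := @integral_pushforward _ _ _ _ _ _ mr (leb n \x mu)%E setT _ mf _ measurableT.
rewrite /Rintegral; congr fine.
by have := h fri; rewrite preimage_setT.
Qed.

Section fixed_width.
Variable v : R.
Hypothesis v0 : 0 < v.

Lemma measurable_gauss_rV n : measurable_fun [set: 'rV[R]_n] (@gauss_rV n v).
Proof.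
exact: (measurableT_comp (@measurable_gauss_rV2 n) (pair1_measurable v)).
Qed.

Lemma integral_gauss_rV n : (\int[leb n]_x (gauss_rV v x)%:E = 1)%E.
Proof.
elim: n => [|n IH].
  rewrite /= integral_dirac //=; last first.
    by apply/measurable_EFinP; exact: measurable_gauss_rV.
  by rewrite diracT mul1e /gauss_rV big_ord0.
rewrite ge0_integral_rV_rcons //; last 2 first.
- by apply/measurable_EFinP; exact: measurable_gauss_rV.
- by move=> x; rewrite lee_fin gauss_rV_ge0.
rewrite -IH; apply: eq_integral => x _.
under eq_integral do rewrite gauss_rV_rcons EFinM.
rewrite ge0_integralZl_EFin ?gauss_rV_ge0 //.
- by rewrite integral_gauss1 // mule1.
- by move=> t _; rewrite lee_fin gauss1_ge0.
- by apply/measurable_EFinP; exact: measurable_gauss1.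
Qed.

Lemma integrable_gauss_rV n : (leb n).-integrable [set: 'rV[R]_n] (EFin \o gauss_rV v).
Proof.
apply/integrableP; split.
  by apply/measurable_EFinP; exact: measurable_gauss_rV.
under eq_integral do rewrite gee0_abs ?lee_fin ?gauss_rV_ge0 //.
by rewrite integral_gauss_rV ltry.
Qed.

(** The cosine and the sine are treated together, by induction on the dimension:
    their addition formulas mix them, and in the last coordinate the sine
    integral vanishes. *)
Lemma fourier_gauss_rV n (xi : 'rV[R]_n) :
  \int[leb n]_x (gauss_rV v x * cos (dotp xi x)) =
    expR (- (v ^+ 2 * (\sum_(i < n) xi ord0 i ^+ 2) / 4)) /\
  \int[leb n]_x (gauss_rV v x * sin (dotp xi x)) = 0.
Proof.
have ic m (eta : 'rV[R]_m) : (leb m).-integrable [set: 'rV[R]_m]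
    (EFin \o (fun x => gauss_rV v x * cos (dotp eta x))).
  apply: (integrable_mul_bounded (integrable_gauss_rV m) (measurable_cos_dotp _)) => x.
  exact: normr_cos_le1.
have is_ m (eta : 'rV[R]_m) : (leb m).-integrable [set: 'rV[R]_m]
    (EFin \o (fun x => gauss_rV v x * sin (dotp eta x))).
  apply: (integrable_mul_bounded (integrable_gauss_rV m) (measurable_sin_dotp _)) => x.
  exact: normr_sin_le1.
have ic1 e : mu.-integrable [set: R] (fun t => (gauss1 v t * cos (e * t))%:E).
  apply: (integrable_mul_bounded (integrable_gauss1 v0) (measurable_cosM e)) => x.
  exact: normr_cos_le1.
have is1 e : mu.-integrable [set: R] (fun t => (gauss1 v t * sin (e * t))%:E).
  apply: (integrable_mul_bounded (integrable_gauss1 v0) (measurable_sinM e)) => x.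
  exact: normr_sin_le1.
elim: n xi => [|n IH] xi.
  split.
    rewrite /Rintegral [leb 0]/= integral_dirac //.
      rewrite diracT mul1e /=.
      by rewrite /gauss_rV /dotp !big_ord0 cos0 mulr1 mulr0 mul0r oppr0 expR0.
    exact: measurable_int (ic _ _).
  rewrite /Rintegral [leb 0]/= integral_dirac //.
    rewrite diracT mul1e /=.
    by rewrite /gauss_rV /dotp !big_ord0 sin0 mulr0.
  exact: measurable_int (is_ _ _).
have [[eta e] ->] := rV_rcons_surj xi.
have [IHc IHs] := IH eta.
have inner a b (x : 'rV[R]_n) :
    \int[mu]_t (gauss_rV v x * a * (gauss1 v t * cos (e * t)) +
                gauss_rV v x * b * (gauss1 v t * sin (e * t))) =
    expR (- (v ^+ 2 * e ^+ 2 / 4)) * (gauss_rV v x * a).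
  rewrite RintegralD //; [|exact: (integrableZl measurableT _ (ic1 e))|
    exact: (integrableZl measurableT _ (is1 e))].
  rewrite !RintegralZl //; [|exact: is1|exact: ic1].
  have -> : \int[mu]_t (gauss1 v t * cos (e * t)) = expR (- (v ^+ 2 * e ^+ 2 / 4)).
    exact: integral_gauss1_cos.
  have -> : \int[mu]_t (gauss1 v t * sin (e * t)) = 0.
    exact: integral_gauss1_sin.
  by rewrite mulr0 addr0 mulrC.
split; rewrite Rintegral_rV_rcons //.
- transitivity (\int[leb n]_x (expR (- (v ^+ 2 * e ^+ 2 / 4)) *
      (gauss_rV v x * cos (dotp eta x)))).
    apply: eq_Rintegral => x _.
    rewrite -(inner _ (- sin (dotp eta x))); apply: eq_Rintegral => t _.
    by rewrite gauss_rV_rcons dotp_rcons /= cosD; ring.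
  rewrite RintegralZl // IHc -expRD big_ord_recr /= rV_rcons_ordmax /=.
  congr expR; under [in RHS]eq_bigr do rewrite rV_rcons_widen; ring.
- transitivity (\int[leb n]_x (expR (- (v ^+ 2 * e ^+ 2 / 4)) *
      (gauss_rV v x * sin (dotp eta x)))).
    apply: eq_Rintegral => x _.
    rewrite -(inner _ (cos (dotp eta x))); apply: eq_Rintegral => t _.
    by rewrite gauss_rV_rcons dotp_rcons /= sinD; ring.
  by rewrite RintegralZl // IHs mulr0.
Qed.

End fixed_width.
End gaussian_rV.

(** * The binomial series *)

Section binomial_series.
Context {R : realType}.

(** The coefficient of u^k in the binomial series of (1 - u)^s. *)
Fixpoint bincoef (s : R) (k : nat) : R :=
  if k is k'.+1 then bincoef s k' * ((k'%:R - s) / k%:R) else 1.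

Lemma bincoefS (s : R) k : bincoef s k.+1 = bincoef s k * ((k%:R - s) / k.+1%:R).
Proof. by []. Qed.

(** The coefficients of the derivative of (1 - u)^s. *)
Lemma bincoefS_shift (s : R) k : k.+1%:R * bincoef s k.+1 = - s * bincoef (s - 1) k.
Proof.
elim: k => [|k IH]; first by rewrite /= mul1r mul1r sub0r divr1 mulr1.
have k0 : 0 <= k%:R :> R by [].
rewrite [bincoef s k.+2]bincoefS [bincoef (s - 1) k.+1]bincoefS [RHS]mulrA -IH.
by rewrite -!natr1; field; rewrite !gt_eqF //; lra.
Qed.

Definition binsum (s u : R) (n : nat) : R := \sum_(0 <= k < n) bincoef s k * u ^+ k.

Lemma binsumS (s u : R) n : binsum s u n.+1 = binsum s u n + bincoef s n * u ^+ n.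
Proof. by rewrite /binsum big_nat_recr. Qed.

(** Partial sums of the coefficients telescope: dividing the series of (1 - u)^s
    by 1 - u sums its coefficients. *)
Lemma binsum1 (s : R) n : binsum s 1 n.+1 = bincoef (s - 1) n.
Proof.
rewrite /binsum; elim: n => [|n IH]; first by rewrite big_nat1 /= mulr1.
rewrite big_nat_recr //= IH expr1n mulr1 -[bincoef s n * _]/(bincoef s n.+1).
have n1 : n.+1%:R != 0 :> R by [].
apply: (mulfI n1); rewrite mulrDr bincoefS_shift -[X in _ = _ * X]/(bincoef (s - 1) n.+1) bincoefS.
have n0 : 0 <= n%:R :> R by [].
by rewrite -natr1; field; rewrite gt_eqF //; lra.
Qed.

Lemma bincoef_le0 (s : R) k : 0 < s -> s <= 1 -> bincoef s k.+1 <= 0.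
Proof.
move=> s0 s1; elim: k => [|k IH]; first by rewrite /= mul1r sub0r divr1 oppr_le0 ltW.
rewrite bincoefS mulr_le0_ge0 // divr_ge0 // subr_ge0 (le_trans s1) //.
by rewrite ler1n.
Qed.

Lemma bincoef_ge0 (s : R) k : 1 < s -> s <= 2 -> 0 <= bincoef s k.+2.
Proof.
move=> s0 s1; elim: k => [|k IH].
  rewrite /= mul1r sub0r divr1 mulr_le0 //; first by rewrite oppr_le0; lra.
  by rewrite ler_pdivrMr // mul0r; lra.
rewrite bincoefS mulr_ge0 // divr_ge0 // subr_ge0 (le_trans s1) //.
by rewrite ler_nat.
Qed.

Lemma bincoef_norm_le1 (s : R) k : -1 <= s -> s <= 1 -> `|bincoef s k| <= 1.
Proof.
move=> s0 s1; elim: k => [|k IH]; first by rewrite /= normr1.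
rewrite bincoefS normrM mulr_ile1 // normrM [`|_^-1|]gtr0_norm ?invr_gt0 //.
rewrite ler_pdivrMr // mul1r ler_norml -natr1.
have : 0 <= k%:R :> R by [].
by move=> ?; apply/andP; split; lra.
Qed.

(** From index 1 on (if s <= 1) or 2 on (if s > 1), the coefficients have a constant
    sign, so that the sum of their absolute values is a partial sum of the
    coefficients themselves, up to the first ones; it is given by [binsum1] and
    bounded by [bincoef_norm_le1]. *)
Lemma sum_norm_bincoef (s : R) n : 0 < s -> s <= 2 -> \sum_(0 <= k < n) `|bincoef s k| <= 4.
Proof.
move=> s0 s2.
case: n => [|n]; first by rewrite big_geq.
have := binsum1 s n; rewrite /binsum.
under eq_bigr do rewrite expr1n mulr1.
have [s1|s1] := leP s 1.
  rewrite !big_nat_recl //= normr1 => h.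
  rewrite (eq_bigr (fun k => - bincoef s k.+1)); last first.
    by move=> k _; rewrite ler0_norm // bincoef_le0.
  have -> : \sum_(0 <= i < n) - bincoef s i.+1 = 1 - bincoef (s - 1) n.
    by rewrite sumrN -h; ring.
  have := bincoef_norm_le1 n (s := s - 1).
  move=> /(_ _ _)/ler_normlP[]; rewrite ?lerBrDr ?lerBlDr; lra.
case: n => [|n].
  by rewrite !big_nat1 /= normr1 => _; lra.
rewrite !big_nat_recl //= normr1 mul1r sub0r divr1 normrN (gtr0_norm s0) => h.
rewrite (eq_bigr (fun k => bincoef s k.+2)); last first.
  by move=> k _; rewrite ger0_norm // bincoef_ge0.
have -> : \sum_(0 <= i < n) bincoef s i.+2 = bincoef (s - 1) n.+1 - 1 + s.
  rewrite /= -h; ring.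
have : bincoef (s - 1) n.+1 <= 0 by apply: bincoef_le0; lra.
lra.
Qed.

Lemma bincoefD (s : R) n : bincoef (s - 1) n + bincoef s n.+1 = bincoef (s - 1) n.+1.
Proof.
by rewrite -!binsum1 /binsum [in RHS]big_nat_recr //= expr1n mulr1.
Qed.

Definition dbinsum (s x : R) (n : nat) : R :=
  \sum_(0 <= k < n) bincoef s k * (k%:R * x ^+ k.-1).

Lemma dbinsumS (s x : R) n :
  dbinsum s x n.+1 = dbinsum s x n + bincoef s n * (n%:R * x ^+ n.-1).
Proof. by rewrite /dbinsum big_nat_recr. Qed.

Lemma is_derive_binsum (s x : R) n :
  is_derive x 1 (fun x : R => binsum s x n) (dbinsum s x n).
Proof.
elim: n => [|n IH].
  rewrite /dbinsum big_geq // (_ : (fun x => binsum s x 0) = cst 0).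
    exact: is_derive_cst.
  by apply/funext => y; rewrite /binsum big_geq.
rewrite /dbinsum big_nat_recr //= (_ : (fun x => binsum s x n.+1) =
  (fun x => binsum s x n) + (fun x => bincoef s n * x ^+ n)).
  have d2 : is_derive x 1 (fun x : R => bincoef s n * x ^+ n) (bincoef s n * (n%:R * x ^+ n.-1)).
    have dX : is_derive x 1 (fun x : R => x ^+ n) (n%:R * x ^+ n.-1).
      apply: DeriveDef; first exact: exprn_derivable.
      by rewrite exp_derive /GRing.scale /= mulr1.
    exact: is_deriveZ.
  exact: is_deriveD.
by apply/funext => y; rewrite /binsum big_nat_recr.
Qed.

(** (1 - u)^s solves (1 - u) f' + s f = 0; its partial sum of order n solves it up
    to a monomial. *)
Lemma binsum_ode (s x : R) n : (1 - x) * dbinsum s x n.+1 + s * binsum s x n.+1 =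
  s * bincoef (s - 1) n * x ^+ n.
Proof.
elim: n => [|n IH].
  by rewrite /dbinsum /binsum !big_nat1 /= !mul0r !mulr0 add0r mulr1 expr0 !mulr1.
rewrite dbinsumS binsumS !mulrDr addrACA IH -bincoefD.
rewrite [bincoef s n.+1 * _]mulrA (mulrC (bincoef s n.+1)) bincoefS_shift exprS; ring.
Qed.

(** The mean value theorem for the quotient J of the partial sum by (1 - u)^s:
    J (0) = 1, and by [binsum_ode] the derivative of J is
    s c x^n (1 - x)^(-s-1), where |c| <= 1. *)
Lemma binsum_remainder (s u : R) n : 0 < u -> u < 1 -> 0 < s -> s <= 2 ->
  `|binsum s u n.+1 * expR (- s * ln (1 - u)) - 1| <=
  s * u ^+ n * expR (- (s + 1) * ln (1 - u)).
Proof.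
move=> u0 u1 s0 s2.
pose J x := binsum s x n.+1 * expR (- s * ln (1 - x)).
pose J' x := s * bincoef (s - 1) n * x ^+ n * expR (- (s + 1) * ln (1 - x)).
have dJ (x : R) : x < 1 -> is_derive x 1 J (J' x).
  move=> x1; have x1' : 0 < 1 - x by rewrite subr_gt0.
  have db := is_derive_binsum s x n.+1.
  have dl : is_derive x 1 (fun x : R => ln (1 - x)) ((1 - x)^-1 * - 1).
    apply: (@is_derive1_comp R (@ln R) (fun x => 1 - x) x _ _ (is_derive1_ln x1')).
    have := is_deriveB (is_derive_cst (1 : R) x (1 : R)) (is_derive_id x (1 : R)).
    by rewrite sub0r.
  have dE : is_derive x 1 (fun x : R => expR (- s * ln (1 - x)))
     (expR (- s * ln (1 - x)) * (- s * ((1 - x)^-1 * - 1))).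
    apply: (@is_derive1_comp R expR (fun x => - s * ln (1 - x)) x _ _
      (is_derive_expR _)).
  apply: is_derive_eq (is_deriveM db dE) _.
  rewrite /J' /GRing.scale /= -binsum_ode.
  rewrite (_ : - (s + 1) * ln (1 - x) = - s * ln (1 - x) - ln (1 - x)); last by ring.
  rewrite expRD expRN lnK ?posrE //.
  by field; rewrite gt_eqF.
have h1 (x : R) : x \in `]0, u[ -> is_derive x 1 J (J' x).
  by rewrite in_itv /= => /andP[_ xu]; apply: dJ; rewrite (lt_trans xu).
have h2 : {within `[0, u], continuous J}.
  apply: derivable_within_continuous => x; rewrite in_itv /= => /andP[_ xu].
  by apply: ex_derive; apply: dJ; rewrite (le_lt_trans xu).
have [c] := MVT_segment (ltW u0) h1 h2.
rewrite in_itv /= => /andP[c0 cu].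
have -> : J 0 = 1.
  rewrite /J subr0 ln1 mulr0 expR0 mulr1 /binsum big_nat_recl //= expr0 mulr1.
  by rewrite big1 ?addr0 // => k _; rewrite exprS mul0r mulr0.
rewrite -/(J u) => ->; rewrite subr0 normrM (gtr0_norm u0) /J' !normrM (gtr0_norm s0).
rewrite normrX (ger0_norm c0) (ger0_norm (expR_ge0 _)).
have c1 : c < 1 by rewrite (le_lt_trans cu).
rewrite -[leRHS]mulr1 ler_pM ?mulr_ge0 ?expR_ge0 ?exprn_ge0 ?(ltW s0) ?(ltW u0) ?(ltW u1) //.
rewrite ler_pM ?mulr_ge0 ?expR_ge0 ?exprn_ge0 ?(ltW s0) //.
  rewrite ler_pM ?mulr_ge0 ?exprn_ge0 ?(ltW s0) ?lerXn2r ?nnegrE ?(ltW u0) //.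
  by rewrite ger_pMr // bincoef_norm_le1 //; lra.
rewrite ler_expR !mulNr lerN2 ler_pM2l ?ler_ln ?posrE; lra.
Qed.

Lemma binsum_cvg_lt1 (s u : R) : 0 <= u -> u < 1 -> 0 < s -> s <= 2 ->
  binsum s u n @[n --> \oo] --> (1 - u) `^ s.
Proof.
move=> u0 u1 s0 s2; rewrite -cvg_shiftS /=.
have u1' : 0 < 1 - u by rewrite subr_gt0.
have pE : (1 - u) `^ s = expR (s * ln (1 - u)) by rewrite /powR gt_eqF.
move: u0; rewrite le_eqVlt => /predU1P[u0|u0].
  rewrite -u0 subr0 powR1; apply: cvg_near_cst; apply: nearW => n.
  rewrite /binsum big_nat_recl //= expr0 mulr1.
  by rewrite big1 ?addr0 // => k _; rewrite exprS mul0r mulr0.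
have h : binsum s u n.+1 * expR (- s * ln (1 - u)) - 1 @[n --> \oo] --> 0.
  apply/norm_cvg0P; apply: (squeeze_cvgr (f := fun=> 0)
    (h := fun n => s * u ^+ n * expR (- (s + 1) * ln (1 - u)))).
  - by apply: nearW => n; rewrite normr_ge0 /= binsum_remainder.
  - exact: cvg_cst.
  - have hu : (u ^+ n : R) @[n --> \oo] --> 0.
      by apply: cvg_expr; rewrite gtr0_norm.
    have := cvgM (cvgM (cvg_cst s) hu) (cvg_cst (expR (- (s + 1) * ln (1 - u)))).
    by rewrite mulr0 mul0r; apply.
rewrite (_ : (fun n => binsum s u n.+1) = (fun n =>
    (binsum s u n.+1 * expR (- s * ln (1 - u)) - 1 + 1) * expR (s * ln (1 - u)))).
  have -> : (1 - u) `^ s = (0 + 1) * expR (s * ln (1 - u)).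
    by rewrite add0r mul1r.
  by apply: cvgM; [apply: cvgD => //; exact: cvg_cst|exact: cvg_cst].
apply/funext => n; rewrite subrK -mulrA -expRD mulNr addNr expR0.
by rewrite mulr1.
Qed.

(** Convergence of the series at u = 1, as [binsum1] shows.  For s > 1 the
    coefficients of (1 - u)^(s-1) are O(1/n) by [bincoefS_shift].  For s <= 1 those of
    (1 - u)^s after the first one are nonpositive, so that the partial sums at
    u = 1 are at most those at any u < 1, which tend to (1 - u)^s; and this is
    small for u near 1. *)
Lemma bincoef_cvg0 (s : R) : 0 < s -> s <= 2 -> bincoef (s - 1) n @[n --> \oo] --> 0.
Proof.
move=> s0 s2; have [s1|s1] := leP s 1; last first.
  rewrite -cvg_shiftS; apply/norm_cvg0P.
  apply: (squeeze_cvgr (f := fun=> 0) (h := fun n : nat => n.+1%:R^-1)).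
  - apply: nearW => n; rewrite normr_ge0 /=.
    have n1 : 0 < n.+1%:R :> R by [].
    rewrite -[leRHS]mulr1 -ler_pdivrMl // invrK -[X in X * _](gtr0_norm n1) -normrM.
    rewrite -/(bincoef (s - 1) n.+1) bincoefS_shift normrM normrN mulr_ile1 //.
      by rewrite ger0_norm; lra.
    by apply: bincoef_norm_le1; lra.
  - exact: cvg_cst.
  - exact: cvg_harmonic.
apply/cvgr0Pnorm_lt => e e0.
(* so that (1 - u)^s = min (e/2, 1/2) *)
pose u : R := 1 - expR (s^-1 * ln (Num.min (e / 2) 2^-1)).
have m0 : 0 < Num.min (e / 2) 2^-1 :> R by rewrite lt_min divr_gt0 //= invr_gt0.
have u1 : u < 1 by rewrite ltrBlDr ltrDl expR_gt0.
have u0 : 0 <= u.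
  rewrite subr_ge0 -[leRHS]expR0 ler_expR mulr_ge0_le0 ?invr_ge0 ?(ltW s0) //.
  by rewrite ln_le0 // ge_min; apply/orP; right; rewrite invf_le1 ?ler1n.
have ue : (1 - u) `^ s < e.
  rewrite /powR gt_eqF ?subr_gt0 // /u subKr expRK mulrA mulfV ?gt_eqF // mul1r.
  rewrite lnK ?posrE // (@le_lt_trans _ _ (e / 2)) //; first by rewrite ge_min lexx.
  lra.
have := binsum_cvg_lt1 u0 u1 s0 s2; rewrite -cvg_shiftS => /cvgr_lt/(_ _ ue).
apply: filterS => n; apply: le_lt_trans.
have b0 : 0 <= bincoef (s - 1) n.
  elim: n => [//|n IH]; rewrite bincoefS mulr_ge0 // divr_ge0 //.
  have : 0 <= n%:R :> R by [].
  lra.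
rewrite ger0_norm // -binsum1 /binsum big_nat_recl // [leRHS]big_nat_recl //= !expr0 lerD2l.
apply: ler_sum => k _; rewrite expr1n mulr1 -/(bincoef s k.+1).
rewrite -[leLHS]mulr1 ler_wnM2l ?bincoef_le0 //.
by rewrite exprn_ile1 // ltW.
Qed.

(** The endpoint u = 1 is needed: it is the value at r = 0 of
    lambda / (lambda + r). *)
Lemma binsum_cvg (s u : R) : 0 <= u -> u <= 1 -> 0 < s -> s <= 2 ->
  binsum s u n @[n --> \oo] --> (1 - u) `^ s.
Proof.
move=> u0; rewrite le_eqVlt => /predU1P[->|]; last exact: binsum_cvg_lt1.
move=> s0 s2; rewrite subrr powR0 ?gt_eqF // -cvg_shiftS /=.
under eq_fun do rewrite binsum1.
exact: bincoef_cvg0.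
Qed.

End binomial_series.

(** * Mixtures of Gaussian densities *)

Section counting.
Context {R : realType}.

(** The sum over k is handled as an integral, so that Fubini's theorem also
    exchanges it with the other integrals. *)
Definition count : {sigma_finite_measure set nat -> \bar R} :=
  sigma_finite_measure_of (@sigma_finite_counting R).

Lemma integral_countE (f : nat -> \bar R) :
  (\int[count]_k f k = \int[counting]_k f k)%E.
Proof. by []. Qed.

Lemma integral_count_abs_le (f : nat -> R) (B : R) :
  (forall n, \sum_(0 <= k < n) `|f k| <= B) ->
  (\int[count]_k `|(f k)%:E| <= B%:E)%E.
Proof.
move=> fB; rewrite integral_countE ge0_integral_count //.
apply: lime_le; first exact: is_cvg_nneseries.
by apply: nearW => n; rewrite sumEFin lee_fin.
Qed.

Lemma Rintegral_count (f : nat -> R) (B l : R) :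
  (forall n, \sum_(0 <= k < n) `|f k| <= B) ->
  \sum_(0 <= k < n) f k @[n --> \oo] --> l ->
  \int[count]_k f k = l.
Proof.
move=> fB fl; rewrite /Rintegral integral_countE integral_count.
  rewrite (_ : (\sum_(k <oo) (f k)%:E)%E = l%:E) //.
  apply/cvg_lim => //; under eq_fun do rewrite sumEFin.
  by apply: cvg_EFin => //; exact: nearW.
rewrite /summable -nneseries_esumT //.
rewrite -ge0_integral_count // -integral_countE.
by apply: le_lt_trans (integral_count_abs_le fB) _; rewrite ltry.
Qed.

End counting.

Section gaussian_mixture.
Context {R : realType} dX (X : measurableType dX).
Variables (m : {sigma_finite_measure set X -> \bar R}) (w v : X -> R).
Hypotheses (wi : m.-integrable [set: X] (EFin \o w))
  (mv : measurable_fun [set: X] v) (v0 : forall x, w x != 0 -> 0 < v x).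
Variable d : nat.

Definition gauss_mixture (x : 'rV[R]_d) : R :=
  \int[m]_t (w t * gauss_rV (v t) x).

Let mrho : measurable_fun [set: X * 'rV[R]_d] (fun p => gauss_rV (v p.1) p.2).
Proof.
have m2 : measurable_fun [set: X * 'rV[R]_d] (fun p : X * 'rV[R]_d => (v p.1, p.2)).
  by apply: measurable_fun_pair => //; exact: measurableT_comp.
exact: (measurableT_comp (@measurable_gauss_rV2 R d) m2).
Qed.

Let rho_ge0 t (x : 'rV[R]_d) : w t != 0 -> 0 <= gauss_rV (v t) x.
Proof. by move=> wt; apply: gauss_rV_ge0; exact: v0. Qed.

Let rho1 t : w t != 0 -> (\int[leb d]_x (gauss_rV (v t) x)%:E = 1)%E.
Proof. by move=> wt; apply: integral_gauss_rV; exact: v0. Qed.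

(** Every Gaussian density has mass 1 whatever its width, so that integrability of
    the weight is enough. *)
Lemma integrable_gauss_mixture :
  (leb d).-integrable [set: 'rV[R]_d] (EFin \o gauss_mixture).
Proof.
exact: (integrable_Rintegral1 (integrable_mixture (m2 := leb d) wi mrho rho_ge0 rho1)).
Qed.

Lemma gauss_mixture_cos (xi : 'rV[R]_d) :
  \int[leb d]_x (gauss_mixture x * cos (dotp xi x)) =
  \int[m]_t (w t * expR (- (v t ^+ 2 * enorm xi ^+ 2 / 4))).
Proof.
rewrite (Rintegral_mixture_weak (m2 := leb d) wi mrho rho_ge0 rho1
  (measurable_cos_dotp xi)); last by move=> x; exact: normr_cos_le1.
apply: eq_Rintegral => t _.
have [->|wt] := eqVneq (w t) 0; first by rewrite !mul0r.
rewrite (fourier_gauss_rV (v0 wt) xi).1 /enorm sqr_sqrtr //.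
by apply: sumr_ge0 => i _; rewrite sqr_ge0.
Qed.

Lemma gauss_mixture_sin (xi : 'rV[R]_d) :
  \int[leb d]_x (gauss_mixture x * sin (dotp xi x)) = 0.
Proof.
rewrite (Rintegral_mixture_weak (m2 := leb d) wi mrho rho_ge0 rho1
  (measurable_sin_dotp xi)); last by move=> x; exact: normr_sin_le1.
rewrite (eq_Rintegral _ (g := fun=> 0)) ?Rintegral_cst ?mul0r // => t _.
have [->|wt] := eqVneq (w t) 0; first by rewrite mul0r.
by rewrite (fourier_gauss_rV (v0 wt) xi).2 mulr0.
Qed.

End gaussian_mixture.

(** * The symbol as an integral of powers *)

Section nat_product.
Context {R : realType}.

(** A preimage is a countable union of products of a point and a measurable set. *)
Lemma measurable_nat_prod d (T : measurableType d) (f : nat * T -> R) :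
  (forall k, measurable_fun [set: T] (fun t => f (k, t))) ->
  measurable_fun [set: nat * T] f.
Proof.
move=> mf _ Y mY; rewrite setTI.
rewrite (_ : f @^-1` Y = \bigcup_k ([set k] `*` ((fun t => f (k, t)) @^-1` Y))).
  apply: bigcupT_measurable => k; apply: measurableX => //.
  by rewrite -[X in measurable X]setTI; exact: mf.
apply/seteqP; split => [[k t] /= fY|[k t] [j _ [/= -> fY]]]; last exact: fY.
by exists k.
Qed.

Lemma measurable_bincoef k : measurable_fun [set: R] (bincoef ^~ k).
Proof.
elim: k => [|k IH]; first exact: measurable_cst.
apply: measurable_funM => //; apply: measurable_funM => //.
exact: measurable_funB.
Qed.

Lemma Rintegral_eq_except (f g : R -> R) (s : seq R) :
  measurable_fun [set: R] f -> measurable_fun [set: R] g ->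
  (forall x, x \notin s -> f x = g x) ->
  \int[lebesgue_measure]_x f x = \int[lebesgue_measure]_x g x.
Proof.
move=> mf mg fg; rewrite /Rintegral; congr fine; apply: ae_eq_integral => //.
- exact/measurable_EFinP.
- exact/measurable_EFinP.
exists [set` s]; split.
- by apply: countable_measurable => [t|]; [exact: measurable_set1|];
    exact/finite_set_countable/finite_seq.
- by apply: countable_lebesgue_measure0; exact/finite_set_countable/finite_seq.
move=> x /= h; apply: contrapT => xs; apply: h => _.
by rewrite fg //; apply/negP.
Qed.

End nat_product.

Section symbol.
Context {R : realType}.
Notation mu := (@lebesgue_measure R).
Notation count := (@count R).
Variables beta gamma lambda : R.
Hypotheses (beta_gt0 : 0 < beta) (gamma_gt1 : 1 < gamma) (gamma_le2 : gamma <= 2)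
  (lambda_gt1 : 1 < lambda).

(** tau^(beta-1) on the half-line, extended by 0. *)
Definition tau_pow (t : R) : R := ind_pos t * expR ((beta - 1) * ln t).

(** The coefficient of u^k in
    (1-u)^gamma - [t < gamma] (1-u)^(gamma-t)
    + [t < gamma-1] t u (1-u)^(gamma-t-1); the factor u shifts the last series. *)
Definition series_coef (k : nat) (t : R) : R :=
  bincoef gamma k - (t < gamma)%R%:R * bincoef (gamma - t) k +
  (t < gamma - 1)%R%:R * (t * (if k is k'.+1 then bincoef (gamma - t - 1) k' else 0)).

(** The exponent a of u^a; it is also the shape parameter of the Gamma
    distribution of which u^a is the Laplace transform. *)
Definition gamma_shape (k : nat) (t : R) : R := k%:R - gamma + t.

(** The signed density of the pairs (k, tau) in the expansion of P in powers of
    u.  The indicator makes the exponent positive where the density is not 0. *)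
Definition weight_kt (p : nat * R) : R :=
  tau_pow p.2 * expR ((gamma - p.2) * ln lambda) *
  (series_coef p.1 p.2 * ind_pos (gamma_shape p.1 p.2)).

Lemma tau_pow_ge0 t : 0 <= tau_pow t.
Proof. by rewrite mulr_ge0 ?ind_pos_ge0 ?expR_ge0. Qed.

Lemma tau_pow_le0 t : t <= 0 -> tau_pow t = 0.
Proof. by move=> t0; rewrite /tau_pow ind_posE ltNge t0 mul0r. Qed.

Lemma tau_pow_powR t : 0 < t -> tau_pow t = t `^ (beta - 1).
Proof. by move=> t0; rewrite /tau_pow ind_posE t0 mul1r /powR gt_eqF. Qed.

Lemma measurable_tau_pow : measurable_fun [set: R] tau_pow.
Proof.
apply: measurable_funM; first exact: measurable_ind_pos.
by apply: measurableT_comp => //; apply: measurable_funM.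
Qed.

Lemma measurable_ind_lt (c : R) : measurable_fun [set: R] (fun t => (t < c)%R%:R : R).
Proof.
rewrite (_ : (fun t => _) = \1_(`]-oo, c[%classic)); first exact: measurable_indic.
by apply/funext => t; rewrite indicE mem_setE in_itv.
Qed.

(** This is where the shape of the decomposition matters: for k = 0 the
    coefficient is 1 - 1 if t < gamma, for k = 1 it is
    - gamma + (gamma - t) + t if t < gamma - 1, and for k >= 2 the exponent is
    positive as gamma <= 2.  For t in {gamma - 1, gamma}, a null set, the exponent may
    be 0. *)
Lemma series_coef_ind_pos k t : 0 < t -> t != gamma -> t != gamma - 1 ->
  series_coef k t * ind_pos (gamma_shape k t) = series_coef k t.
Proof.
have [g1 g2] := (gamma_gt1, gamma_le2).
move=> t0 tg tg1; rewrite ind_posE /gamma_shape; case: ltP => [_|a0]; rewrite ?mulr1 // mulr0.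
case: k a0 => [|[|k]] a0; last first.
- exfalso; have k0 : 0 <= k%:R :> R by [].
  by move: a0; rewrite -!natr1 leNgt => /negP; apply; move: k0 t0 gamma_le2; lra.
- have lt1 : t < gamma - 1 by rewrite lt_neqAle tg1 /=; lra.
  have lt2 : t < gamma by lra.
  by rewrite /series_coef lt1 lt2 /=; field.
- have lt2 : t < gamma by rewrite lt_neqAle tg /=; lra.
  by rewrite /series_coef lt2 /= !mulr0 mul1r subrr addr0.
Qed.

(** Each of the three binomial series contributes at most 4, the last one because
    its factor t is less than gamma - 1 <= 1. *)
Lemma sum_norm_series_coef t n : 0 < t -> \sum_(0 <= k < n) `|series_coef k t| <= 12.
Proof.
have [g1 g2] := (gamma_gt1, gamma_le2).
move=> t0.
pose b k := if k is k'.+1 then bincoef (gamma - t - 1) k' else 0.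
apply: (@le_trans _ _ (\sum_(0 <= k < n) `|bincoef gamma k| +
    (t < gamma)%R%:R * \sum_(0 <= k < n) `|bincoef (gamma - t) k| +
    (t < gamma - 1)%R%:R * (t * \sum_(0 <= k < n) `|b k|))).
  rewrite !big_distrr -!big_split /=; apply: ler_sum => k _.
  rewrite /series_coef -/(b k); apply: (le_trans (ler_normD _ _)); apply: lerD.
    apply: (le_trans (ler_normB _ _)); rewrite lerD2l.
    by rewrite normrM ger0_norm.
  by rewrite !normrM ger0_norm // (gtr0_norm t0).
have h1 : \sum_(0 <= k < n) `|bincoef gamma k| <= 4 by apply: sum_norm_bincoef; lra.
have h2 : (t < gamma)%R%:R * \sum_(0 <= k < n) `|bincoef (gamma - t) k| <= 4.
  case: ltP => tg; last by rewrite mul0r.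
  by rewrite mul1r; apply: sum_norm_bincoef; lra.
have h3 : (t < gamma - 1)%R%:R * (t * \sum_(0 <= k < n) `|b k|) <= 4.
  case: ltP => tg; last by rewrite mul0r.
  rewrite mul1r; case: n {h1 h2} => [|n]; first by rewrite big_geq // mulr0.
  rewrite big_nat_recl //= normr0 add0r.
  have : \sum_(0 <= i < n) `|bincoef (gamma - t - 1) i| <= 4 by apply: sum_norm_bincoef; lra.
  have : 0 <= \sum_(0 <= i < n) `|bincoef (gamma - t - 1) i| by apply: sumr_ge0.
  by nra.
lra.
Qed.

Lemma cvg_sum_series_coef t u : 0 < t -> t != gamma -> t != gamma - 1 -> 0 <= u -> u <= 1 ->
  \sum_(0 <= k < n) (series_coef k t * u ^+ k) @[n --> \oo] -->
  (1 - u) `^ gamma - (t < gamma)%R%:R * (1 - u) `^ (gamma - t) +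
  (t < gamma - 1)%R%:R * (t * u * (1 - u) `^ (gamma - t - 1)).
Proof.
have [g1 g2] := (gamma_gt1, gamma_le2).
move=> t0 tg tg1 u0 u1.
rewrite -cvg_shiftS.
rewrite (_ : (fun n : nat => _) = (fun n => binsum gamma u n.+1 -
   (t < gamma)%R%:R * binsum (gamma - t) u n.+1 +
   (t < gamma - 1)%R%:R * (t * u * binsum (gamma - t - 1) u n))); last first.
  apply/funext => n; rewrite /binsum !big_distrr.
  have -> : \sum_(0 <= k < n.+1) series_coef k t * u ^+ k =
     \sum_(0 <= k < n.+1) (bincoef gamma k * u ^+ k -
       (t < gamma)%R%:R * (bincoef (gamma - t) k * u ^+ k)) +
     \sum_(0 <= k < n.+1) (t < gamma - 1)%R%:R *
       (t * (if k is k'.+1 then bincoef (gamma - t - 1) k' else 0) * u ^+ k).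
    rewrite -big_split /=; apply: eq_bigr => k _; rewrite /series_coef.
    move: (_%:R) (_%:R) (bincoef gamma k) (bincoef (gamma - t) k) 
      (if k is _.+1 then _ else _) => a1 a2 a3 a4 a5.
    ring.
  rewrite sumrB; congr (_ - _ + _).
  rewrite big_nat_recl //= mulr0 mul0r mulr0 add0r.
  by apply: eq_bigr => k _; rewrite exprS /=; ring.
have hS (s : R) : 0 < s -> s <= 2 -> binsum s u n.+1 @[n --> \oo] --> (1 - u) `^ s.
  by move=> s0 s2; rewrite (cvg_shiftS (binsum s u)); exact: binsum_cvg.
apply: cvgD.
  apply: cvgB; first by apply: hS => //; lra.
  case: ltP => tg'; last by rewrite mul0r; under eq_fun do rewrite mul0r; exact: cvg_cst.
  apply: cvgM; first exact: cvg_cst.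
  by apply: hS; lra.
case: ltP => tg'; last by rewrite mul0r; under eq_fun do rewrite mul0r; exact: cvg_cst.
apply: cvgM; first exact: cvg_cst.
apply: cvgM; first exact: cvg_cst.
by apply: binsum_cvg => //; lra.
Qed.

Lemma measurable_series_coef k : measurable_fun [set: R] (series_coef k).
Proof.
have m1 : measurable_fun [set: R] (fun t : R => gamma - t) by exact: measurable_funB.
apply: measurable_funD; last first.
  apply: measurable_funM; first exact: measurable_ind_lt.
  apply: measurable_funM => //; case: k => [|k]; first exact: measurable_cst.
  apply: (measurableT_comp (measurable_bincoef k)); exact: measurable_funB.
apply: measurable_funB; first exact: measurable_cst.
apply: measurable_funM; first exact: measurable_ind_lt.
exact: (measurableT_comp (measurable_bincoef k)).
Qed.

Lemma measurable_gamma_shape : measurable_fun [set: nat * R] (fun p => gamma_shape p.1 p.2).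
Proof.
apply: measurable_nat_prod => k; rewrite /gamma_shape /=.
by apply: measurable_funD => //; exact: measurable_cst.
Qed.

Lemma measurable_weight_kt : measurable_fun [set: nat * R] weight_kt.
Proof.
apply: measurable_nat_prod => k; rewrite /weight_kt /=.
apply: measurable_funM.
  apply: measurable_funM; first exact: measurable_tau_pow.
  apply: measurableT_comp => //; apply: measurable_funM => //.
  exact: measurable_funB.
apply: measurable_funM; first exact: measurable_series_coef.
apply: (measurableT_comp measurable_ind_pos); rewrite /gamma_shape.
by apply: measurable_funD => //; exact: measurable_cst.
Qed.

Lemma ln_lambda_gt0 : 0 < ln lambda.
Proof. exact: ln_gt0. Qed.

Lemma integral_tau_pow_expR (L : R) : 0 < L ->
  (\int[mu]_t (tau_pow t * expR (- t * L))%:E = (Gamma_fun beta * expR (- (beta * ln L)))%:E)%E.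
Proof.
move=> L0; rewrite -(integral_gamma_density_scale beta_gt0 L0).
apply: eq_integral => t _.
by rewrite /tau_pow -mulrA -expRD; congr (_ * expR _)%:E; ring.
Qed.

Lemma integrable_tau_pow_expR (L : R) : 0 < L ->
  mu.-integrable [set: R] (fun t => (tau_pow t * expR (- t * L))%:E).
Proof.
move=> L0; apply/integrableP; split.
  apply/measurable_EFinP; apply: measurable_funM; first exact: measurable_tau_pow.
  apply: (measurableT_comp (@measurable_expR R)).
  by apply: measurable_funM; [exact: oppr_measurable|exact: measurable_cst].
under eq_integral do rewrite gee0_abs ?lee_fin ?mulr_ge0 ?tau_pow_ge0 ?expR_ge0 //.
by rewrite integral_tau_pow_expR // ltry.
Qed.

(** Summing over k first leaves the majorant
    12 lambda^gamma tau^(beta-1) lambda^(-tau), which is integrable because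
    lambda > 1. *)
Lemma integrable_weight_kt :
  (count \x mu)%E.-integrable [set: nat * R] (EFin \o weight_kt).
Proof.
have mw : measurable_fun [set: nat * R] (EFin \o weight_kt).
  by apply/measurable_EFinP; exact: measurable_weight_kt.
pose ms : {sigma_finite_measure set (measurableTypeR R) -> \bar R} := mu.
have [_ wP] := integrable21ltyP count ms mw; apply: wP.
pose M := 12 * expR (gamma * ln lambda).
have iq := integrableZl measurableT M (integrable_tau_pow_expR ln_lambda_gt0).
apply: (@le_lt_trans _ _ (\int[mu]_t (M%:E * (tau_pow t * expR (- t * ln lambda))%:E))%E); last first.
  case/integrableP : iq => _; apply: le_lt_trans.
  rewrite le_eqVlt; apply/orP; left; apply/eqP; apply: eq_integral => t _.
  by rewrite gee0_abs // -EFinM lee_fin !mulr_ge0 ?tau_pow_ge0 ?expR_ge0.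
apply: ge0_le_integral => //.
- by move=> t _; exact: integral_ge0.
- apply: (measurable_fun_fubini_tonelli_G (abse \o (EFin \o weight_kt))) => /= [|z].
    exact: (measurableT_comp (@abse_measurable R setT) mw).
  by rewrite lee_fin.
- exact: measurable_int iq.
- move=> t _; have [t0|t0] := ltP 0 t; last first.
    rewrite integral0_eq; first by rewrite -EFinM lee_fin !mulr_ge0 ?tau_pow_ge0 ?expR_ge0.
    by move=> k _; rewrite /weight_kt /= tau_pow_le0 // !mul0r normr0.
  rewrite -EFinM; apply: (integral_count_abs_le (f := fun k => weight_kt (k, t))) => n.
  apply: (@le_trans _ _ (tau_pow t * expR ((gamma - t) * ln lambda) *
      \sum_(0 <= k < n) `|series_coef k t|)).
    rewrite big_distrr /=; apply: ler_sum => k _.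
    rewrite /weight_kt /= normrM ger0_norm ?mulr_ge0 ?tau_pow_ge0 ?expR_ge0 //.
    rewrite ler_wpM2l ?mulr_ge0 ?tau_pow_ge0 ?expR_ge0 // normrM ler_piMr //.
    by rewrite ger0_norm ?ind_pos_ge0 // ind_posE; case: (0 < _).
  have -> : M * (tau_pow t * expR (- t * ln lambda)) =
      tau_pow t * expR ((gamma - t) * ln lambda) * 12.
    by rewrite mulrBl mulNr expRD /M; ring.
  by rewrite ler_wpM2l ?mulr_ge0 ?tau_pow_ge0 ?expR_ge0 // sum_norm_series_coef.
Qed.

Section fixed_r.
Variable r : R.
Hypothesis r0 : 0 <= r.

Let lr0 : 0 < lambda + r.
Proof. by have := lambda_gt1; have := r0; lra. Qed.

Let l0 : 0 < lambda. Proof. by have := lambda_gt1; lra. Qed.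

(** Gamma(beta) P is the integral of tau^(beta-1) times this function of tau. *)
Definition remainder_integrand (t : R) : R := r `^ gamma * expR (- t * ln (lambda + r)) -
  (t < gamma)%R%:R * r `^ (gamma - t) +
  (t < gamma - 1)%R%:R * (lambda * t * r `^ (gamma - t - 1)).

Let ell : R := ln (1 + r / lambda).

Let ellE : ell = ln (lambda + r) - ln lambda.
Proof.
rewrite /ell -ln_div ?posrE //; congr ln; field.
by rewrite gt_eqF.
Qed.

Let u : R := lambda / (lambda + r).

Let uE : u = expR (- ell).
Proof. by rewrite ellE opprB expRD expRN !lnK ?posrE. Qed.

Let u0 : 0 <= u. Proof. by rewrite divr_ge0 ?ltW. Qed.
Let u1 : u <= 1. Proof. by rewrite ler_pdivrMr // mul1r lerDl. Qed.

Let u1r : r = (1 - u) * (lambda + r).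
Proof. by rewrite /u; field; rewrite gt_eqF. Qed.

(** r = (1 - u) (lambda + r). *)
Let powR_u1 s : expR (s * ln (lambda + r)) * (1 - u) `^ s = r `^ s.
Proof.
have pE : (lambda + r) `^ s = expR (s * ln (lambda + r)) by rewrite /powR gt_eqF.
by rewrite [in RHS]u1r powRM ?subr_ge0 ?(ltW lr0) // pE mulrC.
Qed.

(** The expansion of the integrand in powers of u = exp (- ell). *)
Lemma Rintegral_count_weight_kt t : t \notin [:: gamma; gamma - 1] ->
  \int[count]_k (weight_kt (k, t) * expR (- gamma_shape k t * ell)) =
  tau_pow t * remainder_integrand t.
Proof.
rewrite !inE negb_or => /andP[tg tg1].
have [t0|t0] := ltP 0 t; last first.
  rewrite (eq_Rintegral _ (g := fun=> 0)) ?Rintegral_cst ?mul0r //.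
    by rewrite tau_pow_le0 // mul0r.
  by move=> k _; rewrite /weight_kt /= tau_pow_le0 // !mul0r.
(* lambda^(gamma-t) u^(k-gamma+t) = (lambda+r)^(gamma-t) u^k *)
pose A := tau_pow t * expR ((gamma - t) * ln (lambda + r)).
have wE k : weight_kt (k, t) * expR (- gamma_shape k t * ell) = A * (series_coef k t * u ^+ k).
  rewrite /weight_kt /= series_coef_ind_pos // uE -expRM_natl /A.
  have -> : - gamma_shape k t * ell = (gamma - t) * (ln (lambda + r) - ln lambda) + k%:R * - ell.
    by rewrite -ellE /gamma_shape; ring.
  by rewrite expRD mulrBr expRD expRN; field; rewrite gt_eqF ?expR_gt0.
apply: (Rintegral_count (B := A * 12)).
  move=> n; apply: (@le_trans _ _ (A * \sum_(0 <= k < n) `|series_coef k t|)).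
    rewrite big_distrr /=; apply: ler_sum => k _.
    rewrite wE normrM (@ger0_norm _ A) ?mulr_ge0 ?tau_pow_ge0 ?expR_ge0 //.
    rewrite ler_wpM2l ?mulr_ge0 ?tau_pow_ge0 ?expR_ge0 // normrM ler_piMr //.
    by rewrite ger0_norm ?exprn_ge0 // exprn_ile1.
  by rewrite ler_wpM2l ?mulr_ge0 ?tau_pow_ge0 ?expR_ge0 // sum_norm_series_coef.
have -> : (fun n => \sum_(0 <= k < n) weight_kt (k, t) * expR (- gamma_shape k t * ell)) =
    (fun n => A * \sum_(0 <= k < n) (series_coef k t * u ^+ k)).
  by apply/funext => n; rewrite big_distrr /=; apply: eq_bigr => k _; rewrite wE.
have -> : tau_pow t * remainder_integrand t = A * ((1 - u) `^ gamma -
  (t < gamma)%R%:R * (1 - u) `^ (gamma - t) +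
  (t < gamma - 1)%R%:R * (t * u * (1 - u) `^ (gamma - t - 1))).
  rewrite /A -mulrA; congr (_ * _).
  have e1 : r `^ gamma * expR (- t * ln (lambda + r)) =
      expR ((gamma - t) * ln (lambda + r)) * (1 - u) `^ gamma.
    by rewrite -powR_u1 mulrBl mulNr expRD; ring.
  have e2 := powR_u1 (gamma - t).
  have e3 : lambda * r `^ (gamma - t - 1) =
      expR ((gamma - t) * ln (lambda + r)) * (u * (1 - u) `^ (gamma - t - 1)).
    rewrite -powR_u1 (mulrBl _ (gamma - t) 1) mul1r expRD expRN lnK ?posrE // /u.
    by field; rewrite gt_eqF.
  rewrite /remainder_integrand e1 -e2 (mulrC lambda t) -(mulrA t lambda) e3.
  move: (_%:R) (_%:R) => a1 a2; ring.
apply: cvgM; first exact: cvg_cst.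
exact: cvg_sum_series_coef.
Qed.

Let ell_ge0 : 0 <= ell.
Proof. by rewrite ln_ge0 // lerDl divr_ge0 // ltW. Qed.

Let measurable_powR_r (c : R) : measurable_fun [set: R] (fun t => r `^ (c - t)).
Proof.
by apply: (measurableT_comp (measurable_powRr r)); exact: measurable_funB.
Qed.

Let measurable_expRN (c : R) : measurable_fun [set: R] (fun t => expR (- t * c)).
Proof.
apply: (measurableT_comp (@measurable_expR R)).
by apply: measurable_funM; [exact: oppr_measurable|exact: measurable_cst].
Qed.

Lemma measurable_remainder_integrand : measurable_fun [set: R] remainder_integrand.
Proof.
apply: measurable_funD.
  apply: measurable_funB.
    by apply: measurable_funM; [exact: measurable_cst|exact: measurable_expRN].
  by apply: measurable_funM; [exact: measurable_ind_lt|exact: measurable_powR_r].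
apply: measurable_funM; first exact: measurable_ind_lt.
apply: measurable_funM; first by apply: measurable_funM.
rewrite (_ : (fun t => _) = (fun t => r `^ (gamma - 1 - t))); first exact: measurable_powR_r.
by apply/funext => t; congr (_ `^ _); ring.
Qed.

Lemma Rintegral_weight_kt :
  \int[(count \x mu)%E]_p (weight_kt p * expR (- gamma_shape p.1 p.2 * ell)) =
  \int[mu]_t (tau_pow t * remainder_integrand t).
Proof.
pose phi p := ind_pos (gamma_shape p.1 p.2) * expR (- gamma_shape p.1 p.2 * ell).
have mphi : measurable_fun [set: nat * R] phi.
  apply: measurable_funM; first exact: (measurableT_comp measurable_ind_pos measurable_gamma_shape).
  apply: (measurableT_comp (@measurable_expR R)).
  apply: measurable_funM; last exact: measurable_cst.
  exact: (measurableT_comp (@oppr_measurable R setT) measurable_gamma_shape).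
have phi1 p : `|phi p| <= 1.
  rewrite /phi ind_posE; case: ltP => [e0|_]; last by rewrite mul0r normr0.
  rewrite mul1r ger0_norm ?expR_ge0 // -expR0 ler_expR.
  by rewrite mulNr oppr_le0 mulr_ge0 // ltW.
have wphi p : weight_kt p * expR (- gamma_shape p.1 p.2 * ell) = weight_kt p * phi p.
  rewrite /weight_kt /phi ind_posE; case: ltP => _; first by rewrite mul1r.
  by rewrite !mulr0 !mul0r.
have wi := integrable_mul_bounded integrable_weight_kt mphi phi1.
pose ms : {sigma_finite_measure set (measurableTypeR R) -> \bar R} := mu.
transitivity (\int[(count \x ms)%E]_p (weight_kt p * phi p)).
  by apply: eq_Rintegral => p _; rewrite wphi.
rewrite -(Rintegral_prod21 (m1 := count) (m2 := ms) wi).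
apply: (@Rintegral_eq_except _ _ _ [:: gamma; gamma - 1]).
- have h := integrable_Rintegral1 (m1 := count) (m2 := ms) wi.
  apply/measurable_EFinP.
  exact: (measurable_int _ h).
- by apply: measurable_funM; [exact: measurable_tau_pow|exact: measurable_remainder_integrand].
- move=> t tE; rewrite -Rintegral_count_weight_kt //.
  by apply: eq_Rintegral => k _; rewrite -(wphi (k, t)).
Qed.

(** tau^(beta-1) is locally integrable; this is deduced from the convergence of
    the integral of tau^(beta-1) exp (- tau). *)
Lemma integrable_tau_pow_bounded (b : R -> R) (M : R) : measurable_fun [set: R] b ->
  (forall t, 0 < t -> t <= 2 -> `|b t| <= M) -> (forall t, 2 < t -> b t = 0) ->
  mu.-integrable [set: R] (fun t => (tau_pow t * b t)%:E).
Proof.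
move=> mb bM b0.
have -> : (fun t => (tau_pow t * b t)%:E) = (fun t =>
    (tau_pow t * expR (- t * 1) * (ind_pos t * expR t * b t))%:E).
  apply/funext => t; rewrite /tau_pow ind_posE; case: ltP => _; rewrite !(mul0r, mul1r) //.
  congr EFin; rewrite mulr1 expRN -mulrA; congr (_ * _).
  by rewrite mulKf // gt_eqF ?expR_gt0.
apply: (integrable_mul_bounded (M := expR 2 * `|M|) (integrable_tau_pow_expR ltr01)).
  apply: measurable_funM => //; apply: measurable_funM; first exact: measurable_ind_pos.
  exact: measurable_expR.
move=> t; rewrite ind_posE; case: ltP => [t0|_]; last first.
  by rewrite !mul0r normr0 mulr_ge0 ?expR_ge0.
have [t2|t2] := leP t 2; last by rewrite b0 // mulr0 normr0 mulr_ge0 ?expR_ge0.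
rewrite mul1r normrM ger0_norm ?expR_ge0 // ler_pM ?expR_ge0 ?ler_expR //.
by rewrite (le_trans (bM t t0 t2)) // ler_norm.
Qed.

Let powR_bound (s : R) : 0 <= s -> s <= 2 -> r `^ s <= expR (2 * ln (1 + r)).
Proof.
move=> s0 s2; have r1 : 0 < 1 + r by have := r0; lra.
have e1 : 1 <= expR (2 * ln (1 + r)).
  by rewrite -[leLHS]expR0 ler_expR mulr_ge0 // ln_ge0 // lerDl.
rewrite /powR; case: eqVneq => [_|rn0].
  by apply: le_trans e1; case: (_ == _).
rewrite ler_expR (@le_trans _ _ (s * ln (1 + r))) //.
  rewrite ler_wpM2l // ler_ln ?posrE ?lt0r ?rn0 //; lra.
by rewrite ler_wpM2r // ln_ge0 // lerDl.
Qed.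

Definition main_term : R := \int[mu]_t (tau_pow t * ((t < gamma)%R%:R * r `^ (gamma - t))).

Definition correction_term : R :=
  \int[mu]_t (tau_pow t * ((t < gamma - 1)%R%:R * (lambda * t * r `^ (gamma - t - 1)))).

Let integrable_main_term (c : R) : c <= gamma ->
  mu.-integrable [set: R] (fun t => (tau_pow t * ((t < c)%R%:R * r `^ (gamma - t)))%:E).
Proof.
have [g1 g2] := (gamma_gt1, gamma_le2).
move=> cg; apply: (integrable_tau_pow_bounded (M := expR (2 * ln (1 + r)))).
- by apply: measurable_funM; [exact: measurable_ind_lt|exact: measurable_powR_r].
- move=> t t0 t2; case: ltP => tc; last by rewrite mul0r normr0 expR_ge0.
  by rewrite mul1r ger0_norm ?powR_ge0 // powR_bound; lra.
- by move=> t t2; case: ltP => tc; [lra|rewrite mul0r].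
Qed.

Let integrable_correction_term : mu.-integrable [set: R]
  (fun t => (tau_pow t * ((t < gamma - 1)%R%:R * (lambda * t * r `^ (gamma - t - 1))))%:E).
Proof.
have [g1 g2] := (gamma_gt1, gamma_le2).
apply: (integrable_tau_pow_bounded (M := lambda * expR (2 * ln (1 + r)))).
- apply: measurable_funM; first exact: measurable_ind_lt.
  apply: measurable_funM; first by apply: measurable_funM.
  rewrite (_ : (fun t => _) = (fun t => r `^ (gamma - 1 - t))); first exact: measurable_powR_r.
  by apply/funext => t; congr (_ `^ _); ring.
- move=> t t0 t2; case: ltP => tc; last by rewrite mul0r normr0 mulr_ge0 ?expR_ge0 ?ltW.
  rewrite mul1r -mulrA normrM (gtr0_norm l0) ler_wpM2l ?(ltW l0) //.
  rewrite normrM (gtr0_norm t0) ger0_norm ?powR_ge0 // -[leRHS]mul1r.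
  rewrite ler_pM ?powR_ge0 ?(ltW t0) //; first lra.
  by rewrite powR_bound; lra.
- by move=> t t2; case: ltP => tc; [lra|rewrite mul0r].
Qed.

Lemma ln_lr_gt0 : 0 < ln (lambda + r).
Proof. by rewrite ln_gt0 // (lt_le_trans lambda_gt1) // lerDl. Qed.

Lemma Rintegral_tau_pow_integrand : \int[mu]_t (tau_pow t * remainder_integrand t) =
  Gamma_fun beta * (r `^ gamma / ln (lambda + r) `^ beta) - main_term + correction_term.
Proof.
have L0 := ln_lr_gt0.
have i1 := integrableZl measurableT (r `^ gamma) (integrable_tau_pow_expR L0).
have i2 := integrable_main_term (lexx gamma).
have i12 : mu.-integrable [set: R] (fun t =>
    (r `^ gamma * (tau_pow t * expR (- t * ln (lambda + r))) -
      tau_pow t * ((t < gamma)%R%:R * r `^ (gamma - t)))%:E).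
  exact: (integrableB measurableT i1 i2).
transitivity (\int[mu]_t (r `^ gamma * (tau_pow t * expR (- t * ln (lambda + r))) -
      tau_pow t * ((t < gamma)%R%:R * r `^ (gamma - t)) +
      tau_pow t * ((t < gamma - 1)%R%:R * (lambda * t * r `^ (gamma - t - 1))))).
  by apply: eq_Rintegral => t _; rewrite /remainder_integrand !mulrDr mulrCA mulrN.
rewrite (RintegralD measurableT i12 integrable_correction_term); congr (_ + _).
rewrite (RintegralB measurableT i1 i2); congr (_ - _).
rewrite (RintegralZl _ measurableT (integrable_tau_pow_expR L0)).
rewrite [X in _ * X]/Rintegral integral_tau_pow_expR //= /powR [in RHS](gt_eqF L0) expRN.
by rewrite mulrCA.
Qed.

(** On [0, gamma - 1] both terms are present, on [gamma - 1, gamma] only the first;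
    the two sides are compared away from the endpoints. *)
Lemma main_sub_correction :
  \int[mu]_(t in `[gamma - 1, gamma]) (t `^ (beta - 1) * r `^ (gamma - t)) +
  \int[mu]_(t in `[0, gamma - 1]) (t `^ (beta - 1) *
    (r `^ (gamma - t) - lambda * t * r `^ (gamma - t - 1))) = main_term - correction_term.
Proof.
have [g1 g2] := (gamma_gt1, gamma_le2).
have mp : measurable_fun [set: R] (fun t : R => t `^ (beta - 1)) by exact: measurable_powR.
have mr := measurable_powR_r gamma.
have mr1 : measurable_fun [set: R] (fun t => r `^ (gamma - t - 1)).
  rewrite (_ : (fun t => _) = (fun t => r `^ (gamma - 1 - t))); first exact: measurable_powR_r.
  by apply/funext => t; congr (_ `^ _); ring.
have ia := integrable_main_term (lexx gamma).
have ib : mu.-integrable [set: R] (fun t => (tau_pow t * ((t < gamma - 1)%R%:R * r `^ (gamma - t)))%:E).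
  by apply: integrable_main_term; lra.
have iab := integrableB measurableT ia ib.
have ibc := integrableB measurableT ib integrable_correction_term.
have -> : \int[mu]_(t in `[gamma - 1, gamma]) (t `^ (beta - 1) * r `^ (gamma - t)) =
    \int[mu]_t (tau_pow t * ((t < gamma)%R%:R * r `^ (gamma - t)) -
                tau_pow t * ((t < gamma - 1)%R%:R * r `^ (gamma - t))).
  rewrite Rintegral_mkcond; apply: (@Rintegral_eq_except _ _ _ [:: gamma; gamma - 1]).
  - apply/(measurable_restrictT _ _).1 => //.
    by apply: measurable_funTS; exact: measurable_funM.
  - by apply/measurable_EFinP; exact: (measurable_int _ iab).
  move=> t; rewrite !inE negb_or => /andP[tg tg1]; rewrite patchE mem_setE in_itv /=.
  have [h|h] := ltP t (gamma - 1).
    have -> : t < gamma by lra.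
    by rewrite /= subrr.
  have t0 : 0 < t by lra.
  have [h'|h'] := ltP t gamma; first by rewrite (ltW h') /= tau_pow_powR // !mul0r mulr0 subr0 mul1r.
  have -> : (t <= gamma) = false by apply/negbTE; rewrite -ltNge lt_neqAle eq_sym tg.
  by rewrite andbF !mul0r mulr0 subrr.
have -> : \int[mu]_(t in `[0, gamma - 1]) (t `^ (beta - 1) *
    (r `^ (gamma - t) - lambda * t * r `^ (gamma - t - 1))) =
    \int[mu]_t (tau_pow t * ((t < gamma - 1)%R%:R * r `^ (gamma - t)) -
      tau_pow t * ((t < gamma - 1)%R%:R * (lambda * t * r `^ (gamma - t - 1)))).
  rewrite Rintegral_mkcond; apply: (@Rintegral_eq_except _ _ _ [:: 0; gamma - 1]).
  - apply/(measurable_restrictT _ _).1 => //; apply: measurable_funTS.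
    apply: measurable_funM => //; apply: measurable_funB => //.
    by apply: measurable_funM => //; apply: measurable_funM.
  - by apply/measurable_EFinP; exact: (measurable_int _ ibc).
  move=> t; rewrite !inE negb_or => /andP[t0 tg1]; rewrite patchE mem_setE in_itv /=.
  have [tn|tp] := leP t 0.
    have -> : (0 <= t) = false by apply/negbTE; rewrite -ltNge lt_neqAle t0.
    by rewrite tau_pow_le0 // !mul0r subrr.
  have [h|h] := ltP t (gamma - 1).
    by rewrite (ltW tp) (ltW h) /= !mul1r tau_pow_powR // mulrBr.
  have -> : (t <= gamma - 1) = false.
    by apply/negbTE; rewrite -ltNge lt_neqAle eq_sym tg1.
  by rewrite andbF !mul0r mulr0 subrr.
rewrite (RintegralB measurableT ia ib) (RintegralB measurableT ib integrable_correction_term).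
by rewrite addrA subrK.
Qed.

End fixed_r.
End symbol.

(** * The symbol as a mixture of Gaussians *)

Section prod_measure.
Context d1 d2 (T1 : measurableType d1) (T2 : measurableType d2) (R : realType).
Variables (m1 : {sigma_finite_measure set T1 -> \bar R})
  (m2 : {sigma_finite_measure set T2 -> \bar R}).
Let T : measurableType _ := (T1 * T2)%type.
Let m12 : {measure set T -> \bar R} := (m1 \x m2)%E.

Lemma sigma_finite_prod : sigma_finite [set: T] m12.
Proof.
have /sigma_finiteP[F [TF ndF Foo]] := sigma_finiteT m1.
have /sigma_finiteP[G [TG ndG Goo]] := sigma_finiteT m2.
exists (fun n => F n `*` G n).
  apply/esym/seteqP; split => // -[x y] _.
  have : [set: T1] x by []. rewrite TF => -[n _ Fnx].
  have : [set: T2] y by []. rewrite TG => -[k _ Gky].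
  exists (maxn n k) => //; split.
  - by move: x Fnx; exact/subsetPset/ndF/leq_maxl.
  - by move: y Gky; exact/subsetPset/ndG/leq_maxr.
move=> k; have [mF Fk] := Foo k; have [mG Gk] := Goo k.
split; first exact: measurableX.
by rewrite /m12 /= product_measure1E // lte_mul_pinfty // ge0_fin_numE.
Qed.

(** The product of more than two factors is iterated, so that each product has to
    be sigma-finite again. *)
Definition prod_measure : {sigma_finite_measure set T -> \bar R} :=
  sigma_finite_measure_of sigma_finite_prod.

End prod_measure.

Section kernel.
Context {R : realType}.
Notation mu := (@lebesgue_measure R).
Notation count := (@count R).
Let ms : {sigma_finite_measure set (measurableTypeR R) -> \bar R} := mu.
Variables beta gamma lambda : R.
Hypotheses (beta_gt0 : 0 < beta) (gamma_gt1 : 1 < gamma) (gamma_le2 : gamma <= 2)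
  (lambda_gt1 : 1 < lambda).

Local Notation weight_kt := (weight_kt beta gamma lambda).
Local Notation gamma_shape := (gamma_shape gamma).
Local Notation X1 := (nat * measurableTypeR R)%type.
Local Notation X2 := (X1 * measurableTypeR R)%type.
Local Notation X3 := (X2 * measurableTypeR R)%type.

(** The parameters of a Gaussian are added one at a time: first (k, tau), then the
    variable s of the Gamma integral, then the variable z of the subordination
    formula.  Both s and z have a probability density, which for s depends on
    (k, tau). *)
Definition kt_measure := prod_measure count ms.
Definition kts_measure := prod_measure kt_measure ms.
Definition ktsz_measure := prod_measure kts_measure ms.

Definition gamma_factor (p : X2) : R :=
  gamma_density (gamma_shape p.1.1 p.1.2) p.2 / Gamma_fun (gamma_shape p.1.1 p.1.2).

Definition weight_kts (p : X2) : R := weight_kt p.1 * gamma_factor p.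

Definition gauss_factor (p : X3) : R := 2 / Num.sqrt pi * (ind_pos p.2 * gauss_fun p.2).

Definition weight_ktsz (p : X3) : R := weight_kts p.1 * gauss_factor p.

Definition width (p : X3) : R := p.1.2 / (lambda * p.2).

Lemma weight_kt_shape_gt0 p : weight_kt p != 0 -> 0 < gamma_shape p.1 p.2.
Proof.
rewrite /weight_kt ind_posE; case: ltP => // _.
by rewrite !mulr0 eqxx.
Qed.

Lemma measurable_gamma_factor : measurable_fun [set: X2] gamma_factor.
Proof.
have me : measurable_fun [set: X2] (fun p : X2 => gamma_shape p.1.1 p.1.2).
  exact: (measurableT_comp (measurable_gamma_shape gamma) measurable_fst).
have mp : measurable_fun [set: X2] (fun p : X2 => (gamma_shape p.1.1 p.1.2, p.2)).
  exact: measurable_fun_pair.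
apply: measurable_funM; first exact: (measurableT_comp measurable_gamma_density2 mp).
apply: (measurableT_comp (@measurable_invr R)).
exact: (measurableT_comp measurable_Gamma_fun me).
Qed.

Lemma gamma_factor_ge0 p s : weight_kt p != 0 -> 0 <= gamma_factor (p, s).
Proof.
move=> /weight_kt_shape_gt0 a0; rewrite /gamma_factor divr_ge0 ?gamma_density_ge0 //.
exact/ltW/Gamma_fun_gt0.
Qed.

Lemma integral_gamma_factor p : weight_kt p != 0 -> (\int[ms]_s (gamma_factor (p, s))%:E = 1)%E.
Proof.
move=> /weight_kt_shape_gt0 a0; rewrite /gamma_factor /=; under eq_integral do rewrite mulrC EFinM.
rewrite ge0_integralZl_EFin //.
- by rewrite -EFin_Gamma_fun // -EFinM mulVf // gt_eqF ?Gamma_fun_gt0.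
- by move=> s _; rewrite lee_fin gamma_density_ge0.
- by apply/measurable_EFinP; exact: measurable_gamma_density.
- by rewrite invr_ge0; exact/ltW/Gamma_fun_gt0.
Qed.

Let weight_i := integrable_weight_kt beta_gt0 gamma_gt1 gamma_le2 lambda_gt1.

Lemma integrable_weight_kts : kts_measure.-integrable [set: X2] (EFin \o weight_kts).
Proof.
exact: (integrable_mixture (m1 := kt_measure) (m2 := ms) weight_i
  measurable_gamma_factor gamma_factor_ge0 integral_gamma_factor).
Qed.

Lemma weight_kts_gt0 p : weight_kts p != 0 -> 0 < p.2.
Proof.
rewrite /weight_kts /gamma_factor /gamma_density ind_posE; case: ltP => // _.
by rewrite !mul0r mulr0 eqxx.
Qed.

Lemma measurable_gauss_factor : measurable_fun [set: X3] gauss_factor.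
Proof.
apply: measurable_funM; first exact: measurable_cst.
apply: measurable_funM; first exact: (measurableT_comp measurable_ind_pos measurable_snd).
exact: (measurableT_comp measurable_gauss_fun measurable_snd).
Qed.

Lemma gauss_factor_ge0 p z : weight_kts p != 0 -> 0 <= gauss_factor (p, z).
Proof.
by rewrite /gauss_factor mulr_ge0 ?divr_ge0 ?sqrtr_ge0 // mulr_ge0 ?ind_pos_ge0 ?gauss_fun_ge0.
Qed.

Lemma integral_gauss_factor_gauss (c : R) : 0 <= c ->
  (\int[ms]_z (2 / Num.sqrt pi * (ind_pos z * gauss_fun z) * expR (- (c / z) ^+ 2))%:E =
  (expR (- (2 * c)))%:E)%E.
Proof.
move=> c0.
have e z : 2 / Num.sqrt pi * (ind_pos z * gauss_fun z) * expR (- (c / z) ^+ 2) =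
   2 / Num.sqrt pi * (ind_pos z * expR (- z ^+ 2 - (c / z) ^+ 2)).
  by rewrite expRD -!mulrA.
under eq_integral do rewrite e EFinM.
rewrite ge0_integralZl_EFin //.
- rewrite integral_ind_pos integral_gauss_inv // -EFinM; congr EFin.
  by field; rewrite gt_eqF ?sqrt_pi_gt0.
- by move=> z _; rewrite lee_fin mulr_ge0 ?ind_pos_ge0 ?expR_ge0.
- apply/measurable_EFinP; apply: measurable_funM; first exact: measurable_ind_pos.
  apply: (measurableT_comp (@measurable_expR R)).
  apply: measurable_funB.
    exact: (measurableT_comp (@oppr_measurable R setT) (exprn_measurable 2)).
  apply: measurable_funX; apply: measurable_funM; first exact: measurable_cst.
  exact: measurable_invr.
Qed.

Lemma integral_gauss_factor p : weight_kts p != 0 -> (\int[ms]_z (gauss_factor (p, z))%:E = 1)%E.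
Proof.
move=> _; have := integral_gauss_factor_gauss (lexx 0); rewrite mulr0 oppr0 expR0 => <-.
by apply: eq_integral => z _; rewrite mul0r expr0n /= oppr0 expR0 mulr1.
Qed.

Lemma integrable_weight_ktsz : ktsz_measure.-integrable [set: X3] (EFin \o weight_ktsz).
Proof.
exact: (integrable_mixture (m1 := kts_measure) (m2 := ms) integrable_weight_kts
  measurable_gauss_factor gauss_factor_ge0 integral_gauss_factor).
Qed.

Lemma measurable_width : measurable_fun [set: X3] width.
Proof.
apply: measurable_funM; first exact: (measurableT_comp measurable_snd measurable_fst).
apply: (measurableT_comp (@measurable_invr R)).
by apply: measurable_funM; [exact: measurable_cst|exact: measurable_snd].
Qed.

Lemma width_gt0 p : weight_ktsz p != 0 -> 0 < width p.
Proof.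
rewrite /weight_ktsz mulf_eq0 negb_or => /andP[/weight_kts_gt0 s0].
rewrite /gauss_factor ind_posE; case: ltP => z0; last by rewrite mul0r mulr0 eqxx.
by move=> _; rewrite /width divr_gt0 // mulr_gt0 // (lt_trans ltr01).
Qed.

(** The parameters are integrated out in the reverse order: z turns the Gaussian
    exp (- (s r / (2 lambda z))^2) into exp (- s r / lambda), s turns this exponential
    into (1 + r/lambda)^(-a) with a = k - gamma + tau, and the sum over k and the
    integral over tau yield the symbol. *)
Lemma symbol_gauss_mixture (r : R) : 0 <= r ->
  \int[ktsz_measure]_p (weight_ktsz p * expR (- (width p ^+ 2 * r ^+ 2 / 4))) =
  Gamma_fun beta * (r `^ gamma / ln (lambda + r) `^ beta) - main_term beta gamma r +
  correction_term beta gamma lambda r.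
Proof.
move=> r0; have l0 : 0 < lambda by rewrite (lt_trans ltr01).
rewrite -Rintegral_tau_pow_integrand // -Rintegral_weight_kt //.
pose phi3 p := expR (- (width p ^+ 2 * r ^+ 2 / 4)).
have mphi3 : measurable_fun [set: X3] phi3.
  apply: (measurableT_comp (@measurable_expR R)).
  apply: (measurableT_comp (@oppr_measurable R setT)).
  apply: measurable_funM; last exact: measurable_cst.
  apply: measurable_funM; last exact: measurable_cst.
  by apply: measurable_funX; exact: measurable_width.
have phi31 p : `|phi3 p| <= 1.
  rewrite ger0_norm ?expR_ge0 // -[leRHS]expR0 ler_expR oppr_le0.
  by rewrite divr_ge0 // mulr_ge0 // sqr_ge0.
rewrite (Rintegral_mixture (m1 := kts_measure) (m2 := ms) integrable_weight_kts
  measurable_gauss_factor gauss_factor_ge0 integral_gauss_factor mphi3 phi31).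
pose phi2 (p : X2) : R := ind_pos p.2 * expR (- (p.2 * (r / lambda))).
have rl0 : 0 <= r / lambda by rewrite divr_ge0 // ltW.
have mphi2 : measurable_fun [set: X2] phi2.
  apply: measurable_funM; first exact: (measurableT_comp measurable_ind_pos measurable_snd).
  apply: (measurableT_comp (@measurable_expR R)).
  apply: (measurableT_comp (@oppr_measurable R setT)).
  by apply: measurable_funM; [exact: measurable_snd|exact: measurable_cst].
have phi21 p : `|phi2 p| <= 1.
  rewrite /phi2 ind_posE; case: ltP => [s0|_]; last by rewrite mul0r normr0.
  rewrite mul1r ger0_norm ?expR_ge0 // -[leRHS]expR0 ler_expR oppr_le0.
  by rewrite mulr_ge0 // ltW.
transitivity (\int[kts_measure]_p (weight_kts p * phi2 p)).
  apply: eq_Rintegral => p _; have [->|wp] := eqVneq (weight_kts p) 0.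
    by rewrite !mul0r.
  have s0 := weight_kts_gt0 wp; congr (_ * _).
  rewrite /phi2 ind_posE s0 mul1r.
  have c0 : 0 <= p.2 * r / (2 * lambda) by rewrite divr_ge0 ?mulr_ge0 // ltW.
  transitivity (fine (expR (- (2 * (p.2 * r / (2 * lambda)))))%:E).
    rewrite -(integral_gauss_factor_gauss c0) /Rintegral; congr fine; apply: eq_integral => z _.
    rewrite /gauss_factor /phi3 /width /=; congr (_ * expR _)%:E.
    by rewrite (invfM lambda z); move: (z^-1) => zi; field; rewrite gt_eqF.
  by rewrite /=; congr expR; field; rewrite gt_eqF.
rewrite (Rintegral_mixture (m1 := kt_measure) (m2 := ms) weight_i
  measurable_gamma_factor gamma_factor_ge0
  integral_gamma_factor mphi2 phi21).
apply: eq_Rintegral => p _; have [->|wp] := eqVneq (weight_kt p) 0.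
  by rewrite !mul0r.
congr (_ * _); have a0 := weight_kt_shape_gt0 wp.
have L0 : 0 < 1 + r / lambda by rewrite ltr_wpDr.
have G0 := Gamma_fun_gt0 a0.
transitivity (fine ((Gamma_fun (gamma_shape p.1 p.2))^-1%:E * (Gamma_fun (gamma_shape p.1 p.2) *
   expR (- (gamma_shape p.1 p.2 * ln (1 + r / lambda))))%:E)%E).
  rewrite -(integral_gamma_density_scale a0 L0) /Rintegral; congr fine.
  rewrite -ge0_integralZl_EFin //; last 3 first.
  - by move=> s _; rewrite lee_fin mulr_ge0 ?ind_pos_ge0 ?expR_ge0.
  - apply/measurable_EFinP; apply: measurable_funM; first exact: measurable_ind_pos.
    apply: (measurableT_comp (@measurable_expR R)); apply: measurable_funB.
      by apply: measurable_funM; [exact: measurable_cst|exact: measurable_ln].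
    exact: mulrl_measurable.
  - by rewrite invr_ge0 ltW.
  apply: eq_integral => s _; rewrite -EFinM; congr EFin.
  rewrite /gamma_factor /phi2 /gamma_density /= ind_posE.
  case: ltP => _; last by rewrite !(mul0r, mulr0).
  rewrite !mul1r mulrAC mulrC -expRD; congr (_ * expR _).
  by field; rewrite gt_eqF.
by rewrite -EFinM /= mulrA mulVf ?gt_eqF // mul1r mulNr.
Qed.

End kernel.

(** * Smooth radial functions *)

Section directional.
Context {R : realType} {V : normedModType R}.

Lemma is_derive_line (f : V -> R) (x v : V) (df : R) :
  is_derive x v f df <-> is_derive (0 : R) 1 (fun t : R => f (t *: v + x)) df.
Proof.
have e : (fun h : R => h^-1 *: ((f \o shift x) (h *: v) - f x)) =
    (fun h : R => h^-1 *: (((fun t : R => f (t *: v + x)) \o shift 0) (h *: 1) -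
      (fun t : R => f (t *: v + x)) 0)).
  apply/funext => h; rewrite /= addr0 scale0r add0r.
  by rewrite /GRing.scale /= mulr1.
split=> -[dr dv]; split.
- by rewrite /derivable -e.
- by rewrite -dv /derive -e.
- by rewrite /derivable e.
- by rewrite -dv /derive e.
Qed.

Lemma is_derive_chain (f : V -> R) (h : R -> R) (x v : V) (df dh : R) :
  is_derive x v f df -> is_derive (f x) 1 h dh ->
  is_derive x v (h \o f) (dh * df).
Proof.
move=> /is_derive_line dL dH; apply/is_derive_line.
apply: (@is_derive1_comp R h (fun t : R => f (t *: v + x))) => //.
by rewrite scale0r add0r.
Qed.

End directional.

Section smooth_closed.
Context {R : realType} (d : nat).
Local Notation V := 'rV[R]_d.

(** If every member of S is continuous on U and has directional derivatives in S
    there, then all iterated derivatives agree on U with members of S.  It suffices that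
    f agrees on U with a member of S, because U is open. *)
Lemma smooth_on_closed (U : set V) (S : set (V -> R)) :
  open U ->
  (forall f, S f -> forall x, U x -> {for x, continuous f}) ->
  (forall f v, S f -> exists2 g, S g & forall x, U x -> is_derive x v f (g x)) ->
  forall f f0, S f0 -> (forall x, U x -> f x = f0 x) -> smooth_on U f.
Proof.
move=> oU cS dS f f0 Sf0 ff0 vs /=.
have [h Sh hE] : exists2 h, S h & forall x, U x ->
    foldr (fun v h => 'D_v h) f vs x = h x.
  elim: vs => [|v vs [h Sh hE]]; first by exists f0.
  have [g Sg gE] := dS h v Sh; exists g => // x Ux /=.
  rewrite (near_eq_derive (g := h)); first by have [] := gE x Ux.
  near=> y; apply: hE; near: y; by apply: open_nbhs_nbhs; split.
move=> x Ux.
have nE : \forall y \near x, h y = foldr (fun v h => 'D_v h) f vs y.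
  near=> y; apply/esym; apply: hE; near: y; by apply: open_nbhs_nbhs; split.
split.
  rewrite /prop_for /continuous_at hE //.
  apply: cvg_trans (cS _ Sh _ Ux).
  exact: near_eq_cvg nE.
move=> v; have [g Sg gE] := dS h v Sh.
by apply: near_eq_derivable nE _; have [] := gE x Ux.
Unshelve. all: by end_near. Qed.

End smooth_closed.

Section smooth_radial.
Context {R : realType} (d : nat).
Local Notation V := 'rV[R]_d.

Definition sqnorm (x : V) : R := \sum_(i < d) x ord0 i ^+ 2.

Lemma sqnorm_ge0 x : 0 <= sqnorm x.
Proof. by apply: sumr_ge0 => i _; rewrite sqr_ge0. Qed.

Lemma sqnorm_gt0 x : x != 0 -> 0 < sqnorm x.
Proof.
move=> x0; rewrite lt_neqAle sqnorm_ge0 andbT eq_sym.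
apply: contraNneq x0 => s0; apply/eqP/rowP => i; rewrite mxE.
have := psumr_eq0P (fun i _ => sqr_ge0 (x ord0 i)) s0 => /(_ i isT).
by move/eqP; rewrite sqrf_eq0 => /eqP.
Qed.

Lemma enorm_gt0 (x : V) : x != 0 -> 0 < enorm x.
Proof. by move=> x0; rewrite sqrtr_gt0 sqnorm_gt0. Qed.

Lemma is_derive_coord (i : 'I_d) (x v : V) :
  is_derive x v (fun x : V => x ord0 i) (v ord0 i).
Proof.
apply/is_derive_line.
rewrite (_ : (fun t : R => (t *: v + x) ord0 i) = (fun t => t * v ord0 i + x ord0 i)).
  by apply: is_derive_eq; rewrite /GRing.scale /=; ring.
by apply/funext => t; rewrite !mxE.
Qed.

Lemma is_derive_dotp (w x v : V) : is_derive x v (dotp w) (dotp w v).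
Proof.
have h (i : 'I_d) : is_derive x v (fun x : V => w ord0 i * x ord0 i) (w ord0 i * v ord0 i).
  exact: (is_deriveZ (w ord0 i) (is_derive_coord i x v)).
have := is_derive_sum h.
rewrite (_ : \sum_(i < d) (fun x : V => w ord0 i * x ord0 i) = dotp w) //.
by apply/funext => y; rewrite /dotp fct_sumE.
Qed.

Lemma is_derive_sqnorm (x v : V) : is_derive x v sqnorm (2 * dotp v x).
Proof.
have h (i : 'I_d) : is_derive x v (fun x : V => x ord0 i * x ord0 i)
    (2 * (v ord0 i * x ord0 i)).
  have dc := is_derive_coord i x v.
  apply: is_derive_eq (is_deriveM dc dc) _.
  by rewrite /GRing.scale /=; ring.
have := is_derive_sum h.
rewrite (_ : \sum_(i < d) (fun x : V => x ord0 i * x ord0 i) = sqnorm).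
  by rewrite /dotp big_distrr.
by apply/funext => y; rewrite /sqnorm fct_sumE.
Qed.

Lemma is_derive_enorm (x v : V) : x != 0 ->
  is_derive x v (@enorm R d) (dotp v x / enorm x).
Proof.
move=> x0; have s0 := sqnorm_gt0 x0.
have := is_derive_chain (is_derive_sqnorm x v) (is_derive1_sqrt s0).
congr (is_derive _ _ _ _); rewrite -/(enorm x).
by field; rewrite gt_eqF ?enorm_gt0.
Qed.

Lemma continuous_coordsum (F : 'I_d -> V -> R) :
  (forall i, continuous (F i)) -> continuous (fun x => \sum_(i < d) F i x).
Proof.
move=> cF; rewrite (_ : (fun x => _) = \sum_(i < d) F i); last first.
  by apply/funext => x; rewrite fct_sumE.
elim/big_ind: _ => [|f g cf cg|i _]; [exact: cst_continuous| |exact: cF].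
by move=> x; apply: continuousD; [exact: cf|exact: cg].
Qed.

Lemma continuous_dotp (w : V) : continuous (dotp w).
Proof.
apply: (@continuous_coordsum (fun i x => w ord0 i * x ord0 i)) => i x.
have c : {for x, continuous (fun x : V => x ord0 i)} by exact: coord_continuous.
exact: (continuousM (@cst_continuous V R (w ord0 i) x) c).
Qed.

Lemma continuous_enorm : continuous (@enorm R d).
Proof.
move=> x; apply: (@continuous_comp _ _ _ sqnorm Num.sqrt); last exact: sqrt_continuous.
apply: (@continuous_coordsum (fun i x => x ord0 i ^+ 2)) => i {}x.
have c : {for x, continuous (fun x : V => x ord0 i)} by exact: coord_continuous.
exact: (continuousM c c).
Qed.

Lemma open_neq0_rV : open [set x : V | x != 0].
Proof.
rewrite (_ : [set x | _] = @enorm R d @^-1` [set r | 0 < r]).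
  by apply: open_comp; [move=> x _; exact: continuous_enorm|exact: open_gt].
apply/seteqP; split => x /=; first exact: enorm_gt0.
apply: contraTneq => ->; rewrite -leNgt /enorm big1 ?sqrtr0 // => i _.
by rewrite mxE expr0n.
Qed.

End smooth_radial.

Section laplace_transform.
Context {R : realType}.
Notation mu := (@lebesgue_measure R).

(** The bound on the support makes t |-> g (t) t integrable again, and the Laplace
    transform defined on the whole line. *)
Definition supported02 (g : R -> R) :=
  mu.-integrable [set: R] (EFin \o g) /\
  forall t, g t != 0 -> 0 < t /\ t < 2.

Definition laplace (g : R -> R) (y : R) : R := \int[mu]_t (g t * expR (- (t * y))).

Lemma supported02_mul (g : R -> R) : supported02 g ->
  supported02 (fun t => g t * - t).
Proof.
move=> [gi gs]; split; last first.
  by move=> t gt; apply: gs; apply: contra_neq gt => ->; rewrite mul0r.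
(* t clipped to [0, 2]: a bounded function that agrees with t where g is not 0 *)
pose phi t : R := Num.min 2 (Num.max 0 t).
have -> : EFin \o (fun t => g t * - t) = (fun t => (g t * - phi t)%:E).
  apply/funext => t /=; have [->|gt] := eqVneq (g t) 0; first by rewrite !mul0r.
  have [t0 t2] := gs t gt; congr (_ * - _)%:E.
  by rewrite /phi max_r ?min_r // ltW.
apply: (integrable_mul_bounded (M := 2) gi).
  apply: (measurableT_comp (@oppr_measurable R setT)).
  apply: measurable_minr; first exact: measurable_cst.
  by apply: measurable_maxr => //; exact: measurable_cst.
move=> t; rewrite normrN ger0_norm; first by rewrite ge_min lexx.
by rewrite le_min ler0n le_max lexx.
Qed.

Lemma integrable_laplace (g : R -> R) (y : R) : supported02 g ->
  mu.-integrable [set: R] (fun t => (g t * expR (- (t * y)))%:E).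
Proof.
move=> [gi gs].
pose phi t : R := Num.min (expR (2 * `|y|)) (expR (- (t * y))).
have -> : (fun t => (g t * expR (- (t * y)))%:E) = (fun t => (g t * phi t)%:E).
  apply/funext => t /=; have [->|gt] := eqVneq (g t) 0; first by rewrite !mul0r.
  have [t0 t2] := gs t gt; congr (_ * _)%:E.
  rewrite /phi min_r // ler_expR -mulrN.
  rewrite (@le_trans _ _ (t * `|y|)) //; last by rewrite ler_wpM2r // ltW.
  by rewrite ler_wpM2l ?(ltW t0) // -normrN ler_norm.
apply: (integrable_mul_bounded (M := expR (2 * `|y|)) gi).
  apply: measurable_minr; first exact: measurable_cst.
  apply: (measurableT_comp (@measurable_expR R)).
  by apply: (measurableT_comp (@oppr_measurable R setT)); exact: measurable_funM.
move=> t; rewrite ger0_norm; first by rewrite ge_min lexx.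
by rewrite le_min !expR_ge0.
Qed.

(** Differentiation under the integral sign; for t in [0, 2] the factor
    t exp (- t z) is bounded uniformly for z within 1 of y. *)
Lemma is_derive_laplace (g : R -> R) (y : R) : supported02 g ->
  is_derive y 1 (laplace g) (laplace (fun t => g t * - t) y).
Proof.
move=> gs; have gs' := supported02_mul gs.
pose f (y t : R) : R := g t * expR (- (t * y)).
have pf (z t : R) : partial1of2 f z t = g t * - t * expR (- (t * z)).
  rewrite partial1of2E; apply: derive_val; apply: is_derive_eq.
  by rewrite /GRing.scale /=; ring.
have y_in : `]y - 1, y + 1[%classic y by rewrite /= in_itv /=; apply/andP; split; lra.
have H1 (z : R) : `]y - 1, y + 1[%classic z -> mu.-integrable [set: R] (EFin \o f z).
  by move=> _; exact: integrable_laplace.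
have H2 (z t : R) : `]y - 1, y + 1[%classic z -> [set: R] t -> derivable (f ^~ t) z 1.
  by move=> _ _; apply: ex_derive.
pose G t : R := 2 * expR (2 * (`|y| + 1)) * `|g t|.
have G0 t : 0 <= G t by rewrite !mulr_ge0 ?expR_ge0.
have Gi : mu.-integrable [set: R] (EFin \o G).
  rewrite (_ : EFin \o G = (fun t => (2 * expR (2 * (`|y| + 1)))%:E * `|(g t)%:E|)%E) //.
  by apply: (integrableZl measurableT); exact: (integrable_abse gs.1).
have H3 (z t : R) : `]y - 1, y + 1[%classic z -> [set: R] t ->
    `|partial1of2 f z t| <= G t.
  rewrite /= in_itv /= => /andP[z1 z2] _; rewrite pf.
  have [->|gt] := eqVneq (g t) 0; first by rewrite !mul0r normr0.
  have [t0 t2] := gs.2 t gt.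
  rewrite !normrM normrN (gtr0_norm t0) (ger0_norm (expR_ge0 _)) /G.
  rewrite -mulrA mulrC ler_wpM2r // ler_pM ?expR_ge0 ?(ltW t0) ?(ltW t2) //.
  rewrite ler_expR -mulrN (@le_trans _ _ (t * (`|y| + 1))) //.
    rewrite ler_wpM2l ?(ltW t0) //.
    have := ler_norm (- y); rewrite normrN; lra.
  by rewrite ler_wpM2r ?addr_ge0 // ltW.
apply: DeriveDef; first exact: (derivable_under_integral measurableT y_in H1 H2 G0 Gi H3).
rewrite -derive1E (differentiation_under_integral measurableT y_in H1 H2 G0 Gi H3).
by apply: eq_Rintegral => t _; rewrite -pf.
Qed.

End laplace_transform.

Section smooth_class.
Context {R : realType}.
Variable lambda : R.
Hypothesis lambda_gt1 : 1 < lambda.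

(** Powers of lambda + r are there because they appear in the derivative of
    ln (lambda + r).  The Laplace transforms at ln r account for the integrals of
    r^(gamma - tau) over tau. *)
Inductive radial_class : (R -> R) -> Prop :=
| radial_cst c : radial_class (cst c)
| radial_powR s : radial_class (fun r => r `^ s)
| radial_shift s : radial_class (fun r => (lambda + r) `^ s)
| radial_ln s : radial_class (fun r => ln (lambda + r) `^ s)
| radial_laplace g : supported02 g -> radial_class (fun r => laplace g (ln r))
| radial_add f h : radial_class f -> radial_class h -> radial_class (f \+ h)
| radial_mul f h : radial_class f -> radial_class h -> radial_class (f \* h).

Lemma is_derive_radial_class f : radial_class f ->
  exists2 h, radial_class h & forall r : R, 0 < r -> is_derive r 1 f (h r).
Proof.
have dsh (r : R) : 0 < r -> is_derive r 1 (fun r : R => lambda + r) 1.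
  move=> r0; have := is_deriveD (is_derive_cst lambda r (1 : R)) (is_derive_id r (1 : R)).
  by rewrite add0r.
have lr0 (r : R) : 0 < r -> 0 < lambda + r.
  by move=> r0; rewrite addr_gt0 // (lt_trans ltr01).
elim=> {f} [c|s|s|s|g gs|f h _ [f' Sf' fE] _ [h' Sh' hE]|f h Sf [f' Sf' fE] Sh [h' Sh' hE]].
- by exists (cst 0) => [|r _]; [exact: radial_cst|exact: is_derive_cst].
- exists (cst s \* (fun r => r `^ (s - 1))) => [|r r0 /=].
    by apply: radial_mul; [exact: radial_cst|exact: radial_powR].
  exact: is_derive1_powR.
- exists (cst s \* (fun r => (lambda + r) `^ (s - 1))) => [|r r0 /=].
    by apply: radial_mul; [exact: radial_cst|exact: radial_shift].
  have := @is_derive1_comp R (fun x : R => x `^ s) (fun r => lambda + r) r _ _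
    (is_derive1_powR s (lr0 r r0)) (dsh r r0).
  by rewrite mulr1.
- exists ((cst s \* (fun r => ln (lambda + r) `^ (s - 1))) \*
    (fun r => (lambda + r) `^ (-1))) => [|r r0 /=].
    apply: radial_mul; last exact: radial_shift.
    by apply: radial_mul; [exact: radial_cst|exact: radial_ln].
  have L0 : 0 < ln (lambda + r) by have l1 := lambda_gt1; rewrite ln_gt0 //; lra.
  rewrite powR_inv1 ?(ltW (lr0 r r0)) //.
  have dl := @is_derive1_comp R (@ln R) (fun r => lambda + r) r _ _
    (is_derive1_ln (lr0 r r0)) (dsh r r0).
  rewrite mulr1 in dl.
  exact: (@is_derive1_comp R (fun x : R => x `^ s) (fun r => ln (lambda + r)) r _ _
    (is_derive1_powR s L0) dl).
- exists ((fun r => laplace (fun t => g t * - t) (ln r)) \* (fun r => r `^ (-1))) => [|r r0 /=].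
    apply: radial_mul; last exact: radial_powR.
    exact/radial_laplace/supported02_mul.
  rewrite powR_inv1 ?(ltW r0) //.
  exact: (@is_derive1_comp R (laplace g) (@ln R) r _ _ (is_derive_laplace _ gs)
    (is_derive1_ln r0)).
- exists (f' \+ h') => [|r r0]; first exact: radial_add.
  exact: (is_deriveD (fE r r0) (hE r r0)).
- exists ((f \* h') \+ (h \* f')) => [|r r0]; first by apply: radial_add; exact: radial_mul.
  exact: (is_deriveM (fE r r0) (hE r r0)).
Qed.

Variable d : nat.
Local Notation V := 'rV[R]_d.

(** The gradient of the norm is x / |x|: the linear forms make the class stable
    under directional derivatives. *)
Inductive smooth_class : set (V -> R) :=
| smooth_radial f : radial_class f -> smooth_class (fun x => f (enorm x))
| smooth_dotp w : smooth_class (dotp w)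
| smooth_add f h : smooth_class f -> smooth_class h -> smooth_class (f \+ h)
| smooth_mul f h : smooth_class f -> smooth_class h -> smooth_class (f \* h).

Lemma continuous_smooth_class f : smooth_class f ->
  forall x, x != 0 -> {for x, continuous f}.
Proof.
elim=> {f} [f Sf|w|f h _ cf _ ch|f h _ cf _ ch] x x0.
- have [f' _ fE] := is_derive_radial_class Sf.
  apply: continuous_comp; first exact: continuous_enorm.
  exact: (derive_continuous (fE _ (enorm_gt0 x0))).
- exact: continuous_dotp.
- by apply: continuousD; [exact: cf|exact: ch].
- by apply: continuousM; [exact: cf|exact: ch].
Qed.

Lemma is_derive_smooth_class f v : smooth_class f ->
  exists2 g, smooth_class g & forall x, x != 0 -> is_derive x v f (g x).
Proof.
elim=> {f} [f Sf|w|f h _ [f' Sf' fE] _ [h' Sh' hE]|f h Sf [f' Sf' fE] Sh [h' Sh' hE]].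
- have [f' Sf' fE] := is_derive_radial_class Sf.
  exists ((fun x => f' (enorm x)) \* (dotp v \* (fun x => enorm x `^ (-1)))) => [|x x0 /=].
    apply: smooth_mul; first exact: smooth_radial.
    by apply: smooth_mul; [exact: smooth_dotp|apply: (smooth_radial (radial_powR (-1)))].
  rewrite powR_inv1 ?(ltW (enorm_gt0 x0)) //.
  exact: (is_derive_chain (is_derive_enorm v x0) (fE _ (enorm_gt0 x0))).
- exists (fun=> dotp w v) => [|x _]; last exact: is_derive_dotp.
  exact: (smooth_radial (radial_cst (dotp w v))).
- exists (f' \+ h') => [|x x0]; first exact: smooth_add.
  exact: (is_deriveD (fE x x0) (hE x x0)).
- exists ((f \* h') \+ (h \* f')) => [|x x0]; first by apply: smooth_add; exact: smooth_mul.
  exact: (is_deriveM (fE x x0) (hE x x0)).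
Qed.

Lemma smooth_on_radial f (P : V -> R) : radial_class f ->
  (forall x, x != 0 -> P x = f (enorm x)) -> smooth_on [set x : V | x != 0] P.
Proof.
move=> Sf Pf; apply: (@smooth_on_closed _ _ _ smooth_class _ _ _ _ (fun x => f (enorm x))) => //.
- exact: open_neq0_rV.
- by move=> g Sg x; exact: continuous_smooth_class.
- by move=> g v Sg; exact: is_derive_smooth_class.
- exact: smooth_radial.
Qed.

End smooth_class.

(** * Young's inequality *)

Section tonelli_convolution.
Context {R : realType} (n : nat).
Local Notation V := 'rV[R]_n.
Local Notation mu := (@leb R n).
Implicit Types u v : V -> \bar R.

Lemma measurable_conv_kernel u v :
  measurable_fun [set: V] u -> measurable_fun [set: V] v ->
  measurable_fun [set: V * V] (fun z => u (z.1 - z.2)%R * v z.2)%E.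
Proof.
move=> mu_ mv; apply: emeasurable_funM.
  exact: (measurableT_comp mu_ (@measurable_rV_sub R n)).
exact: (measurableT_comp mv measurable_snd).
Qed.

(** Convolution of nonnegative functions, possibly infinite: measurability and
    Tonelli's theorem hold without integrability. *)
Definition ge0_conv u v (x : V) : \bar R := (\int[mu]_y (u (x - y)%R * v y))%E.

Lemma ge0_conv_ge0 u v x : (forall x, 0 <= u x)%E -> (forall x, 0 <= v x)%E ->
  (0 <= ge0_conv u v x)%E.
Proof. by move=> u0 v0; apply: integral_ge0 => y _; rewrite mule_ge0. Qed.

Lemma measurable_ge0_conv u v :
  measurable_fun [set: V] u -> measurable_fun [set: V] v ->
  (forall x, 0 <= u x)%E -> (forall x, 0 <= v x)%E ->
  measurable_fun [set: V] (ge0_conv u v).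
Proof.
move=> mu_ mv u0 v0.
apply: (measurable_fun_fubini_tonelli_F (fun z : V * V => u (z.1 - z.2)%R * v z.2)%E).
  exact: measurable_conv_kernel.
by move=> z; rewrite mule_ge0.
Qed.

Lemma ge0_integral_conv u v :
  measurable_fun [set: V] u -> measurable_fun [set: V] v ->
  (forall x, 0 <= u x)%E -> (forall x, 0 <= v x)%E ->
  (\int[mu]_x ge0_conv u v x = (\int[mu]_x u x) * \int[mu]_x v x)%E.
Proof.
move=> mu_ mv u0 v0.
rewrite /ge0_conv (fubini_tonelli (fun z : V * V => u (z.1 - z.2)%R * v z.2)%E) /=; last 2 first.
- exact: measurable_conv_kernel.
- by move=> z; rewrite mule_ge0.
rewrite -ge0_integralZl //; last exact: integral_ge0.
apply: eq_integral => y _.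
rewrite ge0_integralZr //; last exact: (measurableT_comp mu_ (@measurable_rV_subr R n y)).
by rewrite ge0_integral_rV_shift.
Qed.

Lemma ge0_conv_cst u (c : R) x :
  measurable_fun [set: V] u -> (forall x, 0 <= u x)%E -> 0 <= c ->
  ge0_conv u (cst c%:E) x = ((\int[mu]_x u x) * c%:E)%E.
Proof.
move=> mu_ u0 c0; rewrite /ge0_conv ge0_integralZr //; last first.
  exact: (measurableT_comp mu_ (@measurable_rV_subl R n x)).
by rewrite (ge0_integral_rV_reflect x).
Qed.

End tonelli_convolution.

Section young.
Context {R : realType} (n : nat).
Local Notation V := 'rV[R]_n.
Local Notation mu := (@leb R n).
Variables (k : V -> R).
Hypothesis k_ge0 : forall x, 0 <= k x.
Hypothesis ki : mu.-integrable [set: V] (EFin \o k).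

Let mass : R := \int[mu]_x k x.

Let mk : measurable_fun [set: V] k.
Proof. by apply/measurable_EFinP; exact: measurable_int ki. Qed.

Let mkE : measurable_fun [set: V] (EFin \o k).
Proof. exact/measurable_EFinP. Qed.

Let kE0 x : (0 <= (EFin \o k) x)%E.
Proof. by rewrite lee_fin. Qed.

Let massE : (\int[mu]_x (k x)%:E = mass%:E)%E.
Proof. by rewrite /mass /Rintegral fineK //; exact: integrable_fin_num ki. Qed.

Let mass_ge0 : 0 <= mass.
Proof. by apply: Rintegral_ge0. Qed.

(** Hoelder's inequality for k g = (k^(1/p) g) * k^(1/q) with 1/p + 1/q = 1. *)
Lemma conv_powR_le (p : R) (g : V -> R) : 1 <= p ->
  measurable_fun [set: V] g -> (forall x, 0 <= g x) -> forall x,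
  (ge0_conv (EFin \o k) (EFin \o g) x `^ p <=
   (mass `^ (p - 1))%:E * ge0_conv (EFin \o k) (fun y => (g y `^ p)%:E) x)%E.
Proof.
move=> p1 mg g0 x.
have p0 : 0 < p by apply: lt_le_trans p1.
have c0 (h : V -> R) : (forall x, 0 <= h x) -> (0 <= ge0_conv (EFin \o k) (EFin \o h) x)%E.
  by move=> h0; apply: ge0_conv_ge0 => // y; rewrite lee_fin.
have [pe1|pn1] := eqVneq p 1.
  rewrite pe1 subrr powRr0 mul1e poweRe1; last exact: c0.
  by rewrite (_ : (fun y => _) = EFin \o g) //; apply/funext => y /=; rewrite powRr1.
have {pn1}p1' : 1 < p by rewrite lt_neqAle eq_sym pn1.
pose q := p / (p - 1).
have pB : 0 < p - 1 by rewrite subr_gt0.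
have q0 : 0 < q by rewrite divr_gt0.
have pq : p^-1 + q^-1 = 1 by rewrite /q; field; rewrite !gt_eqF.
pose kx (y : V) := k (x - y).
have mkx : measurable_fun [set: V] kx.
  exact: (measurableT_comp mk (@measurable_rV_subl R n x)).
pose a (y : V) := g y * kx y `^ p^-1.
pose b (y : V) := kx y `^ q^-1.
have ma : measurable_fun [set: V] a.
  by apply: measurable_funM => //; exact: (measurableT_comp (measurable_powR p^-1) mkx).
have mb : measurable_fun [set: V] b by exact: (measurableT_comp (measurable_powR q^-1) mkx).
have := hoelder mu ma mb p0 q0 pq.
rewrite Lnorm1 (eq_integral (fun y : V => ((EFin \o k) (x - y)%R * (EFin \o g) y)%E)); last first.
  move=> y _ /=; rewrite ger0_norm; last by rewrite !mulr_ge0 ?powR_ge0.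
  rewrite /a /b -mulrA -powRD pq; last by rewrite oner_eq0.
  by rewrite powRr1 ?k_ge0 // mulrC.
rewrite -/(ge0_conv _ _ x) => hx.
have kb : ('N[mu]_q%:E[EFin \o b] = (mass `^ q^-1)%:E)%E.
  rewrite unlock /= -poweR_EFin -massE; congr (_ `^ _)%E.
  rewrite -[RHS](ge0_integral_rV_reflect x) //.
  apply: eq_integral => y _ /=.
  by rewrite ger0_norm ?powR_ge0 // -powRrM mulVf ?gt_eqF // powRr1 // k_ge0.
have ka : ('N[mu]_p%:E[EFin \o a] `^ p = ge0_conv (EFin \o k) (fun y => (g y `^ p)%:E) x)%E.
  rewrite poweR_Lnorm ?gt_eqF //; apply: eq_integral => y _ /=.
  rewrite ger0_norm; last by rewrite mulr_ge0 ?powR_ge0.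
  rewrite powRM ?powR_ge0 // -powRrM mulVf ?gt_eqF // powRr1 ?k_ge0 //.
  by rewrite -EFinM mulrC.
apply: (@le_trans _ _ (('N[mu]_p%:E[EFin \o a] * 'N[mu]_q%:E[EFin \o b]) `^ p)%E).
  by apply: (gt0_ler_poweR (ltW p0)) => //; rewrite in_itv /= ?leey ?andbT ?mule_ge0 ?Lnorm_ge0 // c0.
rewrite poweRM ?Lnorm_ge0 // ka kb poweR_EFin -powRrM muleC.
by rewrite (_ : q^-1 * p = p - 1) //; rewrite /q; field; rewrite !gt_eqF.
Qed.

(** Integrate [conv_powR_le] in x: by Tonelli's theorem and translation invariance
    the right-hand side becomes mass^(p-1) * mass times the integral of g^p. *)
Lemma young_real (p : R) (g : V -> R) : 1 <= p ->
  measurable_fun [set: V] g -> (forall x, 0 <= g x) ->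
  ('N[mu]_p%:E[ge0_conv (EFin \o k) (EFin \o g)] <= mass%:E * 'N[mu]_p%:E[EFin \o g])%E.
Proof.
move=> p1 mg g0.
have p0 : 0 < p by apply: lt_le_trans p1.
have pn0 : p != 0 by rewrite gt_eqF.
have mgE : measurable_fun [set: V] (EFin \o g) by exact/measurable_EFinP.
have gE0 x : (0 <= (EFin \o g) x)%E by rewrite lee_fin.
pose gp (y : V) := (g y `^ p)%:E.
have mgp : measurable_fun [set: V] gp.
  by apply/measurable_EFinP; exact: (measurableT_comp (measurable_powR p) mg).
have gp0 x : (0 <= gp x)%E by rewrite lee_fin powR_ge0.
have H0 x : (0 <= ge0_conv (EFin \o k) (EFin \o g) x)%E by apply: ge0_conv_ge0.
have mH := measurable_ge0_conv mkE mgE kE0 gE0.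
have mG := measurable_ge0_conv mkE mgp kE0 gp0.
rewrite unlock /=.
rewrite (eq_integral (fun y : V => ge0_conv (EFin \o k) (EFin \o g) y `^ p)%E); last first.
  by move=> y _; rewrite gee0_abs.
have -> : (\int[mu]_x (`|g x|%:E `^ p) = \int[mu]_x gp x)%E.
  by apply: eq_integral => y _; rewrite ger0_norm.
have I0 : (0 <= \int[mu]_x gp x)%E by exact: integral_ge0.
have -> : (mass%:E * (\int[mu]_x gp x) `^ p^-1 =
    ((mass `^ p)%:E * \int[mu]_x gp x) `^ p^-1)%E.
  rewrite poweRM ?lee_fin ?powR_ge0 // poweR_EFin -powRrM mulfV // powRr1 //.
apply: (gt0_ler_poweR (ltW _)); rewrite ?invr_gt0 // ?in_itv /= ?leey ?andbT.
- by apply: integral_ge0 => x _; exact: poweR_ge0.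
- by rewrite mule_ge0 ?lee_fin ?powR_ge0.
apply: (@le_trans _ _ (\int[mu]_x ((mass `^ (p - 1))%:E * ge0_conv (EFin \o k) gp x))%E).
  apply: ge0_le_integral => //.
  - by move=> x _; exact: poweR_ge0.
  - exact: (measurableT_comp (measurable_poweR p) mH).
  - exact: measurable_funeM.
  - by move=> x _; exact: conv_powR_le.
rewrite ge0_integralZl_EFin ?powR_ge0 //; last by move=> x _; exact: ge0_conv_ge0.
rewrite (ge0_integral_conv mkE mgp kE0 gp0) massE muleA -EFinM.
by rewrite -{2}(powRr1 mass_ge0) -powRD ?subrK ?(negbTE pn0).
Qed.

Lemma conv_bounded_le (g : V -> R) (M : R) x : 0 <= M ->
  measurable_fun [set: V] g -> (forall x, 0 <= g x) ->
  {ae mu, forall y, g y <= M} ->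
  (ge0_conv (EFin \o k) (EFin \o g) x <= mass%:E * M%:E)%E.
Proof.
move=> M0 mg g0 gM; rewrite -massE -(ge0_conv_cst x mkE kE0 M0).
have mkx : measurable_fun [set: V] (fun y : V => (k (x - y))%:E).
  exact: (measurableT_comp mkE (@measurable_rV_subl R n x)).
apply: ae_ge0_le_integral => //.
- by move=> y _; rewrite mule_ge0 // lee_fin.
- by apply: emeasurable_funM => //; exact/measurable_EFinP.
- by move=> y _; rewrite mule_ge0 // lee_fin.
- by apply: emeasurable_funM => //; exact: measurable_cst.
by apply: filterS gM => y gyM _ /=; rewrite lee_pmul ?lee_fin.
Qed.

Lemma mu_setT_gt0 : (0 < mu [set: V])%E.
Proof.
pose B := [set x : V | forall i : 'I_n, `[0, 1]%classic (x ord0 i)].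
have B1 : mu B = 1%E.
  rewrite /= (@lebesgue_rV_box R n (fun=> `[0, 1]%classic)) // big1 // => i _.
  by rewrite lebesgue_measure_itv /= lte_fin ltr01 sube0.
apply: (@lt_le_trans _ _ (mu B)); first by rewrite B1.
apply: le_measure => //; rewrite inE //.
rewrite (_ : B = \bigcap_(i in [set: 'I_n])
    ((fun x : V => x ord0 i) @^-1` `[0, 1]%classic)).
  apply: fin_bigcap_measurable => [|i _]; first exact: finite_finset.
  by rewrite -[X in measurable X]setTI; exact: measurable_coord.
by apply/seteqP; split=> [x h i _|x h i]; [exact: (h i)|exact: (h i Logic.I)].
Qed.

(** The second conclusion says that the convolution integral converges for almost
    every x: its p-th power is integrable, or, for p infinite, it is bounded. *)
Lemma young (p : \bar R) (g : V -> R) : (1 <= p)%E ->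
  measurable_fun [set: V] g -> (forall x, 0 <= g x) ->
  ('N[mu]_p[EFin \o g] < +oo)%E ->
  ('N[mu]_p[ge0_conv (EFin \o k) (EFin \o g)] <= mass%:E * 'N[mu]_p[EFin \o g])%E /\
  {ae mu, forall x, ge0_conv (EFin \o k) (EFin \o g) x < +oo}%E.
Proof.
move=> + mg g0.
have mgE : measurable_fun [set: V] (EFin \o g) by exact/measurable_EFinP.
have gE0 x : (0 <= (EFin \o g) x)%E by rewrite lee_fin.
have H0 x : (0 <= ge0_conv (EFin \o k) (EFin \o g) x)%E by apply: ge0_conv_ge0.
have mH := measurable_ge0_conv mkE mgE kE0 gE0.
case: p => [p|_|//]; last first.
  rewrite unlock mu_setT_gt0 => gy.
  have N0 : (0 <= ess_sup mu (abse \o (EFin \o g)))%E.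
    by apply: ess_sup_gee; [exact: mu_setT_gt0|by apply: nearW => x /=; rewrite lee_fin].
  have [M NM] : exists M, ess_sup mu (abse \o (EFin \o g)) = M%:E.
    by exists (fine (ess_sup mu (abse \o (EFin \o g)))); rewrite fineK // ge0_fin_numE.
  have M0 : 0 <= M by rewrite -lee_fin -NM.
  have gM : {ae mu, forall y, g y <= M}.
    have := ess_sup_ge mu (abse \o (EFin \o g)); rewrite NM; apply: filterS => y /=.
    by rewrite lee_fin ger0_norm.
  have HM x := conv_bounded_le x M0 mg g0 gM.
  split; last by apply: nearW => x; apply: (le_lt_trans (HM x)); rewrite -EFinM ltry.
  by rewrite NM; apply/ess_supP; apply: nearW => x /=; rewrite gee0_abs.
rewrite lee_fin => p1 gy; have p0 : 0 < p by apply: lt_le_trans p1.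
have Y := young_real p1 mg g0; split => //.
have Hp : mu.-integrable [set: V] (fun x => ge0_conv (EFin \o k) (EFin \o g) x `^ p)%E.
  apply/integrableP; split; first exact: (measurableT_comp (measurable_poweR p) mH).
  rewrite (eq_integral (fun x : V => `|ge0_conv (EFin \o k) (EFin \o g) x| `^ p)%E).
    rewrite -poweR_Lnorm ?gt_eqF //; apply: poweR_lty; apply: (le_lt_trans Y).
    by apply: lte_mul_pinfty => //; rewrite lee_fin.
  by move=> x _; rewrite [in LHS]gee0_abs ?poweR_ge0 // gee0_abs.
apply: filterS (integrable_ae measurableT Hp) => x /(_ Logic.I) Hx.
apply: (@lty_poweRy _ _ p); first by rewrite gt_eqF.
by rewrite ltey_eq Hx.
Qed.

End young.

(** * Fourier transform of a real convolution *)

Local Open Scope complex_scope.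

Section real_convolution.
Context {R : realType} (n : nat).
Local Notation V := 'rV[R]_n.
Local Notation mu := (@leb R n).

Lemma Rintegral_rV_shift (c : V) (f : V -> R) : measurable_fun [set: V] f ->
  \int[mu]_x f (x - c) = \int[mu]_x f x.
Proof.
move=> mf; have mfE : measurable_fun [set: V] (EFin \o f) by exact/measurable_EFinP.
rewrite /Rintegral [in LHS]integralE [in RHS]integralE.
congr (fine (_ - _)).
- rewrite -(ge0_integral_rV_shift c (measurable_funepos mfE)) //.
  by apply: eq_integral => x _; rewrite !funeposE.
- rewrite -(ge0_integral_rV_shift c (measurable_funeneg mfE)) //.
  by apply: eq_integral => x _; rewrite !funenegE.
Qed.

Variable k : V -> R.
Hypothesis ki : mu.-integrable [set: V] (EFin \o k).

Let mk : measurable_fun [set: V] k.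
Proof. by apply/measurable_EFinP; exact: measurable_int ki. Qed.

Definition rconv (g : V -> R) (x : V) : R := \int[mu]_y (k (x - y) * g y).

Let mkg (g : V -> R) : measurable_fun [set: V] g ->
  measurable_fun [set: V * V] (fun z => (k (z.1 - z.2) * g z.2)%:E).
Proof.
move=> mg; apply/measurable_EFinP; apply: measurable_funM.
  exact: (measurableT_comp mk (@measurable_rV_sub R n)).
exact: (measurableT_comp mg measurable_snd).
Qed.

Lemma measurable_rconv (g : V -> R) : measurable_fun [set: V] g ->
  measurable_fun [set: V] (rconv g).
Proof.
move=> mg; have mF := mkg mg.
apply: (measurableT_comp (@fine_measurable R setT measurableT)).
rewrite (_ : (fun x => _) = (fun x =>
  \int[mu]_y ((fun z : V * V => (k (z.1 - z.2) * g z.2)%:E)^\+ (x, y)) -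
  \int[mu]_y ((fun z : V * V => (k (z.1 - z.2) * g z.2)%:E)^\- (x, y)))%E); last first.
  by apply/funext => x; rewrite integralE; congr (_ - _)%E;
    apply: eq_integral => y _; rewrite ?funeposE ?funenegE.
apply: emeasurable_funB.
- by apply: measurable_fun_fubini_tonelli_F => //; exact: measurable_funepos.
- by apply: measurable_fun_fubini_tonelli_F => //; exact: measurable_funeneg.
Qed.

(** Holds also where the integral defining the convolution diverges, since the
    real-valued integral is then 0. *)
Lemma rconv_abs_le (g h : V -> R) x : measurable_fun [set: V] g ->
  measurable_fun [set: V] h -> (forall y, `|g y| <= h y) ->
  (`|rconv g x|%:E <= ge0_conv (fun y => `|k y|%:E) (EFin \o h) x)%E.
Proof.
move=> mg mh gh.
have mkx : measurable_fun [set: V] (fun y => k (x - y)).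
  exact: (measurableT_comp mk (@measurable_rV_subl R n x)).
have fle (a : \bar R) : (`|fine a|%:E <= `|a|)%E by case: a => //= ; rewrite leey.
apply: (le_trans (fle _)); apply: (le_trans (le_abse_integral _ _ _)) => //.
  by apply/measurable_EFinP; exact: measurable_funM.
apply: ge0_le_integral => //.
- by apply: measurableT_comp => //; apply/measurable_EFinP; exact: measurable_funM.
- by apply/measurable_EFinP; apply: measurable_funM => //; exact: measurableT_comp.
- by move=> y _ /=; rewrite -EFinM lee_fin normrM ler_wpM2l.
Qed.

Lemma integrable_conv_kernel (g h : V -> R) x : measurable_fun [set: V] g ->
  measurable_fun [set: V] h -> (forall y, `|g y| <= h y) ->
  (ge0_conv (fun y => `|k y|%:E) (EFin \o h) x < +oo)%E ->
  mu.-integrable [set: V] (fun y => (k (x - y) * g y)%:E).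
Proof.
move=> mg mh gh hx.
have mkx : measurable_fun [set: V] (fun y => k (x - y)).
  exact: (measurableT_comp mk (@measurable_rV_subl R n x)).
apply/integrableP; split; first by apply/measurable_EFinP; exact: measurable_funM.
apply: le_lt_trans hx; apply: ge0_le_integral => //.
- by apply: measurableT_comp => //; apply/measurable_EFinP; exact: measurable_funM.
- by apply/measurable_EFinP; apply: measurable_funM => //; exact: measurableT_comp.
- by move=> y _ /=; rewrite -EFinM lee_fin normrM ler_wpM2l.
Qed.

Section fourier_rconv.
Variable g : V -> R.
Hypothesis gi : mu.-integrable [set: V] (EFin \o g).

Let mg : measurable_fun [set: V] g.
Proof. by apply/measurable_EFinP; exact: measurable_int gi. Qed.

Lemma integrable_conv_prod :
  (mu \x mu)%E.-integrable [set: V * V] (fun z => (k (z.1 - z.2) * g z.2)%:E).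
Proof.
apply/integrable12ltyP; first exact: mkg.
rewrite (eq_integral (ge0_conv (fun y => `|k y|%:E) (fun y => `|g y|%:E))); last first.
  by move=> x _; apply: eq_integral => y _; rewrite /= normrM EFinM.
have ak : measurable_fun [set: V] (fun y => `|k y|%:E).
  by apply/measurable_EFinP; exact: measurableT_comp.
have ag : measurable_fun [set: V] (fun y => `|g y|%:E).
  by apply/measurable_EFinP; exact: measurableT_comp.
rewrite ge0_integral_conv //.
by apply: lte_mul_pinfty;
  [exact: integral_ge0|exact: integrable_fin_num (integrable_abse ki)|case/integrableP: gi].
Qed.

Lemma integrable_rconv : mu.-integrable [set: V] (EFin \o rconv g).
Proof.
exact: (integrable_Rintegral2 integrable_conv_prod).
Qed.

(** Exchange of the integrals and the change of variable x = z + y.  The convolution is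
    defined by a convergent integral for almost every x only, which is enough to
    move phi x inside. *)
Lemma Rintegral_rconv_mul (phi : V -> R) :
  measurable_fun [set: V] phi -> (forall x, `|phi x| <= 1) ->
  \int[mu]_x (rconv g x * phi x) =
  \int[mu]_y (g y * \int[mu]_z (k z * phi (z + y))).
Proof.
move=> mphi phi1.
have fi := integrable_conv_prod.
have mphi' : measurable_fun [set: V * V] (fun z => phi z.1) by exact: measurableT_comp.
have phi1' (z : V * V) : `|phi z.1| <= 1 by [].
have fpi := integrable_mul_bounded fi mphi' phi1'.
transitivity (\int[mu]_x \int[mu]_y (k (x - y) * g y * phi x)).
  rewrite /Rintegral; congr fine.
  have i1 := integrable_mul_bounded integrable_rconv mphi phi1.
  have i2 : mu.-integrable [set: V] (fun x => (\int[mu]_y (k (x - y) * g y * phi x))%:E).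
    exact: (integrable_Rintegral2 (f := fun z : V * V => k (z.1 - z.2) * g z.2 * phi z.1) fpi).
  apply: ae_eq_integral => //; [exact: measurable_int _ i1|exact: measurable_int _ i2|].
  apply: filterS (ae_integrable1 fi) => x ix _ /=.
  by rewrite -RintegralZr.
rewrite (Rintegral_prod12 fpi) -(Rintegral_prod21 fpi) /=.
apply: eq_Rintegral => y _.
have mkp : measurable_fun [set: V] (fun z => k z * phi (z + y)).
  apply: measurable_funM => //; apply: (measurableT_comp mphi).
  have := @measurable_rV_subr R n (- y); congr (measurable_fun _ _).
  by apply/funext => z; rewrite opprK.
rewrite -(Rintegral_rV_shift y mkp) -RintegralZl //.
  by apply: eq_Rintegral => x _; rewrite subrK; ring.
have ky : mu.-integrable [set: V] (fun x => (k (x - y))%:E).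
  apply/integrableP; split.
    by apply/measurable_EFinP; exact: (measurableT_comp mk (@measurable_rV_subr R n y)).
  rewrite (ge0_integral_rV_shift y (f := fun x => `|(k x)%:E|%E)) //; last first.
    by apply: measurableT_comp => //; exact/measurable_EFinP.
  by case/integrableP: ki.
apply: eq_integrable (integrable_mul_bounded ky mphi phi1) => // x _.
by rewrite /= subrK.
Qed.

Variables (xi : V) (c : R).
Hypotheses (kcos : \int[mu]_x (k x * cos (dotp xi x)) = c)
  (ksin : \int[mu]_x (k x * sin (dotp xi x)) = 0).

Let dotpD (x y : V) : dotp xi (x + y) = dotp xi x + dotp xi y.
Proof. by rewrite /dotp -big_split; apply: eq_bigr => i _; rewrite mxE mulrDr. Qed.

Let kci : mu.-integrable [set: V] (fun x => (k x * cos (dotp xi x))%:E).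
Proof.
apply: (integrable_mul_bounded ki (measurable_cos_dotp xi)) => x; exact: normr_cos_le1.
Qed.

Let ksi : mu.-integrable [set: V] (fun x => (k x * sin (dotp xi x))%:E).
Proof.
apply: (integrable_mul_bounded ki (measurable_sin_dotp xi)) => x; exact: normr_sin_le1.
Qed.

(** The addition formula for cos (xi . (z + y)) would produce also the sine transform
    of the kernel, which vanishes. *)
Lemma Rintegral_rconv_cos :
  \int[mu]_x (rconv g x * cos (dotp xi x)) = c * \int[mu]_x (g x * cos (dotp xi x)).
Proof.
rewrite (Rintegral_rconv_mul (measurable_cos_dotp xi)); last by move=> x; exact: normr_cos_le1.
rewrite -RintegralZl //; last first.
  by apply: (integrable_mul_bounded gi (measurable_cos_dotp xi)) => x; exact: normr_cos_le1.
apply: eq_Rintegral => y _.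
rewrite (_ : \int[mu]_z _ = c * cos (dotp xi y)); first by ring.
transitivity (\int[mu]_z (k z * cos (dotp xi z) * cos (dotp xi y) -
    k z * sin (dotp xi z) * sin (dotp xi y))).
  by apply: eq_Rintegral => z _; rewrite dotpD cosD; ring.
rewrite RintegralB ?RintegralZr // ?kcos ?ksin ?mul0r ?subr0 //.
- exact: (integrableZr measurableT (cos (dotp xi y)) kci).
- exact: (integrableZr measurableT (sin (dotp xi y)) ksi).
Qed.

Lemma Rintegral_rconv_sin :
  \int[mu]_x (rconv g x * sin (dotp xi x)) = c * \int[mu]_x (g x * sin (dotp xi x)).
Proof.
rewrite (Rintegral_rconv_mul (measurable_sin_dotp xi)); last by move=> x; exact: normr_sin_le1.
rewrite -RintegralZl //; last first.
  by apply: (integrable_mul_bounded gi (measurable_sin_dotp xi)) => x; exact: normr_sin_le1.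
apply: eq_Rintegral => y _.
rewrite (_ : \int[mu]_z _ = c * sin (dotp xi y)); first by ring.
transitivity (\int[mu]_z (k z * sin (dotp xi z) * cos (dotp xi y) +
    k z * cos (dotp xi z) * sin (dotp xi y))).
  by apply: eq_Rintegral => z _; rewrite dotpD sinD; ring.
rewrite RintegralD ?RintegralZr // ?kcos ?ksin ?mul0r ?add0r //.
- exact: (integrableZr measurableT (cos (dotp xi y)) ksi).
- exact: (integrableZr measurableT (sin (dotp xi y)) kci).
Qed.

End fourier_rconv.
End real_convolution.

(** * Convolution of complex functions *)

Section complex_modulus.
Context {R : realType}.
Implicit Types (a : R) (z : R[i]).

Lemma Re_realM a z : complex.Re (a%:C * z) = a * complex.Re z.
Proof. by case: z => x y /=; rewrite mul0r subr0. Qed.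

Lemma Im_realM a z : complex.Im (a%:C * z) = a * complex.Im z.
Proof. by case: z => x y /=; rewrite mul0r addr0. Qed.

Lemma normc_real a : Normc.normc a%:C = `|a|.
Proof. by rewrite /= expr0n addr0 sqrtr_sqr. Qed.

Lemma normc_ge0 z : 0 <= Normc.normc z.
Proof. by case: z => x y; exact: sqrtr_ge0. Qed.

Lemma normc_le z : Normc.normc z <= `|complex.Re z| + `|complex.Im z|.
Proof.
case: z => x y /=; rewrite -[leRHS]ger0_norm ?addr_ge0 // -sqrtr_sqr.
rewrite ler_sqrt ?sqr_ge0 // sqrrD !real_normK ?num_real //.
by rewrite -addrA lerD2l lerDr mulrn_wge0 // mulr_ge0.
Qed.

Lemma Re_le_normc z : `|complex.Re z| <= Normc.normc z.
Proof.
by case: z => x y /=; rewrite -sqrtr_sqr ler_sqrt ?addr_ge0 ?sqr_ge0 // lerDl sqr_ge0.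
Qed.

Lemma Im_le_normc z : `|complex.Im z| <= Normc.normc z.
Proof.
by case: z => x y /=; rewrite -sqrtr_sqr ler_sqrt ?addr_ge0 ?sqr_ge0 // lerDr sqr_ge0.
Qed.

Lemma measurable_normc dT (T : measurableType dT) (f : T -> R[i]) :
  cmeasurable_fun f -> measurable_fun [set: T] (fun x => Normc.normc (f x)).
Proof.
move=> [mr mi].
rewrite (_ : (fun x => _) = (fun x =>
  Num.sqrt (complex.Re (f x) ^+ 2 + complex.Im (f x) ^+ 2))); last first.
  by apply/funext => x; case: (f x).
apply: (measurableT_comp (continuous_measurable_fun (@sqrt_continuous R))).
by apply: measurable_funD; exact: measurable_funX.
Qed.

End complex_modulus.

Lemma le_Lnorm (R : realType) dT (T : measurableType dT) (mu : {measure set T -> \bar R})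
    (p : \bar R) (f g : T -> \bar R) : (1 <= p)%E ->
  measurable_fun [set: T] f -> measurable_fun [set: T] g ->
  (forall x, `|f x| <= `|g x|)%E -> ('N[mu]_p[f] <= 'N[mu]_p[g])%E.
Proof.
move=> + mf mg fg; rewrite unlock; case: p => [p||//] /=; last first.
  by move=> _; case: ifP => // _; apply: le_ess_sup; exact: nearW.
rewrite lee_fin => p1; have p0 : 0 < p by apply: lt_le_trans p1.
have I0 (h : T -> \bar R) : (0 <= \int[mu]_x (`|h x| `^ p))%E.
  by apply: integral_ge0 => x _; exact: poweR_ge0.
apply: gt0_ler_poweR; rewrite ?invr_ge0 ?(ltW p0) ?in_itv /= ?leey ?andbT //.
have mabs (h : T -> \bar R) : measurable_fun [set: T] h ->
    measurable_fun [set: T] (fun x => `|h x| `^ p)%E.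
  by move=> mh; apply: (measurableT_comp (measurable_poweR p)); exact: measurableT_comp.
apply: ge0_le_integral => //; [by move=> x _; exact: poweR_ge0|exact: mabs|exact: mabs|].
by move=> x _; apply: gt0_ler_poweR; rewrite ?(ltW p0) ?in_itv /= ?leey ?andbT.
Qed.

Section complex_convolution.
Context {R : realType} (n : nat).
Local Notation V := 'rV[R]_n.
Local Notation mu := (@leb R n).
Variable k : V -> R.
Hypothesis ki : mu.-integrable [set: V] (EFin \o k).
Local Notation K := (fun x : V => (k x)%:C).

Let mk : measurable_fun [set: V] k.
Proof. by apply/measurable_EFinP; exact: measurable_int ki. Qed.

Let Lnorm_leb p (f : V -> \bar R) : ('N[mu]_p[f] = 'N[lebesgue_rV n]_p[f])%E.
Proof. by rewrite unlock. Qed.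

Lemma cLp_real_kernel : cLp (lebesgue_rV n) 1%E K.
Proof.
split; first by split => //=; exact: measurable_cst.
rewrite /cLnorm Lnorm1.
rewrite (eq_integral (fun x => `|(k x)%:E|)%E); first by case/integrableP: ki.
by move=> x _; rewrite normc_real /= normr_id.
Qed.

Let ReK (f : V -> R[i]) x : complex.Re (convolution K f x) = rconv k (@complex.Re R \o f) x.
Proof. by rewrite /= /rconv; apply: eq_Rintegral => y _; rewrite Re_realM. Qed.

Let ImK (f : V -> R[i]) x : complex.Im (convolution K f x) = rconv k (@complex.Im R \o f) x.
Proof. by rewrite /= /rconv; apply: eq_Rintegral => y _; rewrite Im_realM. Qed.

Lemma cmeasurable_convolution (f : V -> R[i]) : cmeasurable_fun f ->
  cmeasurable_fun (convolution K f).
Proof.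
move=> [mr mi]; split.
  by under eq_fun do rewrite ReK; exact: measurable_rconv.
by under eq_fun do rewrite ImK; exact: measurable_rconv.
Qed.

(** The modulus of the convolution is at most the sum of the moduli of its real
    and imaginary parts, hence at most the convolution of 2 |k| with |f|, to which
    Young's inequality for nonnegative functions applies. *)
Lemma convolution_Lp : exists A : R, forall (p : \bar R) (f : V -> R[i]),
  (1 <= p)%E -> cLp (lebesgue_rV n) p f ->
  [/\ {ae lebesgue_rV n, forall x, cintegrable (lebesgue_rV n) (fun y => K (x - y) * f y)},
      cLp (lebesgue_rV n) p (convolution K f)
    & (cLnorm (lebesgue_rV n) p (convolution K f) <= A%:E * cLnorm (lebesgue_rV n) p f)%E].
Proof.
pose k2 (y : V) := 2 * `|k y|.
have k2_ge0 y : 0 <= k2 y by rewrite mulr_ge0.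
have k2i : mu.-integrable [set: V] (EFin \o k2).
  exact: (integrableZl measurableT 2 (integrable_abse ki)).
have mk2E : measurable_fun [set: V] (EFin \o k2) by exact: measurable_int k2i.
exists (\int[mu]_x k2 x) => p f p1 [mf fp].
pose g (y : V) := Normc.normc (f y).
have mg : measurable_fun [set: V] g by exact: measurable_normc.
have g0 y : 0 <= g y by exact: normc_ge0.
have mgE : measurable_fun [set: V] (EFin \o g) by exact/measurable_EFinP.
rewrite /cLnorm -Lnorm_leb in fp.
have [Y1 Y2] := young k2_ge0 k2i p1 mg g0 fp.
have mak : measurable_fun [set: V] (fun y => `|k y|%:E).
  by apply/measurable_EFinP; exact: measurableT_comp.
have H0 x : (0 <= ge0_conv (fun y => `|k y|%:E) (EFin \o g) x)%E.
  by apply: ge0_conv_ge0 => y; rewrite lee_fin.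
have k2E x : (ge0_conv (EFin \o k2) (EFin \o g) x =
    2%:E * ge0_conv (fun y => `|k y|%:E) (EFin \o g) x)%E.
  rewrite /ge0_conv -ge0_integralZl_EFin //.
  - by apply: eq_integral => y _; rewrite /= -!EFinM mulrA.
  - by move=> y _; rewrite mule_ge0 // lee_fin.
  - apply: emeasurable_funM => //.
    exact: (measurableT_comp mak (@measurable_rV_subl R n x)).
have Cle x : ((Normc.normc (convolution K f x))%:E <=
    ge0_conv (EFin \o k2) (EFin \o g) x)%E.
  apply: (@le_trans _ _ (`|complex.Re (convolution K f x)| +
    `|complex.Im (convolution K f x)|)%:E); first by rewrite lee_fin normc_le.
  rewrite k2E (_ : 2%:E = 1%:E + 1%:E)%E // EFinD ge0_muleDl // !mul1e ReK ImK.
  apply: leeD.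
    by apply: (rconv_abs_le ki) => [|//|y]; [case: mf|exact: Re_le_normc].
  by apply: (rconv_abs_le ki) => [|//|y]; [case: mf|exact: Im_le_normc].
have mC := cmeasurable_convolution mf.
have N_le : (cLnorm (lebesgue_rV n) p (convolution K f) <=
    (\int[mu]_x k2 x)%:E * cLnorm (lebesgue_rV n) p f)%E.
  rewrite /cLnorm -!Lnorm_leb; apply: le_trans Y1; apply: le_Lnorm => //.
  - by apply/measurable_EFinP; exact: measurable_normc.
  - by apply: measurable_ge0_conv => // y; rewrite lee_fin.
  - move=> x; rewrite gee0_abs ?lee_fin ?normc_ge0 // gee0_abs ?k2E ?mule_ge0 //.
    by rewrite -k2E.
split => //; last first.
  split => //; apply: (le_lt_trans N_le); rewrite /cLnorm -Lnorm_leb.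
  by apply: lte_mul_pinfty => //; rewrite lee_fin; apply: Rintegral_ge0.
apply: filterS Y2 => x; rewrite k2E => Hx.
have {}Hx : (ge0_conv (fun y => `|k y|%:E) (EFin \o g) x < +oo)%E.
  apply: le_lt_trans Hx; rewrite -[leLHS]mul1e lee_wpmul2r // lee_fin; lra.
split.
- under eq_fun do rewrite Re_realM.
  by apply: (integrable_conv_kernel ki _ _ _ Hx) => [|//|y]; [case: mf|exact: Re_le_normc].
- under eq_fun do rewrite Im_realM.
  by apply: (integrable_conv_kernel ki _ _ _ Hx) => [|//|y]; [case: mf|exact: Im_le_normc].
Qed.

Variables (xi : V) (c : R).
Hypotheses (kcos : \int[mu]_x (k x * cos (dotp xi x)) = c)
  (ksin : \int[mu]_x (k x * sin (dotp xi x)) = 0).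

Lemma fourier_real_kernel : fourier K xi = c%:C.
Proof.
rewrite /fourier /cintegral; congr (_ +i* _).
  by rewrite -kcos; apply: eq_Rintegral => x _; rewrite Re_realM.
transitivity (\int[mu]_x (-1 * (k x * sin (dotp xi x)))).
  by apply: eq_Rintegral => x _; rewrite Im_realM /=; ring.
rewrite RintegralZl ?ksin ?mulr0 //.
by apply: (integrable_mul_bounded ki (measurable_sin_dotp xi)) => x; exact: normr_sin_le1.
Qed.

(** The kernel being real and its sine transform zero, the real and imaginary
    parts of f are convolved separately and their cosine and sine transforms are
    multiplied by c. *)
Lemma fourier_convolution (f : V -> R[i]) : cLp (lebesgue_rV n) 1%E f ->
  fourier (convolution K f) xi = c%:C * fourier f xi.
Proof.
move=> [[mr mi] f1]; have fN : (\int[mu]_x (Normc.normc (f x))%:E < +oo)%E.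
  move: f1; rewrite /cLnorm Lnorm1 (eq_integral (fun x => (Normc.normc (f x))%:E)) //.
  by move=> x _; rewrite gee0_abs // lee_fin normc_ge0.
have int_le (h : V -> R) : measurable_fun [set: V] h ->
    (forall x, `|h x| <= Normc.normc (f x)) -> mu.-integrable [set: V] (EFin \o h).
  move=> mh hf; apply/integrableP; split; first exact/measurable_EFinP.
  apply: le_lt_trans fN; apply: ge0_le_integral => //.
  - by apply: measurableT_comp => //; exact/measurable_EFinP.
  - by apply/measurable_EFinP; apply: measurable_normc.
  - by move=> x _; rewrite lee_fin.
have ri := int_le (@complex.Re R \o f) mr (fun x => Re_le_normc (f x)).
have ii := int_le (@complex.Im R \o f) mi (fun x => Im_le_normc (f x)).
have ci (h : V -> R) : mu.-integrable [set: V] (EFin \o h) ->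
    mu.-integrable [set: V] (fun x => (h x * cos (dotp xi x))%:E).
  by move=> hi; apply: (integrable_mul_bounded hi (measurable_cos_dotp xi)) => x;
    exact: normr_cos_le1.
have si (h : V -> R) : mu.-integrable [set: V] (EFin \o h) ->
    mu.-integrable [set: V] (fun x => (h x * sin (dotp xi x))%:E).
  by move=> hi; apply: (integrable_mul_bounded hi (measurable_sin_dotp xi)) => x;
    exact: normr_sin_le1.
have FE (h : V -> R[i]) : mu.-integrable [set: V] (EFin \o (@complex.Re R \o h)) ->
    mu.-integrable [set: V] (EFin \o (@complex.Im R \o h)) ->
    fourier h xi = (\int[mu]_x (complex.Re (h x) * cos (dotp xi x)) +
      \int[mu]_x (complex.Im (h x) * sin (dotp xi x))) +i*
      (\int[mu]_x (complex.Im (h x) * cos (dotp xi x)) -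
      \int[mu]_x (complex.Re (h x) * sin (dotp xi x))).
  move=> hr hi; rewrite /fourier /cintegral; congr (_ +i* _).
    rewrite -RintegralD //; [|exact: ci|exact: si].
    by apply: eq_Rintegral => x _; case: (h x) => a b /=; ring.
  rewrite -RintegralB //; [|exact: ci|exact: si].
  by apply: eq_Rintegral => x _; case: (h x) => a b /=; ring.
rewrite FE; last 2 first.
- rewrite (_ : @complex.Re R \o _ = rconv k (@complex.Re R \o f)); first exact: integrable_rconv.
  by apply/funext => x; exact: ReK.
- rewrite (_ : @complex.Im R \o _ = rconv k (@complex.Im R \o f)); first exact: integrable_rconv.
  by apply/funext => x; exact: ImK.
rewrite (FE f ri ii).
have E1 := Rintegral_rconv_cos ki ri kcos ksin.
have E2 := Rintegral_rconv_sin ki ri kcos ksin.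
have E3 := Rintegral_rconv_cos ki ii kcos ksin.
have E4 := Rintegral_rconv_sin ki ii kcos ksin.
have ReE (h : V -> R) : \int[mu]_x (complex.Re (convolution K f x) * h x) =
    \int[mu]_x (rconv k (@complex.Re R \o f) x * h x).
  by apply: eq_Rintegral => x _; rewrite ReK.
have ImE (h : V -> R) : \int[mu]_x (complex.Im (convolution K f x) * h x) =
    \int[mu]_x (rconv k (@complex.Im R \o f) x * h x).
  by apply: eq_Rintegral => x _; rewrite ImK.
rewrite !ReE !ImE E1 E2 E3 E4; apply/eqP; rewrite eq_complex /=.
by apply/andP; split; apply/eqP; ring.
Qed.

End complex_convolution.

(** * The remainder *)

Section main.
Context {R : realType}.
Notation mu := (@lebesgue_measure R).
Variables beta gamma lambda : R.
Hypotheses (beta_gt0 : 0 < beta) (gamma_gt1 : 1 < gamma) (gamma_le2 : gamma <= 2)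
  (lambda_gt1 : 1 < lambda).

Let C : R := (Gamma_fun beta)^-1.

Definition remainder_symbol (r : R) : R :=
  r `^ gamma / ln (lambda + r) `^ beta -
  (Gamma_fun beta)^-1 * (main_term beta gamma r - correction_term beta gamma lambda r).

Definition remainder_kernel (d : nat) (x : 'rV[R]_d) : R :=
  gauss_mixture (@ktsz_measure R) (fun p => (Gamma_fun beta)^-1 * weight_ktsz beta gamma lambda p)
    (width lambda) x.

Let g2 (t : R) : R := tau_pow beta t * (t < gamma)%R%:R.
Let g3 (t : R) : R := tau_pow beta t * ((t < gamma - 1)%R%:R * t).

Let tau_pow_supp (c t x : R) : c <= 2 -> tau_pow beta t * ((t < c)%R%:R * x) != 0 -> 0 < t /\ t < 2.
Proof.
move=> c2; case: (ltP 0 t) => [t0|t0]; last by rewrite tau_pow_le0 // mul0r eqxx.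
by case: ltP => tc; [split=> //; lra|rewrite mul0r mulr0 eqxx].
Qed.

Let g2_supp : supported02 g2.
Proof.
have [g1 g2_] := (gamma_gt1, gamma_le2); split.
  apply: (integrable_tau_pow_bounded beta_gt0 (M := 1)); first exact: measurable_ind_lt.
  - by move=> t _ _; case: ltP; rewrite ?normr1 ?normr0.
  - by move=> t t2; case: ltP => // tc; lra.
by move=> t; rewrite /g2 -[(_ < _)%R%:R]mulr1; exact: tau_pow_supp.
Qed.

Let g3_supp : supported02 g3.
Proof.
have [g1 g2_] := (gamma_gt1, gamma_le2); split.
  apply: (integrable_tau_pow_bounded beta_gt0 (M := 2)).
  - by apply: measurable_funM; first exact: measurable_ind_lt.
  - move=> t t0 t2; case: ltP; rewrite ?mul0r ?mul1r ?normr0 // => _.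
    by rewrite gtr0_norm.
  - by move=> t t2; case: ltP => [tc|]; [lra|rewrite mul0r].
by move=> t; apply: tau_pow_supp; lra.
Qed.

Let main_term_laplace (r : R) : 0 < r -> main_term beta gamma r = r `^ gamma * laplace g2 (ln r).
Proof.
move=> r0; rewrite /laplace -RintegralZl //; last exact: integrable_laplace.
apply: eq_Rintegral => t _; rewrite powRB ?(implybT, gt_eqF r0) //.
by rewrite /g2 expRN /powR gt_eqF //; ring.
Qed.

Let correction_term_laplace (r : R) : 0 < r ->
  correction_term beta gamma lambda r = lambda * r `^ (gamma - 1) * laplace g3 (ln r).
Proof.
move=> r0; rewrite /laplace -RintegralZl //; last exact: integrable_laplace.
apply: eq_Rintegral => t _.
rewrite (_ : gamma - t - 1 = gamma - 1 - t); last by ring.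
rewrite powRB ?(implybT, gt_eqF r0) // /g3 expRN /powR gt_eqF //; ring.
Qed.

(** For r > 0, r^(gamma - tau) = r^gamma exp (- tau ln r), so that the integrals
    over tau are Laplace transforms at ln r of functions supported in [0, 2]. *)
Lemma smooth_remainder_symbol d :
  smooth_on [set x : 'rV[R]_d | x != 0] (fun x => remainder_symbol (enorm x)).
Proof.
pose f : R -> R := ((fun r => r `^ gamma) \* (fun r => ln (lambda + r) `^ (- beta))) \+
  (cst C \* ((cst (-1) \* ((fun r => r `^ gamma) \* (fun r => laplace g2 (ln r)))) \+
    (cst lambda \* ((fun r => r `^ (gamma - 1)) \* (fun r => laplace g3 (ln r)))))).
have Cf : radial_class lambda f.
  apply: radial_add.
    by apply: radial_mul; [exact: radial_powR|exact: radial_ln].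
  apply: radial_mul; first exact: radial_cst.
  apply: radial_add; (apply: radial_mul; first exact: radial_cst);
    (apply: radial_mul; first exact: radial_powR); exact: radial_laplace.
apply: (smooth_on_radial lambda_gt1 Cf) => x x0.
have r0 := enorm_gt0 x0.
rewrite /remainder_symbol main_term_laplace // correction_term_laplace // /f /= powRN -/C; ring.
Qed.

Lemma decomposition_symbol (r : R) : 0 <= r ->
  r `^ gamma / ln (lambda + r) `^ beta =
    (Gamma_fun beta)^-1 * (\int[mu]_(t in `[gamma - 1, gamma])
      (t `^ (beta - 1) * r `^ (gamma - t))) +
    (Gamma_fun beta)^-1 * (\int[mu]_(t in `[0, gamma - 1])
      (t `^ (beta - 1) * (r `^ (gamma - t) - lambda * t * r `^ (gamma - t - 1)))) +
    remainder_symbol r.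
Proof.
move=> r0; rewrite -mulrDr (main_sub_correction beta_gt0 gamma_gt1 gamma_le2 lambda_gt1 r0).
by rewrite /remainder_symbol; ring.
Qed.

Let wi : (@ktsz_measure R).-integrable [set: _]
  (EFin \o (fun p => (Gamma_fun beta)^-1 * weight_ktsz beta gamma lambda p)).
Proof.
exact: (integrableZl measurableT (Gamma_fun beta)^-1
  (integrable_weight_ktsz beta_gt0 gamma_gt1 gamma_le2 lambda_gt1)).
Qed.

Let v0 p : (Gamma_fun beta)^-1 * weight_ktsz beta gamma lambda p != 0 -> 0 < width lambda p.
Proof.
rewrite mulf_eq0 negb_or => /andP[_]; exact: width_gt0.
Qed.

Lemma integrable_remainder_kernel d :
  (leb d).-integrable [set: 'rV[R]_d] (EFin \o @remainder_kernel d).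
Proof. exact: (integrable_gauss_mixture wi (measurable_width lambda) v0). Qed.

(** A Gaussian density of width v has transform exp (- v^2 |xi|^2 / 4), so that the
    transform of the kernel is the mixture computed by [symbol_gauss_mixture]. *)
Lemma remainder_kernel_cos d (xi : 'rV[R]_d) :
  \int[leb d]_x (remainder_kernel x * cos (dotp xi x)) = remainder_symbol (enorm xi).
Proof.
rewrite (gauss_mixture_cos wi (measurable_width lambda) v0).
transitivity (\int[@ktsz_measure R]_p ((Gamma_fun beta)^-1 * (weight_ktsz beta gamma lambda p *
    expR (- (width lambda p ^+ 2 * enorm xi ^+ 2 / 4))))).
  by apply: eq_Rintegral => p _; rewrite -[LHS]mulrA.
have G0 := Gamma_fun_gt0 beta_gt0.
rewrite RintegralZl //; last first.
  apply: (integrable_mul_bounded (M := 1)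
    (integrable_weight_ktsz beta_gt0 gamma_gt1 gamma_le2 lambda_gt1)).
    apply: (measurableT_comp (@measurable_expR R)).
    apply: (measurableT_comp (@oppr_measurable R setT)).
    apply: measurable_funM; last exact: measurable_cst.
    apply: measurable_funM; last exact: measurable_cst.
    by apply: measurable_funX; exact: measurable_width.
  move=> p; rewrite ger0_norm ?expR_ge0 // -[leRHS]expR0 ler_expR oppr_le0.
  by rewrite divr_ge0 // mulr_ge0 // sqr_ge0.
rewrite symbol_gauss_mixture ?sqrtr_ge0 // /remainder_symbol.
by move: (_ / ln _ `^ _) => z; field; rewrite gt_eqF.
Qed.

Lemma remainder_kernel_sin d (xi : 'rV[R]_d) :
  \int[leb d]_x (remainder_kernel x * sin (dotp xi x)) = 0.
Proof. exact: (gauss_mixture_sin wi (measurable_width lambda) v0). Qed.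

End main.

Theorem lemma2p3 (R : realType) (beta : R) (beta_gt0 : 0 < beta) :
  exists C : R, 0 < C /\
  forall (d : nat) (gamma lambda : R),
    (1 <= d)%N -> 1 < gamma -> gamma <= 2 -> 1 < lambda ->
  exists (P : 'rV[R]_d -> R) (K : 'rV[R]_d -> R[i]),
  [/\ (* the decomposition, as an identity of symbols *)
      forall xi : 'rV[R]_d,
        enorm xi `^ gamma / ln (lambda + enorm xi) `^ beta =
          C * (\int[lebesgue_measure]_(tau in `[gamma - 1, gamma])
                 (tau `^ (beta - 1) * enorm xi `^ (gamma - tau)))
        + C * (\int[lebesgue_measure]_(tau in `[0, gamma - 1])
                 (tau `^ (beta - 1) *
                    (enorm xi `^ (gamma - tau)
                     - lambda * tau * enorm xi `^ (gamma - tau - 1))))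
        + P xi,
      (* the symbol P is smooth, away from the origin *)
      smooth_on [set xi | xi != 0] P,
      (* K is integrable, and is the convolution kernel of P *)
      cLp (lebesgue_rV d) 1%E K /\
        (forall xi, fourier K xi = (P xi)%:C),
      (* f |-> K * f is the Fourier multiplier with symbol P *)
      forall f : 'rV[R]_d -> R[i], cLp (lebesgue_rV d) 1%E f ->
        forall xi, fourier (convolution K f) xi = (P xi)%:C * fourier f xi
    & (* f |-> K * f is bounded on L^p, 1 <= p <= +oo *)
      exists A : R, forall (p : \bar R) (f : 'rV[R]_d -> R[i]),
        (1 <= p)%E -> cLp (lebesgue_rV d) p f ->
        [/\ {ae lebesgue_rV d, forall x,
               cintegrable (lebesgue_rV d) (fun y => K (x - y) * f y)},
            cLp (lebesgue_rV d) p (convolution K f)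
          & (cLnorm (lebesgue_rV d) p (convolution K f)
             <= A%:E * cLnorm (lebesgue_rV d) p f)%E] ].
Proof.
exists (Gamma_fun beta)^-1; split; first by rewrite invr_gt0 Gamma_fun_gt0.
move=> d gamma lambda _ g1 g2 l1.
exists (fun xi => remainder_symbol beta gamma lambda (enorm xi)),
  (fun x => (remainder_kernel beta gamma lambda x)%:C).
have ki := integrable_remainder_kernel beta_gt0 g1 g2 l1 d.
have kcos := remainder_kernel_cos beta_gt0 g1 g2 l1 (d := d).
have ksin := remainder_kernel_sin beta_gt0 g1 g2 l1 (d := d).
split.
- by move=> xi; apply: decomposition_symbol => //; exact: sqrtr_ge0.
- exact: smooth_remainder_symbol.
- split; first exact: cLp_real_kernel.
  by move=> xi; exact: (fourier_real_kernel ki (kcos xi) (ksin xi)).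
- by move=> f f1 xi; exact: (fourier_convolution ki (kcos xi) (ksin xi) f1).
- exact: convolution_Lp.
Qed.
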